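(* Let $X$ be an infinite-dimensional separable real Banach space endowed with a centered non-degenerate Gaussian measure $\gamma$, with Cameron–Martin space $H$, and let $\Omega\subset X$ be a nonempty open convex set. For each $\varphi\in W^{1,2}(\Omega,\gamma)$, $$\int_\Omega|\varphi-m_\Omega(\varphi)|^2\,d\gamma\leq\int_\Omega|\nabla_H\varphi|_H^2\,d\gamma,\qquad\text{where } m_{\Omega}(\varphi)=\frac{1}{\gamma(\Omega)}\int_\Omega\varphi\, d\gamma .$$
   Context: Cameron–Martin space: $X^*_\gamma$ is the closure of $X^*$ in $L^2(X,\gamma)$; $R_\gamma:X^*_\gamma\to X$ is determined by $g(R_\gamma f)=\int_X f g\,d\gamma$ for all $g\in X^*$; $H=R_\gamma(X^*_\gamma)$. For $h\in H$, $\hat h\in X^*_\gamma$ is the element with $h=R_\gamma\hat h$, and $\langle h,k\rangle_H=\int_X\hat h\,\hat k\,d\gamma$. $H$ is a separable Hilbert space continuously embedded in $X$. Cylindrical functions: $\mathcal{F}C^k_b(X)$ is the set of functions $f(x)=\varphi(l_1(x),\ldots,l_n(x))$ with $n\in\mathbb N$, $\varphi\in C^k_b(\mathbb R^n)$, $l_i\in X^*$; $\mathcal{F}C^k_b(X)_{|\Omega}$ is the set of their restrictions to $\Omega$. For $f\in\mathcal{F}C^1_b(X)$, $\nabla_H f(x)$ is the unique $y\in H$ with $\langle y,h\rangle_H=f'(x)h$ for all $h\in H$. Sobolev space: the operator $\nabla_H:\mathcal{F}C^1_b(X)_{|\Omega}\to L^2(\Omega,\gamma;H)$ is closable in $L^2(\Omega,\gamma)$;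 its closure is still denoted $\nabla_H$ and the domain of the closure is $W^{1,2}(\Omega,\gamma)$, with norm $\|f\|^2=\int_\Omega f^2d\gamma+\int_\Omega|\nabla_Hf|_H^2d\gamma$. *)

(* Defs.v *)
From HB Require Import structures.
From mathcomp Require Import all_boot all_order all_algebra.
From mathcomp Require Import all_classical all_reals all_analysis.

Set Implicit Arguments.
Unset Strict Implicit.
Unset Printing Implicit Defensive.

Import Order.TTheory GRing.Theory Num.Theory.
Import numFieldNormedType.Exports.

Local Open Scope classical_set_scope.
Local Open Scope ring_scope.

Definition separable (T : topologicalType) :=
  exists D : set T, countable D /\ dense D.

Definition infinite_dimensional (R : realType) (X : lmodType R) :=
  forall (n : nat) (b : 'I_n -> X),
    exists x : X, forall c : 'I_n -> R, x <> \sum_(i < n) c i *: b i.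

(* [borel X] is convertible to [X], so that functions on and subsets of one are
   functions on and subsets of the other. *)
Definition borel (R : realType) (X : normedModType R) :=
  g_sigma_algebraType (@open X).

Definition top_dual (R : realType) (X : normedModType R) : set (X -> R) :=
  [set l : X -> R | linear (l : X -> R^o) /\ continuous l].

Section GaussianSpace.
Context (R : realType) (X : completeNormedModType R).
Variable gamma : probability (borel X) R.

(* The Dirac mass is a separate case: the library's [normal_prob 0 0] is the
   uniform law on [0, 1]. *)
Definition centered_gaussian :=
  forall l : X -> R, top_dual l ->
    (exists2 sigma : R, 0 < sigma &
       forall A : set R, measurable A ->
         pushforward gamma (l : borel X -> R) A = normal_prob 0 sigma A) \/
    (forall A : set R, measurable A ->
       pushforward gamma (l : borel X -> R) A = \d_(0 : R) A).

Definition nondegenerate_measure :=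
  forall l : X -> R, top_dual l -> (exists x, l x != 0) ->
    ~ (exists c : R, forall A : set R, measurable A ->
         pushforward gamma (l : borel X -> R) A = \d_c A).

(* Elements of L^2 are represented by functions, not by classes. *)
Definition L2 (Omega : set X) (f : X -> R) :=
  measurable_fun (Omega : set (borel X)) (f : borel X -> R) /\
  (\int[gamma]_(x in Omega) ((f x) ^+ 2)%:E < +oo)%E.

(* X^*_gamma, the closure of the dual in L^2(X, gamma). *)
Definition dual_closure : set (X -> R) :=
  [set f | L2 setT f /\
    forall e : R, 0 < e -> exists2 l, top_dual l &
      (\int[gamma]_x ((f x - l x) ^+ 2)%:E < e%:E)%E].

(* [is_Rgamma f h] stands for h = R_gamma f. *)
Definition is_Rgamma (f : X -> R) (h : X) :=
  forall g, top_dual g -> g h = \int[gamma]_x (f x * g x).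

Definition cameron_martin : set X :=
  [set h | exists2 f, dual_closure f & is_Rgamma f h].

(* For h outside of the Cameron-Martin space this is a default value. *)
Definition cm_hat (h : X) : X -> R :=
  get [set f | dual_closure f /\ is_Rgamma f h].

Definition cm_dot (h k : X) : R := \int[gamma]_x (cm_hat h x * cm_hat k x).

Definition cm_norm (h : X) : R := Num.sqrt (cm_dot h h).

Definition cm_open (U : set X) :=
  U `<=` cameron_martin /\
  forall h, U h -> exists2 r : R, 0 < r &
    forall k, cameron_martin k -> cm_norm (k - h) < r -> U k.

(* L^2(Omega, gamma; H); Borel measurability with respect to the topology of H,
   which is strong measurability because H is separable. *)
Definition L2H (Omega : set X) (Y : X -> X) :=
  [/\ forall x, Omega x -> cameron_martin (Y x),
      forall U, cm_open U ->
        measurable (Omega `&` Y @^-1` U : set (borel X)) &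
      (\int[gamma]_(x in Omega) ((cm_norm (Y x)) ^+ 2)%:E < +oo)%E].

Definition C1b (n : nat) (phi : 'rV[R]_n -> R^o) :=
  [/\ bounded_fun phi,
      forall y, differentiable phi y &
      forall i : 'I_n, continuous ('D_(delta_mx 0 i) phi) /\
                       bounded_fun ('D_(delta_mx 0 i) phi)].

Definition FC1b (f : X -> R) :=
  exists (n : nat) (phi : 'rV[R]_n -> R^o) (l : 'I_n -> X -> R),
    [/\ C1b phi, forall i, top_dual (l i) &
        forall x, f x = phi (\row_i l i x)].

(* The Riesz representative in H of the restriction to H of f'(x). *)
Definition cyl_gradH (f : X -> R) (x : X) : X :=
  get [set y | cameron_martin y /\
    forall h, cameron_martin h -> cm_dot y h = 'd (f : X -> R^o) x h].

(* The graph of the closure, in L^2(Omega, gamma) x L^2(Omega, gamma; H), of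
   the operator [cyl_gradH] defined on restrictions to Omega. *)
Definition gradH_graph (Omega : set X) (phi : X -> R) (Y : X -> X) :=
  [/\ L2 Omega phi, L2H Omega Y &
      exists u : nat -> X -> R,
        [/\ forall n, FC1b (u n),
            (\int[gamma]_(x in Omega) ((u n x - phi x) ^+ 2)%:E)%E
              @[n --> \oo] --> 0%E &
            (\int[gamma]_(x in Omega)
               ((cm_norm (cyl_gradH (u n) x - Y x)) ^+ 2)%:E)%E
              @[n --> \oo] --> 0%E]].

Definition W12 (Omega : set X) : set (X -> R) :=
  [set phi | exists Y, gradH_graph Omega phi Y].

(* Closability makes the value unique gamma-a.e. in Omega. *)
Definition gradH (Omega : set X) (phi : X -> R) : X -> X :=
  get (gradH_graph Omega phi).

Definition mean (Omega : set X) (phi : X -> R) : R :=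
  (fine (gamma Omega))^-1 * \int[gamma]_(x in Omega) phi x.

End GaussianSpace.

(* Main.v *)
Require Import Defs.
From HB Require Import structures.
From mathcomp Require Import all_boot all_order all_algebra.
From mathcomp Require Import all_classical all_reals all_analysis measurable_realfun.
From mathcomp Require Import ring lra zify.
Import Order.TTheory GRing.Theory Num.Theory.
Import numFieldNormedType.Exports.
Local Open Scope classical_set_scope.
Local Open Scope ring_scope.
Set Implicit Arguments.
Unset Strict Implicit.
Unset Printing Implicit Defensive.

(** The inequality is first proved for the standard Gaussian measure of R^m
    and a convex set K. The Gaussian density p satisfies
    p(x) p(y) = p((x+y)/2)^2 exp(-|x-y|^2/4), so the Prekopa-Leindler inequality
    for Lebesgue measure becomes, for Gaussian expectations,
    E u * E v <= (E w)^2 as soon as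
    u(x) v(y) <= w((x+y)/2)^2 exp(|x-y|^2/4)
    ([prekopa_leindler_gauss]). Take w = 1_K, v = exp(-e g) 1_K and
    u = exp(e g - e^2 |grad g|^2) 1_K. Convexity of K puts the midpoint in K, and
    for y near x the hypothesis is e (g(x) - g(y)) <= e^2 |grad g(x)|^2 + |x-y|^2/4,
    which follows from g(x) - g(y) ~ grad g(x).(x-y) and 2ab <= a^2 + b^2. The
    coefficient of e^2 in the resulting inequality is exactly
    E 1_K * E(g^2 1_K) - E(g 1_K)^2 <= E 1_K * E(|grad g|^2 1_K)
    ([poincare_gauss]).

    A cylindrical function together with a polyhedron of X only sees finitely many
    continuous functionals. Gram-Schmidt in L^2(gamma), where non-degeneracy turns
    almost sure relations between functionals into identities
    ([orthonormal_basis]), writes all of them as combinations of orthonormal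
    functionals xi_1, ..., xi_m. Since every combination of the xi_k is a centered
    normal variable, the vector (xi_k) has the standard Gaussian law; this is read
    off from the integrals of cos(sum_k a_k xi_k + b) ([gauss_law]). The
    H-gradient of f = phi(l_1, ..., l_n) is sum_i d_i phi R_gamma(l_i), and
    <R_gamma l_i, R_gamma l_j>_H is the integral of l_i l_j, so |grad_H f|^2 is the
    squared Euclidean norm of the gradient in the coordinates xi_k. Hence the
    inequality for polyhedra ([poincare_polyhedron]). The vector R_gamma(l)
    is the integral of l(x) x against gamma, a limit of Riemann sums which converge
    in X because the variances of the functionals of norm at most 1 are uniformly
    bounded ([Rgamma_exists]).

    By Hahn-Banach and separability, an open convex set is an increasing union of
    countable intersections of closed half-spaces ([open_convex_halfspaces]), so
    bounded convergence carries the inequality from polyhedra to Omega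
    ([poincare_convex]). Finally, for phi in W^{1,2} with approximating cylindrical
    functions u_n, both sides are controlled along u_n by the two convergences that
    define the closure of the gradient ([poincare_graph]). *)

(** * The Brunn-Minkowski inequality on the line *)

Section brunn_minkowski_line.
Variable R : realType.
Notation mu := (@lebesgue_measure R).
Implicit Types A B C : set R.

Lemma measurable_double (b : R) :
  measurable_fun [set: measurableTypeR R]
    (fun z : measurableTypeR R => (2 * z - b : measurableTypeR R)).
Proof. by apply: measurable_funB => //; exact: measurable_funM. Qed.

(** Both sides are measures in A, and they agree on intervals. *)
Lemma lebesgue_measure_half A (b : R) : measurable A ->
  (mu A = 2%:E * mu ((fun z => (2 * z - b)%R) @^-1` A))%E.
Proof.
move=> mA.
pose nu := (mscale (NngNum (ler0n R 2))
  (@pushforward _ _ (measurableTypeR R) (measurableTypeR R) _ mu (fun z : R => 2 * z - b))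
  : {measure set (measurableTypeR R) -> \bar R}).
apply: (@lebesgue_measure_unique R (nu (measurable_double b)) _ A mA).
move=> X [[x y] _ <-] /=.
rewrite /nu /mscale /= /pushforward /=.
have -> : (fun z : R => 2 * z - b) @^-1` `]x, y]%classic = `](x + b) / 2, (y + b) / 2]%classic.
  by apply/seteqP; split=> z /=; rewrite !in_itv/= => /andP[h1 h2]; apply/andP; split; lra.
rewrite !lebesgue_measure_itv/= !lte_fin.
have -> : ((x + b) / 2 < (y + b) / 2) = (x < y) by apply/idP/idP => h; lra.
case: ifPn => _; last by rewrite mule0.
by rewrite -!EFinD -EFinM; congr (_%:E); lra.
Qed.

(** The sets (a + B `&` [b, +oo[)/2 and (A `&` ]-oo, a] + b)/2 are both in C and
    lie on opposite sides of (a + b)/2, so their measures add up. *)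
Lemma brunn_minkowski_ray A B C a b : measurable A -> measurable B ->
  measurable C -> A a -> B b ->
  (forall x y, A x -> B y -> C ((x + y) / 2)) ->
  (mu (A `&` `]-oo, a]) + mu (B `&` `[b, +oo[) <= 2%:E * mu C)%E.
Proof.
move=> mA mB mC Aa Bb ABC.
(* Dropping the point b makes the two halves disjoint. *)
have -> : mu (B `&` `[b, +oo[) = mu (B `&` `]b, +oo[).
  apply/eqP; rewrite eq_le; apply/andP; split; last first.
    apply: le_measure; rewrite ?inE; [exact: measurableI|exact: measurableI|].
    by apply: setIS => z /=; rewrite !in_itv/= !andbT => /ltW.
  apply: (@le_trans _ _ (mu ((B `&` `]b, +oo[) `|` [set b]))).
    apply: le_measure; rewrite ?inE.
    - exact: measurableI.
    - by apply: measurableU => //; exact: measurableI.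
    - move=> z [Bz] /=; rewrite !in_itv/= !andbT le_eqVlt => /orP[/eqP <-|bz].
        by right.
      by left; split => //=; rewrite in_itv/= bz.
  apply: le_trans (measureU2 _ _ _) _ => //; first exact: measurableI.
  by rewrite [X in (_ + X)%E](_ : _ = 0%E) ?adde0//; exact: lebesgue_measure_set1.
rewrite (lebesgue_measure_half b); last exact: measurableI.
rewrite [X in (_ + X)%E](lebesgue_measure_half a); last exact: measurableI.
rewrite -ge0_muleDr// lee_pmul2l//.
set A1 := _ @^-1` (A `&` _); set B1 := _ @^-1` (B `&` _).
have mA1 : measurable A1.
  by rewrite -[A1]setTI; apply: measurable_double => //; exact: measurableI.
have mB1 : measurable B1.
  by rewrite -[B1]setTI; apply: measurable_double => //; exact: measurableI.
rewrite -measureU//; last first.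
  apply/seteqP; split => // z [[_ h1] [_ h2]]; move: h1 h2.
  by rewrite /= !in_itv/= andbT => h1 h2; exfalso; lra.
apply: le_measure; rewrite ?inE//; first exact: measurableU.
move=> z [[h _]|[h _]].
  by have := ABC _ _ h Bb; congr C; lra.
by have := ABC _ _ Aa h; congr C; lra.
Qed.

(** A compact subset of A has a last point and a compact subset of B a first one.
    At these points [brunn_minkowski_ray] sees the whole of both sets; inner
    regularity does the rest. *)
Lemma brunn_minkowski_line A B C : measurable A -> measurable B ->
  measurable C -> A !=set0 -> B !=set0 ->
  (forall x y, A x -> B y -> C ((x + y) / 2)) ->
  (mu A + mu B <= 2%:E * mu C)%E.
Proof.
move=> mA mB mC [a0 Aa0] [b0 Bb0] ABC.
have Ny Z : (mu Z != -oo)%E.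
  by rewrite gt_eqF// (lt_le_trans _ (measure_ge0 _ _))// ltNy0.
have HA b : B b -> (mu A + mu (B `&` `[b, +oo[) <= 2%:E * mu C)%E.
  move=> Bb.
  have [foo|] := ltP (mu (B `&` `[b, +oo[)) +oo%E; last first.
    rewrite leye_eq => /eqP E.
    have := brunn_minkowski_ray mA mB mC Aa0 Bb ABC.
    by rewrite E addey// leye_eq => /eqP ->; exact: leey.
  rewrite -leeBrDr ?ge0_fin_numE//.
  rewrite lebesgue_regularity_inner_sup//; apply: ge_ereal_sup => _ [K [cK KA] <-].
  have [->|/set0P K0] := eqVneq K set0.
    rewrite measure0 leeBrDr ?ge0_fin_numE// add0e.
    apply: le_trans (brunn_minkowski_ray mA mB mC Aa0 Bb ABC).
    by rewrite leeDr.
  have [k Kk kmax] : exists2 c, K c & forall t, K t -> t <= c.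
    have cid : {within K, continuous (id : R -> R)}.
      by apply: continuous_subspaceT => x; exact: cvg_id.
    have [c /set_mem Kc h] := compact_EVT_max K0 cK cid.
    by exists c => // t Kt; apply: h; rewrite inE.
  rewrite leeBrDr ?ge0_fin_numE//.
  apply: le_trans (brunn_minkowski_ray mA mB mC (KA _ Kk) Bb ABC).
  rewrite leeD2r//; apply: le_measure; rewrite ?inE.
  - exact: compact_measurable.
  - exact: measurableI.
  - by move=> t Kt; split; [exact: KA|rewrite /= in_itv/= kmax].
have [foo|] := ltP (mu A) +oo%E; last first.
  rewrite leye_eq => /eqP E.
  by have := HA _ Bb0; rewrite E addye// leye_eq => /eqP ->; exact: leey.
rewrite -leeBrDl ?ge0_fin_numE//.
rewrite lebesgue_regularity_inner_sup//; apply: ge_ereal_sup => _ [K [cK KB] <-].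
have [->|/set0P K0] := eqVneq K set0.
  rewrite measure0 leeBrDl ?ge0_fin_numE// adde0.
  by apply: le_trans (HA _ Bb0); rewrite leeDl.
have [k Kk kmin] : exists2 c, K c & forall t, K t -> c <= t.
  have cid : {within K, continuous (id : R -> R)}.
    by apply: continuous_subspaceT => x; exact: cvg_id.
  have [c /set_mem Kc h] := compact_EVT_min K0 cK cid.
  by exists c => // t Kt; apply: h; rewrite inE.
rewrite leeBrDl ?ge0_fin_numE//.
apply: le_trans (HA _ (KB _ Kk)).
rewrite leeD2l//; apply: le_measure; rewrite ?inE.
- exact: compact_measurable.
- exact: measurableI.
- by move=> t Kt; split; [exact: KB|rewrite /= in_itv/= kmin].
Qed.

End brunn_minkowski_line.

(** * The Prekopa-Leindler inequality on the line *)

Section prekopa_leindler_line.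
Variable R : realType.
Notation mu := (@lebesgue_measure R).
Implicit Types u v w : R -> R.

Definition hypograph (u : R -> R) : set (R * R) :=
  [set z | 0 <= z.2 < u z.1].

Lemma measurable_hypograph u : measurable_fun setT u -> measurable (hypograph u).
Proof.
move=> mu_.
have -> : hypograph u = (snd @^-1` `[0%R, +oo[) `&` ((fun z => u z.1 - z.2) @^-1` `]0%R, +oo[).
  apply/seteqP; split=> z /=; rewrite !in_itv/= !andbT.
    by move=> /andP[h1 h2]; split=> //; rewrite subr_gt0.
  by move=> [h1]; rewrite subr_gt0 => h2; apply/andP.
apply: measurableI; first by rewrite -[X in measurable X]setTI; exact: measurable_snd.
rewrite -[X in measurable X]setTI.
by apply: (measurable_funB (measurableT_comp mu_ measurable_fst) measurable_snd).
Qed.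

(** The two iterated integrals of the indicator of the hypograph. *)
Lemma layer_cake u : measurable_fun setT u -> (forall x, 0 <= u x) ->
  (\int[mu]_x (u x)%:E = \int[mu]_t mu [set x | (0 <= t < u x)%R])%E.
Proof.
move=> mu_ u0.
have mA : measurable (hypograph u : set (measurableTypeR R * measurableTypeR R)).
  exact: measurable_hypograph.
have := indic_fubini_tonelli mu mu mA.
rewrite (indic_fubini_tonelli_FE mu mA) (indic_fubini_tonelli_GE mu mA) => E.
rewrite (_ : (fun t : R => mu [set x | 0 <= t < u x]) = mu \o ysection (hypograph u)); last first.
  apply/funext => t /=; congr (mu _).
  by apply/seteqP; split => x /=; rewrite /ysection/= inE.
rewrite -E; apply: eq_integral => x _ /=.
have -> : xsection (hypograph u) x = `[0, u x[%classic.
  by apply/seteqP; split => t /=; rewrite /xsection/= inE /hypograph/= in_itv/=.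
rewrite lebesgue_measure_itv/= lte_fin; case: ltP => h; first by rewrite -EFinB subr0.
by congr (_%:E); apply/eqP; rewrite eq_le h u0.
Qed.

Lemma measurable_layer u : measurable_fun setT u ->
  measurable_fun setT (fun t : R => mu [set x | (0 <= t < u x)%R]).
Proof.
move=> mu_.
rewrite (_ : (fun t : R => mu [set x | 0 <= t < u x]) = mu \o ysection (hypograph u)); last first.
  apply/funext => t /=; congr (mu _).
  by apply/seteqP; split => x /=; rewrite /ysection/= inE.
have mA : measurable (hypograph u : set (measurableTypeR R * measurableTypeR R)).
  exact: measurable_hypograph.
exact: measurable_fun_ysection mA.
Qed.

Lemma measurable_superlevel u (t : R) : measurable_fun setT u ->
  measurable [set x | (0 <= t < u x)%R].
Proof.
move=> mu_; rewrite (_ : [set _ | _] = ysection (hypograph u) t); last first.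
  by apply/seteqP; split => x /=; rewrite /ysection/= inE.
exact: measurable_ysection (measurable_hypograph mu_).
Qed.

(** For u and v of supremum 1 the superlevel sets at every t < 1 are nonempty and
    their midpoints lie in the superlevel set of w, so [brunn_minkowski_line] can
    be integrated over t. *)
Lemma prekopa_leindler_sup1 (u v w : R -> R) :
  measurable_fun setT u -> measurable_fun setT v -> measurable_fun setT w ->
  (forall x, 0 <= u x <= 1) -> (forall x, 0 <= v x <= 1) -> (forall x, 0 <= w x) ->
  (forall t, t < 1 -> exists x, t < u x) -> (forall t, t < 1 -> exists x, t < v x) ->
  (forall x y, u x * v y <= w ((x + y) / 2) ^+ 2) ->
  (\int[mu]_x (u x)%:E + \int[mu]_x (v x)%:E <= 2%:E * \int[mu]_x (w x)%:E)%E.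
Proof.
move=> mu_ mv mw u01 v01 w0 us vs uvw.
have u0 x : 0 <= u x by case/andP: (u01 x).
have v0 x : 0 <= v x by case/andP: (v01 x).
rewrite !layer_cake// -ge0_integralD//; try exact: measurable_layer.
rewrite -ge0_integralZl//; last exact: measurable_layer.
apply: ge0_le_integral => //.
- by move=> t _; rewrite adde_ge0.
- by apply: emeasurable_funD; exact: measurable_layer.
- by apply: measurable_funeM; apply: measurable_layer.
move=> t _.
have [/andP[t0 t1]|] := boolP (0 <= t < 1).
  apply: brunn_minkowski_line; try exact: measurable_superlevel.
  - by have [x h] := us _ t1; exists x => /=; rewrite t0.
  - by have [x h] := vs _ t1; exists x => /=; rewrite t0.
  - move=> x y /= /andP[_ h1] /andP[_ h2]; rewrite t0/=.
    rewrite -(ltr_pXn2r (n := 2))// ?nnegrE//.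
    apply: lt_le_trans (uvw x y).
    by rewrite expr2; apply: ltr_pM.
move=> nt.
have E (f : R -> R) : (forall x, 0 <= f x <= 1) -> [set x : R | 0 <= t < f x] = set0.
  move=> f01; apply/seteqP; split => // x /= /andP[h1 h2].
  move: nt; rewrite h1/= -leNgt => h3; have /andP[_ h4] := f01 x.
  by exfalso; lra.
have E0 (f : R -> R) : (forall x, 0 <= f x <= 1) -> mu [set x : R | 0 <= t < f x] = 0%E.
  by move=> f01; rewrite (E f f01); exact: measure0.
by rewrite (E0 u u01) (E0 v v01) adde0 mule_ge0.
Qed.

(** After division by the suprema a and b of u and v, and of w by sqrt(ab), the
    sum form [prekopa_leindler_sup1] gives the product form by the inequality of
    arithmetic and geometric means. *)
Lemma prekopa_leindler_line (u v w : R -> R) (M : R) :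
  measurable_fun setT u -> measurable_fun setT v -> measurable_fun setT w ->
  (forall x, 0 <= u x <= M) -> (forall x, 0 <= v x <= M) -> (forall x, 0 <= w x) ->
  mu.-integrable setT (EFin \o u) -> mu.-integrable setT (EFin \o v) ->
  mu.-integrable setT (EFin \o w) ->
  (forall x y, u x * v y <= w ((x + y) / 2) ^+ 2) ->
  (\int[mu]_x u x) * (\int[mu]_x v x) <= (\int[mu]_x w x) ^+ 2.
Proof.
move=> mu_ mv mw u0M v0M w0 iu iv iw uvw.
have supP (f : R -> R) : (forall x, 0 <= f x <= M) -> measurable_fun setT f ->
    mu.-integrable setT (EFin \o f) ->
    (\int[mu]_x f x = 0) \/ exists2 a, 0 < a & (forall x, f x <= a) /\
      (forall t, t < 1 -> exists x, t < f x / a).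
  move=> f0M mf fi; pose a := sup (range f).
  have hs : has_sup (range f).
    split; first by exists (f 0); exists 0.
    by exists M => _ [x _ <-]; case/andP: (f0M x).
  have fa x : f x <= a by apply: sup_ubound; [exact: hs.2|exists x].
  have a0 : 0 <= a by apply: le_trans (fa 0); case/andP: (f0M 0).
  move: a0; rewrite le_eqVlt => /orP[/eqP a0|a0]; [left|right].
    rewrite (_ : f = cst 0) ?Rintegral_cst ?mul0r//.
    apply/funext => x; apply/eqP; rewrite eq_le {1}a0 fa/=.
    by case/andP: (f0M x).
  exists a => //; split => // t t1.
  have ta : t * a < a by rewrite -[ltRHS]mul1r ltr_pM2r.
  have [_ [x _ <-] h] := sup_gt hs.1 ta.
  by exists x; rewrite ltr_pdivlMr.
have [->|[a a0 [ua us]]] := supP u u0M mu_ iu; first by rewrite mul0r sqr_ge0.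
have [->|[b b0 [vb vs]]] := supP v v0M mv iv; first by rewrite mulr0 sqr_ge0.
pose s := Num.sqrt (a * b).
have s0 : 0 < s by rewrite sqrtr_gt0 mulr_gt0.
have s2 : s ^+ 2 = a * b by rewrite sqr_sqrtr// mulr_ge0 ?ltW.
have nn (f : R -> R) c : (forall x, 0 <= f x <= M) -> (forall x, f x <= c) -> 0 < c ->
    forall x, 0 <= f x / c <= 1.
  move=> h1 h2 c0 x; have /andP[h3 _] := h1 x.
  by rewrite divr_ge0 ?(ltW c0)//= ler_pdivrMr// mul1r.
have IE (f : R -> R) c : mu.-integrable setT (EFin \o f) ->
   (\int[mu]_x (f x / c)%:E = ((\int[mu]_x f x) / c)%:E)%E.
  move=> fi.
  under eq_integral do rewrite EFinM.
  rewrite integralZr// EFinM; congr (_ * _)%E.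
  by rewrite /Rintegral fineK//; exact: integrable_fin_num.
have := @prekopa_leindler_sup1 (fun x => u x / a) (fun x => v x / b) (fun x => w x / s).
rewrite !IE// => H.
have {}H : (\int[mu]_x u x) / a + (\int[mu]_x v x) / b <= 2 * ((\int[mu]_x w x) / s).
  rewrite -lee_fin EFinD EFinM; apply: H.
  - by apply: measurable_funM.
  - by apply: measurable_funM.
  - by apply: measurable_funM.
  - exact: nn.
  - exact: nn.
  - by move=> x; rewrite divr_ge0// ltW.
  - exact: us.
  - exact: vs.
  - move=> x y; rewrite expr_div_n s2.
    rewrite mulrACA -invfM ler_pM2r ?invr_gt0 ?mulr_gt0//.
have U0 : 0 <= \int[mu]_x u x by apply: Rintegral_ge0 => x _; case/andP: (u0M x).
have V0 : 0 <= \int[mu]_x v x by apply: Rintegral_ge0 => x _; case/andP: (v0M x).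
move: H U0 V0; set U := \int[mu]_x u x; set V := \int[mu]_x v x; set W := \int[mu]_x w x.
move=> H U0 V0.
have U0' : 0 <= U / a by rewrite divr_ge0// ltW.
have V0' : 0 <= V / b by rewrite divr_ge0// ltW.
have H2 : (U / a) * (V / b) <= (W / s) ^+ 2.
  apply: (@le_trans _ _ (((U / a + V / b) / 2) ^+ 2)).
    have amgm (p q : R) : p * q <= ((p + q) / 2) ^+ 2.
      by have := sqr_ge0 (p - q); rewrite !expr2; lra.
    exact: amgm.
  have W0' : 0 <= W / s.
    by rewrite divr_ge0 ?(ltW s0)//; apply: Rintegral_ge0.
  have UV0 : 0 <= (U / a + V / b) / 2 by rewrite divr_ge0// addr_ge0.
  by rewrite ler_sqr ?nnegrE//; lra.
move: H2; rewrite expr_div_n s2 mulrACA -invfM ler_pM2r ?invr_gt0 ?mulr_gt0//.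
Qed.

End prekopa_leindler_line.

(** * Integration against normal laws *)

Section normal_density.
Variable R : realType.
Notation mu := (@lebesgue_measure R).
Variables m s : R.

(** The change of variables formula is stated for an abstract Radon-Nikodym
    derivative, which this identifies. *)
Lemma normal_Radon_Nikodym_ae :
  ae_eq mu setT (Radon_Nikodym_SigmaFinite.f (normal_prob m s) mu)
    (fun x => (normal_pdf m s x)%:E).
Proof.
have dom := normal_prob_dominates m s.
apply: integral_ae_eq => //=.
- exact: Radon_Nikodym_SigmaFinite.f_integrable.
- by apply/measurable_EFinP; exact: measurable_normal_pdf.
- by move=> E _ mE; rewrite -Radon_Nikodym_SigmaFinite.f_integral.
Qed.

Lemma ge0_integral_normal (f : R -> \bar R) : measurable_fun setT f ->
  (forall x, 0 <= f x)%E ->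
  (\int[normal_prob m s]_x f x = \int[mu]_x (f x * (normal_pdf m s x)%:E))%E.
Proof.
move=> mf f0; have dom := normal_prob_dominates m s.
rewrite -(Radon_Nikodym_SigmaFinite.change_of_variables dom)//=.
apply: ae_eq_integral => //.
- apply: emeasurable_funM => //; apply: (measurable_int mu).
  exact: Radon_Nikodym_SigmaFinite.f_integrable.
- apply: emeasurable_funM => //=; apply/measurable_EFinP.
  exact: measurable_normal_pdf.
- by apply: ae_eqe_mul2l; exact: normal_Radon_Nikodym_ae.
Qed.

Lemma integrable_normal (f : R -> R) : measurable_fun setT f ->
  (normal_prob m s).-integrable setT (EFin \o f) ->
  mu.-integrable setT (fun x => (f x * normal_pdf m s x)%:E).
Proof.
move=> mf /integrableP[_ fi]; apply/integrableP; split.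
  by apply/measurable_EFinP; apply: measurable_funM => //; exact: measurable_normal_pdf.
move: fi; rewrite ge0_integral_normal//=; last first.
  by apply/measurable_EFinP; exact: measurableT_comp.
under eq_integral do rewrite -EFinM.
by under [X in _ -> (X < _)%E]eq_integral do
  rewrite normrM (ger0_norm (normal_pdf_ge0 _ _ _)).
Qed.

Lemma integral_normal (f : R -> R) : measurable_fun setT f ->
  (\int[normal_prob m s]_x (f x)%:E = \int[mu]_x (f x * normal_pdf m s x)%:E)%E.
Proof.
move=> mf; have mfE : measurable_fun setT (EFin \o f) by exact/measurable_EFinP.
rewrite [LHS]integralE [RHS]integralE !ge0_integral_normal//.
- congr (_ - _)%E; apply: eq_integral => x _.
  + rewrite !funeposE -EFin_max -EFinM -EFin_max; congr (_%:E).
    by rewrite maxr_pMl ?normal_pdf_ge0// mul0r.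
  + rewrite !funenegE -EFinN -EFin_max -EFinM -EFinN -EFin_max; congr (_%:E).
    by rewrite maxr_pMl ?normal_pdf_ge0// mul0r mulNr.
- exact: measurable_funeneg.
- exact: measurable_funepos.
Qed.

End normal_density.

(** * Bounded measurable functions and tensorization *)

Section bounded_measurable.
Context d (T : measurableType d) (R : realType).
Implicit Types f g : T -> R.

(** These functions are stable under all the operations below and integrable
    against every finite measure, which removes all integrability side conditions. *)
Definition bounded_measurable f :=
  measurable_fun setT f /\ exists M, forall x, `|f x| <= M.

Lemma bounded_measurable_integrable (P : {finite_measure set T -> \bar R}) f :
  bounded_measurable f -> P.-integrable setT (EFin \o f).
Proof.
move=> [mf [M fM]]; apply: measurable_bounded_integrable => //.
  by rewrite ltey_eq fin_num_measure.
exists M; split; first exact: num_real.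
by move=> x xM t _; apply: le_trans (fM t) _; exact: ltW.
Qed.

Lemma bounded_measurable_cst c : bounded_measurable (cst c : T -> R).
Proof. by split => //; exists `|c|. Qed.

Lemma bounded_measurableD f g : bounded_measurable f -> bounded_measurable g ->
  bounded_measurable (fun x => f x + g x).
Proof.
move=> [mf [M fM]] [mg [N gN]]; split; first exact: measurable_funD.
by exists (M + N) => x; apply: le_trans (ler_normD _ _) _; exact: lerD.
Qed.

Lemma bounded_measurableM f g : bounded_measurable f -> bounded_measurable g ->
  bounded_measurable (fun x => f x * g x).
Proof.
move=> [mf [M fM]] [mg [N gN]]; split; first exact: measurable_funM.
by exists (M * N) => x; rewrite normrM; exact: ler_pM.
Qed.

Lemma bounded_measurableN f : bounded_measurable f ->
  bounded_measurable (fun x => - f x).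
Proof.
move=> [mf [M fM]]; split; first exact: measurableT_comp.
by exists M => x; rewrite normrN.
Qed.

Lemma bounded_measurableB f g : bounded_measurable f -> bounded_measurable g ->
  bounded_measurable (fun x => f x - g x).
Proof. by move=> bf bg; apply: bounded_measurableD => //; exact: bounded_measurableN. Qed.

Lemma bounded_measurable_indic (A : set T) : measurable A ->
  bounded_measurable (\1_A : T -> R).
Proof.
move=> mA; split; first exact: measurable_indic.
by exists 1 => x; rewrite indicE; case: (_ \in _); rewrite ?normr1 ?normr0.
Qed.

Lemma Rintegral_EFin (P : {finite_measure set T -> \bar R}) f :
  bounded_measurable f -> (\int[P]_x (f x)%:E = (\int[P]_x f x)%:E)%E.
Proof.
move=> bf; rewrite /Rintegral fineK//.
by apply: integrable_fin_num => //; exact: bounded_measurable_integrable.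
Qed.

End bounded_measurable.

Lemma bounded_measurable_comp d (T : measurableType d) d' (T' : measurableType d')
    (R : realType) (f : T' -> R) (g : T -> T') :
  bounded_measurable f -> measurable_fun setT g -> bounded_measurable (f \o g).
Proof.
by move=> [mf [M fM]] mg; split; [exact: measurableT_comp|exists M => x /=].
Qed.

Section fubini_bounded.
Context d1 d2 (T1 : measurableType d1) (T2 : measurableType d2) (R : realType).
Variables (P1 : probability T1 R) (P2 : probability T2 R).

Lemma bounded_measurable_section (f : T1 * T2 -> R) (x : T1) :
  bounded_measurable f -> bounded_measurable (fun y => f (x, y)).
Proof. by move=> bf; apply: (bounded_measurable_comp bf); exact: measurable_pair1. Qed.

Lemma bounded_measurable_Rintegral (f : T1 * T2 -> R) :
  bounded_measurable f -> bounded_measurable (fun x => \int[P2]_y f (x, y)).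
Proof.
move=> bf; have [mf [M fM]] := bf; split; last first.
  exists M => x.
  have bx := bounded_measurable_section x bf.
  apply: le_trans (le_normr_Rintegral _ _) _ => //.
    exact: bounded_measurable_integrable.
  have -> : M = \int[P2]_y cst M y.
    by rewrite Rintegral_cst// [X in fine X](@probability_setT _ _ _ P2) mulr1.
  apply: le_Rintegral => //.
  - by apply: bounded_measurable_integrable; split;
      [apply: measurableT_comp; [exact: normr_measurable|exact: bx.1]|
       exists M => y; rewrite normr_id].
  - by apply: bounded_measurable_integrable; exact: bounded_measurable_cst.
pose P12 : probability (T1 * T2)%type R := (P1 \x P2)%E.
have I : (P1 \x P2)%E.-integrable setT (EFin \o f).
  exact: (bounded_measurable_integrable P12).
have := measurable_fubini_F I.
move=> h; apply/measurable_EFinP; apply: eq_measurable_fun h => x _.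
by rewrite /fubini_F/= -Rintegral_EFin//; exact: bounded_measurable_section.
Qed.

Lemma Rintegral_prod (f : T1 * T2 -> R) : bounded_measurable f ->
  \int[(P1 \x P2)%E]_z f z = \int[P1]_x \int[P2]_y f (x, y).
Proof.
move=> bf.
pose P12 : probability (T1 * T2)%type R := (P1 \x P2)%E.
have I : (P1 \x P2)%E.-integrable setT (EFin \o f).
  exact: (bounded_measurable_integrable P12).
have := integral12_prod_meas1 I.
rewrite /fubini_F => E.
rewrite [LHS]/Rintegral -[X in fine X]E [RHS]/Rintegral; congr fine.
apply: eq_integral => x _; rewrite -Rintegral_EFin//.
exact: bounded_measurable_section.
Qed.

End fubini_bounded.

(** The inequality for an abstract midpoint map and cost, the form in which it
    passes to products. For a Gaussian measure the cost is |x - y|^2/4. *)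
Definition prekopa_leindler d (T : measurableType d) (R : realType)
    (P : {measure set T -> \bar R}) (mid : T -> T -> T) (q : T -> T -> R) :=
  forall u v w : T -> R, bounded_measurable u -> bounded_measurable v ->
    bounded_measurable w ->
    (forall x, 0 <= u x) -> (forall x, 0 <= v x) -> (forall x, 0 <= w x) ->
    (forall x y, u x * v y <= w (mid x y) ^+ 2 * expR (q x y)) ->
    (\int[P]_x u x) * (\int[P]_x v x) <= (\int[P]_x w x) ^+ 2.

(** The inequality of the second factor, applied to sections, is the hypothesis of
    the inequality of the first factor for the partial integrals. The cost of the
    first coordinates is a constant there and is absorbed into w. *)
Lemma prekopa_leindler_prod d1 d2 (T1 : measurableType d1) (T2 : measurableType d2)
    (R : realType) (P1 : probability T1 R) (P2 : probability T2 R)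
    mid1 mid2 (q1 : T1 -> T1 -> R) (q2 : T2 -> T2 -> R) :
  prekopa_leindler P1 mid1 q1 -> prekopa_leindler P2 mid2 q2 ->
  prekopa_leindler (P1 \x P2)%E
    (fun x y => (mid1 x.1 y.1, mid2 x.2 y.2)) (fun x y => q1 x.1 y.1 + q2 x.2 y.2).
Proof.
move=> H1 H2 u v w bu bv bw u0 v0 w0 uvw.
rewrite !Rintegral_prod//; apply: H1; try exact: bounded_measurable_Rintegral.
- by move=> x; exact: Rintegral_ge0.
- by move=> x; exact: Rintegral_ge0.
- by move=> x; exact: Rintegral_ge0.
move=> x y; set m := mid1 x y.
pose c := expR (q1 x y / 2).
have c2 : c ^+ 2 = expR (q1 x y).
  by rewrite -expRM_natl; congr expR; lra.
have bwc : bounded_measurable (fun z => w (m, z) * c).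
  apply: bounded_measurableM; last exact: bounded_measurable_cst.
  exact: bounded_measurable_section.
have := H2 (fun z => u (x, z)) (fun z => v (y, z)) (fun z => w (m, z) * c).
rewrite RintegralZr//; last first.
  by apply: bounded_measurable_integrable; exact: bounded_measurable_section.
rewrite exprMn c2; apply => //; try exact: bounded_measurable_section.
- by move=> z; rewrite mulr_ge0// expR_ge0.
- move=> z t; apply: le_trans (uvw _ _) _ => /=.
  by rewrite exprMn c2 expRD mulrA.
Qed.

Section gauss_line.
Variable R : realType.
Notation mu := (@lebesgue_measure R).

Lemma standard_normal_pdfE (x : R) :
  normal_pdf 0 1 x = normal_peak 1 * expR (- x ^+ 2 / 2).
Proof.
by rewrite normal_pdfE ?oner_eq0// /normal_fun subr0 expr1n.
Qed.

(** The parallelogram identity in the exponent. *)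
Lemma standard_normal_pdf_mid (x y : R) :
  normal_pdf 0 1 x * normal_pdf 0 1 y =
  normal_pdf 0 1 ((x + y) / 2) ^+ 2 * expR (- (x - y) ^+ 2 / 4).
Proof.
rewrite !standard_normal_pdfE exprMn -[RHS]mulrA mulrACA -expr2; congr (_ * _).
by rewrite -expRM_natl -!expRD; congr expR; field.
Qed.

(** The Lebesgue inequality for the functions multiplied by the density; the cost
    is what is left over in [standard_normal_pdf_mid]. *)
Lemma prekopa_leindler_normal :
  prekopa_leindler (normal_prob (0 : R) 1) (fun x y => (x + y) / 2)
    (fun x y => (x - y) ^+ 2 / 4).
Proof.
move=> u v w bu bv bw u0 v0 w0 uvw.
have p0 x : 0 <= normal_pdf (0 : R) 1 x by exact: normal_pdf_ge0.
have mp : measurable_fun setT (normal_pdf (0 : R) 1) by exact: measurable_normal_pdf.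
have pb x : normal_pdf (0 : R) 1 x <= normal_peak 1.
  by apply: normal_pdf_ub; rewrite oner_eq0.
have E f : bounded_measurable f ->
    \int[normal_prob (0 : R) 1]_x f x = \int[mu]_x (f x * normal_pdf 0 1 x).
  by move=> [mf _]; rewrite /Rintegral integral_normal.
have I f : bounded_measurable f ->
    mu.-integrable setT (EFin \o (fun x => f x * normal_pdf 0 1 x)).
  move=> bf; apply: integrable_normal; first exact: bf.1.
  exact: bounded_measurable_integrable.
have [mu_ [M uM]] := bu; have [mv [N vN]] := bv; have [mw _] := bw.
rewrite !E//.
apply: (@prekopa_leindler_line R _ _ _ ((M + N) * normal_peak 1)) => //.
- exact: measurable_funM.
- exact: measurable_funM.
- exact: measurable_funM.
- move=> x; rewrite mulr_ge0//=; apply: ler_pM => //.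
  apply: le_trans (ler_norm _) (le_trans (uM x) _).
  by rewrite lerDl; apply: le_trans (vN 0).
- move=> x; rewrite mulr_ge0//=; apply: ler_pM => //.
  apply: le_trans (ler_norm _) (le_trans (vN x) _).
  by rewrite lerDr; apply: le_trans (uM 0).
- by move=> x; rewrite mulr_ge0.
- exact: I.
- exact: I.
- exact: I.
move=> x y; rewrite mulrACA standard_normal_pdf_mid exprMn mulrCA [leRHS]mulrC.
apply: ler_wpM2l; first exact: sqr_ge0.
rewrite mulNr expRN ler_pdivrMr ?expR_gt0//; exact: uvw.
Qed.

End gauss_line.

(** * The standard Gaussian measure in finite dimension *)

Section bounded_integral.
Context d (T : measurableType d) (R : realType).
Variable P : {finite_measure set T -> \bar R}.
Implicit Types f g : T -> R.

Lemma bRintegralD f g : bounded_measurable f -> bounded_measurable g ->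
  \int[P]_x (f x + g x) = \int[P]_x f x + \int[P]_x g x.
Proof. by move=> bf bg; rewrite RintegralD//; exact: bounded_measurable_integrable. Qed.

Lemma bRintegralB f g : bounded_measurable f -> bounded_measurable g ->
  \int[P]_x (f x - g x) = \int[P]_x f x - \int[P]_x g x.
Proof. by move=> bf bg; rewrite RintegralB//; exact: bounded_measurable_integrable. Qed.

Lemma bRintegralZ f c : bounded_measurable f ->
  \int[P]_x (c * f x) = c * \int[P]_x f x.
Proof. by move=> bf; rewrite RintegralZl//; exact: bounded_measurable_integrable. Qed.

Lemma ble_Rintegral f g : bounded_measurable f -> bounded_measurable g ->
  (forall x, f x <= g x) -> \int[P]_x f x <= \int[P]_x g x.
Proof. by move=> bf bg fg; apply: le_Rintegral => //; exact: bounded_measurable_integrable. Qed.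

Lemma bounded_measurable_sum (I : Type) (s : seq I) (F : I -> T -> R) :
  (forall i, bounded_measurable (F i)) ->
  bounded_measurable (fun x => \sum_(i <- s) F i x).
Proof.
move=> bF; elim: s => [|i s IH].
  by under [fun _ => _]funext do rewrite big_nil; exact: bounded_measurable_cst.
under [fun _ => _]funext do rewrite big_cons.
exact: bounded_measurableD.
Qed.

Lemma bounded_measurableZ f c : bounded_measurable f ->
  bounded_measurable (fun x => c * f x).
Proof. by move=> bf; apply: bounded_measurableM => //; exact: bounded_measurable_cst. Qed.

Lemma bounded_measurable_norm f : bounded_measurable f ->
  bounded_measurable (fun x => `|f x|).
Proof.
move=> [mf [M fM]]; split; first exact: measurableT_comp.
by exists M => x; rewrite normr_id.
Qed.

Lemma bounded_measurable_sqr f : bounded_measurable f ->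
  bounded_measurable (fun x => f x ^+ 2).
Proof. by move=> bf; under [fun _ => _]funext do rewrite expr2; exact: bounded_measurableM. Qed.

Lemma bounded_measurable_expR f : bounded_measurable f ->
  bounded_measurable (fun x => expR (f x)).
Proof.
move=> [mf [M fM]]; split; first exact: measurableT_comp.
exists (expR M) => x; rewrite ger0_norm ?expR_ge0// ler_expR.
exact: le_trans (ler_norm _) (fM x).
Qed.

End bounded_integral.

Section gauss_tower.
Variable R : realType.

(** R^m as an iterated product, so that measures and inequalities on it are obtained
    by induction from those of a product of two spaces. *)
Fixpoint tower (m : nat) : {d : measure_display & measurableType d} :=
  if m is m'.+1 then
    existT _ _ ((measurableTypeR R * projT2 (tower m'))%type : measurableType _)
  else existT _ _ (unit : measurableType _).

Definition coords m := projT2 (tower m).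

Fixpoint gauss m : probability (coords m) R :=
  match m return probability (coords m) R with
  | 0 => dirac tt
  | m'.+1 => (normal_prob 0 1 : probability (measurableTypeR R) R) \x gauss m'
  end%E.

(** Indexed by all natural numbers, with default value 0, to keep the recursion
    free of bounded indices. *)
Fixpoint crd m : coords m -> nat -> R :=
  match m return coords m -> nat -> R with
  | 0 => fun _ _ => 0
  | m'.+1 => fun z i => if i is i'.+1 then crd (m := m') z.2 i' else z.1
  end.

Fixpoint midpoint m : coords m -> coords m -> coords m :=
  match m return coords m -> coords m -> coords m with
  | 0 => fun _ _ => tt
  | m'.+1 => fun x y => ((x.1 + y.1) / 2, midpoint (m := m') x.2 y.2)
  end.

Fixpoint quad m : coords m -> coords m -> R :=
  match m return coords m -> coords m -> R with
  | 0 => fun _ _ => 0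
  | m'.+1 => fun x y => (x.1 - y.1) ^+ 2 / 4 + quad (m := m') x.2 y.2
  end.

Lemma measurable_crd m i : measurable_fun setT (fun z : coords m => crd z i).
Proof.
elim: m i => [|m IH] i /=; first exact: measurable_cst.
case: i => [|i]; first exact: measurable_fst.
exact: (measurableT_comp (IH i) measurable_snd).
Qed.

Lemma crd_midpoint m (x y : coords m) i : crd (midpoint x y) i = (crd x i + crd y i) / 2.
Proof.
elim: m x y i => [|m IH] x y i /=; first by rewrite addr0 mul0r.
by case: i => [|i].
Qed.

Lemma quadE m (x y : coords m) : quad x y = \sum_(i < m) (crd x i - crd y i) ^+ 2 / 4.
Proof.
elim: m x y => [|m IH] x y /=; first by rewrite big_ord0.
by rewrite big_ord_recl /= IH.
Qed.

Lemma prekopa_leindler_gauss m : prekopa_leindler (gauss m) (@midpoint m) (@quad m).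
Proof.
elim: m => [|m IH].
  move=> u v w bu bv bw u0 v0 w0 uvw.
  have E (f : coords 0 -> R) : bounded_measurable f -> \int[gauss 0]_x f x = f tt.
    move=> bf; rewrite /Rintegral.
    have mf : measurable_fun setT (EFin \o (f : unit -> R)) by [].
    have := @integral_dirac _ unit tt R setT measurableT _ mf.
    by rewrite diracT mul1e /= => ->.
  by rewrite !E//; have := uvw tt tt; rewrite /= expR0 mulr1.
exact: (prekopa_leindler_prod (P1 := normal_prob 0 1) (P2 := gauss m)
  (@prekopa_leindler_normal R) IH).
Qed.

End gauss_tower.

Section taylor.
Variable R : realType.

Lemma nonneg_of_derive (f f' : R -> R) : (forall x : R, is_derive x 1 f (f' x)) ->
  0 <= f 0 -> (forall x, 0 <= x -> 0 <= f' x) -> forall x, 0 <= x -> 0 <= f x.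
Proof.
move=> df f0 f'0 x x0.
apply: le_trans f0 _.
apply: (@ger0_derive1_le_cc R f 0 x) => //.
- by move=> y; rewrite in_itv/= => /andP[y0 _]; rewrite derive1E derive_val f'0 ?ltW.
- by apply: derivable_within_continuous => y _; apply: ex_derive.
- by rewrite in_itv/= lexx x0.
- by rewrite in_itv/= lexx x0.
Qed.

(** For negative arguments the Taylor polynomials are alternately lower and upper
    bounds, each of which follows from the previous one by integration. *)
Lemma expR_lower3 (t : R) : 1 + t + t ^+ 2 / 2 - `|t| ^+ 3 <= expR t.
Proof.
have [t0|t0] := leP 0 t.
  apply: (@le_trans _ _ (1 + t + t ^+ 2 / 2)).
    by rewrite gerBl exprn_ge0.
  rewrite -subr_ge0.
  apply: (@nonneg_of_derive (fun t => expR t - (1 + t + t ^+ 2 / 2)) (fun t => expR t - (1 + t))) => //.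
  - move=> x; apply: is_derive_eq.
    by rewrite /GRing.scale/=; field.
  - by rewrite expR0; lra.
  - by move=> x _; rewrite subr_ge0 expR_ge1Dx.
have : 0 <= - t by rewrite oppr_ge0 ltW.
rewrite ltr0_norm// -[t in X in _ -> X]opprK; move: (- t) => s s0; rewrite opprK.
have H1 (y : R) : 0 <= y -> 0 <= 1 - y + y ^+ 2 / 2 - expR (- y).
  apply: (@nonneg_of_derive (fun y => 1 - y + y ^+ 2 / 2 - expR (- y)) (fun y => expR (- y) - (1 - y))).
  - move=> x; apply: is_derive_eq.
    by rewrite /GRing.scale/=; field.
  - by rewrite oppr0 expR0; lra.
  - by move=> x _; rewrite subr_ge0 expR_ge1Dx.
have H2 : 0 <= expR (- s) - (1 - s + s ^+ 2 / 2 - s ^+ 3 / 6).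
  apply: (@nonneg_of_derive (fun y => expR (- y) - (1 - y + y ^+ 2 / 2 - y ^+ 3 / 6))
    (fun y => 1 - y + y ^+ 2 / 2 - expR (- y))) => //.
  - move=> x; apply: is_derive_eq.
    by rewrite /GRing.scale/=; field.
  - by rewrite oppr0 expR0; lra.
have : 0 <= s ^+ 3 by rewrite exprn_ge0.
by rewrite sqrrN; lra.
Qed.

End taylor.

(** * The Poincare inequality on convex sets in finite dimension *)

Section poincare_gauss.
Variable R : realType.

(** Letting e tend to 0. *)
Lemma le0_of_small (X c : R) (e0 : R) : 0 < e0 ->
  (forall e, 0 < e -> e <= e0 -> X <= e * c) -> X <= 0.
Proof.
move=> e00 H; apply/ler_addgt0Pr => r r0; rewrite add0r.
pose e := Num.min e0 (r / (`|c| + 1)).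
have c0 : 0 < `|c| + 1 by rewrite ltr_pwDr.
have e_gt0 : 0 < e by rewrite lt_min e00 divr_gt0.
apply: le_trans (H e e_gt0 _) _; first by rewrite ge_min lexx.
have : e <= r / (`|c| + 1) by rewrite ge_min lexx orbT.
rewrite ler_pdivlMr// => h.
apply: le_trans h; rewrite ler_pM2l//.
by apply: le_trans (ler_norm _) _; rewrite lerDl.
Qed.

(** The terms of order 0 and 1 in e cancel, and comparing those of order 2 gives the
    conclusion. With k, A, S, Q the integrals of 1, g, g^2 and |grad g|^2 over K,
    this is the passage from Prekopa-Leindler to Poincare. *)
Lemma second_order_le (k A S Q C e0 : R) : 0 < e0 ->
  (forall e, 0 < e -> e <= e0 ->
    (k + e * A + e ^+ 2 * (S / 2 - Q) - e ^+ 3 * C) *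
    (k - e * A + e ^+ 2 * (S / 2) - e ^+ 3 * C) <= k ^+ 2) ->
  k * S - A ^+ 2 <= k * Q.
Proof.
move=> e00 H.
pose B1 := S / 2 - Q; pose B2 := S / 2.
pose c3 := - 2 * k * C + A * B2 - A * B1.
pose c4 := B1 * B2.
pose c5 := - C * (B1 + B2).
pose c6 := C ^+ 2.
suff : k * S - A ^+ 2 - k * Q <= 0 by rewrite subr_le0.
apply: (@le0_of_small _ (`|c3| + `|c4| + `|c5| + `|c6|) (Num.min e0 1)).
  by rewrite lt_min e00 ltr01.
move=> e ep; rewrite le_min => /andP[ee0 e1].
have := H e ep ee0; rewrite -subr_le0.
have -> : (k + e * A + e ^+ 2 * (S / 2 - Q) - e ^+ 3 * C) *
    (k - e * A + e ^+ 2 * (S / 2) - e ^+ 3 * C) - k ^+ 2 =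
    e ^+ 2 * ((k * S - A ^+ 2 - k * Q) + e * (c3 + e * c4 + e ^+ 2 * c5 + e ^+ 3 * c6)).
  by rewrite /c3 /c4 /c5 /c6 /B1 /B2; field.
rewrite pmulr_rle0 ?exprn_gt0// => h.
suff : - (c3 + e * c4 + e ^+ 2 * c5 + e ^+ 3 * c6) <= `|c3| + `|c4| + `|c5| + `|c6|.
  rewrite -(ler_pM2l ep); lra.
apply: le_trans (ler_norm _) _; rewrite normrN.
have B n c : `|e ^+ n * c| <= `|c|.
  rewrite normrM ger0_norm ?exprn_ge0 ?(ltW ep)// ler_piMl//.
  by rewrite exprn_ile1// ltW.
apply: le_trans (ler_normD _ _) _; apply: lerD; last exact: B.
apply: le_trans (ler_normD _ _) _; apply: lerD; last exact: B.
apply: le_trans (ler_normD _ _) _; apply: lerD => //.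
by have := B 1 c4; rewrite expr1.
Qed.

(** A second-order expansion in e of exp(e a - e^2 r), with a remainder which is
    uniform for a and r in bounded sets. *)
Lemma expR_second_order (e a r M Q : R) : 0 < e -> e <= 1 -> `|a| <= M ->
  0 <= r -> r <= Q ->
  1 - e ^+ 3 * (M * Q + (M + Q) ^+ 3) +
    (e * a + (e ^+ 2 / 2 * a ^+ 2 - e ^+ 2 * r)) <= expR (e * a - e ^+ 2 * r).
Proof.
move=> ep e1 aM r0 rQ; apply: le_trans (expR_lower3 _).
have M0 : 0 <= M by apply: le_trans aM.
have Q0 := le_trans r0 rQ.
have e_ge0 := ltW ep.
have e3_ge0 : 0 <= e ^+ 3 by rewrite exprn_ge0.
set t := e * a - e ^+ 2 * r.
have tb : `|t| <= e * (M + Q).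
  apply: le_trans (ler_normB _ _) _; rewrite mulrDr; apply: lerD.
    by rewrite normrM (ger0_norm e_ge0) ler_pM2l.
  rewrite ger0_norm; last by rewrite mulr_ge0 ?sqr_ge0.
  rewrite expr2 -mulrA ler_pM2l//.
  by apply: le_trans rQ; rewrite ler_piMl.
have tb3 : `|t| ^+ 3 <= e ^+ 3 * (M + Q) ^+ 3.
  by rewrite -exprMn lerXn2r// ?nnegrE// mulr_ge0// addr_ge0.
have ar : a * r <= M * Q.
  apply: (@le_trans _ _ (M * r)); last exact: ler_wpM2l.
  by apply: ler_wpM2r => //; apply: le_trans (ler_norm _) aM.
have t2 : e ^+ 2 * a ^+ 2 - 2 * e ^+ 3 * (M * Q) <= t ^+ 2.
  have -> : t ^+ 2 = e ^+ 2 * a ^+ 2 - 2 * e ^+ 3 * (a * r) + (e ^+ 2 * r) ^+ 2.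
    by rewrite /t; ring.
  apply: (@le_trans _ _ (e ^+ 2 * a ^+ 2 - 2 * e ^+ 3 * (a * r))); last first.
    by rewrite lerDl sqr_ge0.
  by rewrite lerD2l lerN2 ler_wpM2l// ?mulr_ge0.
move: t2 tb3; rewrite /t; clear; move: ((M + Q) ^+ 3) => N; lra.
Qed.

Lemma integral_expR_second_order d (T : measurableType d) (P : probability T R)
    (K : set T) (a r : T -> R) (e M Q : R) :
  measurable K -> bounded_measurable a -> bounded_measurable r ->
  0 < e -> e <= 1 -> (forall z, `|a z| <= M) -> (forall z, 0 <= r z) ->
  (forall z, r z <= Q) ->
  \int[P]_z \1_K z + e * \int[P]_z (a z * \1_K z) +
    e ^+ 2 * ((\int[P]_z (a z ^+ 2 * \1_K z)) / 2 - \int[P]_z (r z * \1_K z)) -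
    e ^+ 3 * (M * Q + (M + Q) ^+ 3) <=
  \int[P]_z (expR (e * a z - e ^+ 2 * r z) * \1_K z).
Proof.
move=> mK ba br ep e1 aM r0 rQ.
have bI : bounded_measurable (\1_K : T -> R) by exact: bounded_measurable_indic.
have I0 z : 0 <= \1_K z :> R by rewrite indicE.
have I1 z : \1_K z <= 1 :> R by rewrite indicE; case: (_ \in _).
set k := \int[P]_z \1_K z.
have k1 : k <= 1.
  have := ble_Rintegral P bI (bounded_measurable_cst _ 1) I1.
  by rewrite Rintegral_cst// [X in fine X](@probability_setT _ _ _ P) mul1r.
have M0 : 0 <= M by apply: le_trans (aM point).
have Q0 : 0 <= Q by apply: le_trans (r0 point) (rQ point).
set C := M * Q + _.
have C0 : 0 <= e ^+ 3 * C.
  by rewrite mulr_ge0 ?exprn_ge0 ?(ltW ep)// addr_ge0 ?mulr_ge0 ?exprn_ge0 ?addr_ge0.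
have b1 : bounded_measurable (fun z => (1 - e ^+ 3 * C) * \1_K z).
  exact: bounded_measurableZ.
have b2 : bounded_measurable (fun z => e * (a z * \1_K z)).
  by apply: bounded_measurableZ; exact: bounded_measurableM.
have b3 : bounded_measurable (fun z => e ^+ 2 / 2 * (a z ^+ 2 * \1_K z)).
  apply: bounded_measurableZ; apply: bounded_measurableM => //.
  exact: bounded_measurable_sqr.
have b4 : bounded_measurable (fun z => e ^+ 2 * (r z * \1_K z)).
  by apply: bounded_measurableZ; exact: bounded_measurableM.
have b34 := bounded_measurableB b3 b4.
have b234 := bounded_measurableD b2 b34.
have b1234 := bounded_measurableD b1 b234.
have bu : bounded_measurable (fun z => expR (e * a z - e ^+ 2 * r z) * \1_K z).
  apply: bounded_measurableM => //; apply: bounded_measurable_expR.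
  by apply: bounded_measurableB; exact: bounded_measurableZ.
have L z : (1 - e ^+ 3 * C) * \1_K z + (e * (a z * \1_K z) +
    (e ^+ 2 / 2 * (a z ^+ 2 * \1_K z) - e ^+ 2 * (r z * \1_K z))) <=
    expR (e * a z - e ^+ 2 * r z) * \1_K z.
  have := expR_second_order ep e1 (aM z) (r0 z) (rQ z).
  move/(ler_wpM2r (I0 z)); apply: le_trans; rewrite -/C.
  by rewrite le_eqVlt; apply/orP; left; apply/eqP; ring.
have := ble_Rintegral P b1234 bu L.
rewrite (bRintegralD P b1 b234) (bRintegralD P b2 b34) (bRintegralB P b3 b4).
rewrite !bRintegralZ//; last 3 first.
- exact: bounded_measurableM.
- by apply: bounded_measurableM => //; exact: bounded_measurable_sqr.
- exact: bounded_measurableM.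
rewrite -/k; apply: le_trans.
have : e ^+ 3 * C * k <= e ^+ 3 * C by rewrite ler_piMr.
move: (\int[P]_z (a z * _)) (\int[P]_z (a z ^+ 2 * _)) (\int[P]_z (r z * _)).
by clearbody k; clear => A S Q' h; lra.
Qed.

Variable m : nat.
Notation coords := (coords R m).
Notation E f := (\int[gauss R m]_z f z).

(** For close points this is the first-order bound on g combined with
    ab <= a^2 + b^2/4. For distant points the cost exceeds eta^2/4, hence the
    oscillation of e g once e is small. *)
Lemma transport_cost_bound (K : set coords) (g : coords -> R) (D : 'I_m -> coords -> R)
    (M delta eta : R) : 0 < eta -> (forall x, `|g x| <= M) ->
  (forall x y, K x -> K y -> (forall i : 'I_m, `|crd y i - crd x i| <= eta) ->
    g x - g y <= \sum_i (`|D i x| + delta) * `|crd y i - crd x i|) ->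
  forall e : R, 0 < e -> e * (8 * M) <= eta ^+ 2 -> forall x y, K x -> K y ->
  (e * g x - e ^+ 2 * \sum_i (`|D i x| + delta) ^+ 2) - e * g y <= quad x y.
Proof.
move=> eta0 gM H e e0 eM x y Kx Ky; rewrite quadE.
have [/forallP near|] := boolP [forall i : 'I_m, `|crd y i - crd x i| <= eta].
  have := H x y Kx Ky near; rewrite -(ler_pM2l e0) mulrBr => h.
  rewrite addrAC lerBlDr; apply: le_trans h _.
  rewrite !mulr_sumr -big_split/=; apply: ler_sum => i _.
  rewrite distrC -(real_normK (num_real (crd x i - crd y i))).
  set a := `|D i x| + delta; set b := `|_ - _|.
  have := sqr_ge0 (b / 2 - e * a); rewrite !expr2; lra.
rewrite negb_forall => /existsP[i]; rewrite -ltNge => far.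
apply: (@le_trans _ _ ((crd x i - crd y i) ^+ 2 / 4)); last first.
  rewrite (bigD1 i)//= lerDl; apply: sumr_ge0 => j _.
  by rewrite divr_ge0// sqr_ge0.
apply: (@le_trans _ _ (e * (2 * M))).
  have r0 : 0 <= e ^+ 2 * \sum_(i < m) (`|D i x| + delta) ^+ 2.
    by rewrite mulr_ge0 ?sqr_ge0//; apply: sumr_ge0 => j _; exact: sqr_ge0.
  have : e * (g x - g y) <= e * (2 * M).
    rewrite ler_pM2l//.
    have := gM x; have := gM y; rewrite !ler_norml => /andP[h1 h2] /andP[h3 h4]; lra.
  lra.
rewrite ler_pdivlMr//; apply: le_trans (_ : eta ^+ 2 <= _); first by lra.
rewrite -(real_normK (num_real (crd x i - crd y i))) distrC.
by rewrite ler_sqr ?nnegrE ?(ltW eta0)// ltW.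
Qed.

(** Prekopa-Leindler for exponentials of e g, expanded to second order in e. The
    function D i plays the part of the i-th partial derivative of g, to which it is
    tied by the one-sided first-order bound, uniform on K, that
    [transport_cost_bound] asks for. *)
Lemma poincare_gauss (K : set coords) (g : coords -> R) (D : 'I_m -> coords -> R) :
  measurable K -> (forall x y, K x -> K y -> K (midpoint x y)) ->
  bounded_measurable g -> (forall i, bounded_measurable (D i)) ->
  (forall delta : R, 0 < delta -> exists2 eta, 0 < eta &
    forall x y, K x -> K y -> (forall i : 'I_m, `|crd y i - crd x i| <= eta) ->
    g x - g y <= \sum_i (`|D i x| + delta) * `|crd y i - crd x i|) ->
  E (\1_K : coords -> R) * E (fun z => g z ^+ 2 * \1_K z) - E (fun z => g z * \1_K z) ^+ 2 <=
  E (\1_K : coords -> R) * E (fun z => (\sum_i D i z ^+ 2) * \1_K z).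
Proof.
move=> mK Kmid bg bD H.
have bI : bounded_measurable (\1_K : coords -> R) by exact: bounded_measurable_indic.
have I0 z : 0 <= \1_K z :> R by rewrite indicE.
have [mg [M gM]] := bg.
have M0 : 0 <= M by apply: le_trans (gM point).
set k := E \1_K; set A := E (fun z => g z * \1_K z); set S := E (fun z => g z ^+ 2 * \1_K z).
have k0 : 0 <= k by apply: Rintegral_ge0 => z _; exact: I0.
move: (k0); rewrite le_eqVlt => /orP[/eqP <-|kgt0].
  by rewrite !mul0r sub0r oppr_le0 sqr_ge0.
have S0 : 0 <= S by apply: Rintegral_ge0 => z _; rewrite mulr_ge0// sqr_ge0.
have key (delta : R) : 0 < delta ->
    k * S - A ^+ 2 <= k * E (fun z => (\sum_i (`|D i z| + delta) ^+ 2) * \1_K z).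
  move=> d0; have [eta eta0 Heta] := H _ d0.
  pose r z := \sum_(i < m) (`|D i z| + delta) ^+ 2.
  have br : bounded_measurable r.
    apply: bounded_measurable_sum => i; apply: bounded_measurable_sqr.
    apply: bounded_measurableD; last exact: bounded_measurable_cst.
    exact: bounded_measurable_norm.
  have r0 z : 0 <= r z by apply: sumr_ge0 => i _; exact: sqr_ge0.
  have [_ [Q0 rQ0]] := br.
  have rQ z : r z <= Q0 by apply: le_trans (ler_norm _) (rQ0 z).
  have Q00 : 0 <= Q0 by apply: le_trans (r0 point) (rQ _).
  pose C := M * Q0 + (M + Q0) ^+ 3.
  have C0 : 0 <= C by rewrite addr_ge0 ?mulr_ge0 ?exprn_ge0 ?addr_ge0.
  have N0 : 0 < `|A| + C + 1 by rewrite ltr_wpDl// addr_ge0.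
  have M80 : 0 < 8 * M + 1 by rewrite ltr_wpDl// mulr_ge0.
  apply: (@second_order_le _ _ _ _ C
    (Num.min 1 (Num.min (eta ^+ 2 / (8 * M + 1)) (k / (`|A| + C + 1))))).
    by rewrite !lt_min ltr01 !divr_gt0// exprn_gt0.
  move=> e ep; rewrite !le_min => /and3P[e1].
  rewrite !ler_pdivlMr// => e2 e3.
  have e_ge0 := ltW ep.
  have eM : e * (8 * M) <= eta ^+ 2.
    by apply: le_trans e2; rewrite ler_pM2l// lerDl.
  (* The penalty e^2 r is put on u alone: with r close to the squared gradient,
     this gives the constant 1. *)
  pose u z := expR (e * g z - e ^+ 2 * r z) * \1_K z.
  pose v z := expR (e * (- g z) - e ^+ 2 * 0) * \1_K z.
  have bNg : bounded_measurable (fun z => - g z) by exact: bounded_measurableN.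
  have bu : bounded_measurable u.
    apply: bounded_measurableM => //; apply: bounded_measurable_expR.
    by apply: bounded_measurableB => //; exact: bounded_measurableZ.
  have bv : bounded_measurable v.
    apply: bounded_measurableM => //; apply: bounded_measurable_expR.
    apply: bounded_measurableB; first exact: bounded_measurableZ.
    exact: bounded_measurable_cst.
  have u0 z : 0 <= u z by rewrite mulr_ge0// expR_ge0.
  have v0 z : 0 <= v z by rewrite mulr_ge0// expR_ge0.
  have UV : E u * E v <= k ^+ 2.
    apply: (@prekopa_leindler_gauss R m u v \1_K) => //.
    move=> x y; rewrite /u /v !indicE.
    have [/set_mem Kx|_] := boolP (x \in K); last first.
      by rewrite mulr0 mul0r mulr_ge0 ?sqr_ge0 ?expR_ge0.
    have [/set_mem Ky|_] := boolP (y \in K); last first.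
      by rewrite !mulr0 mulr_ge0 ?sqr_ge0 ?expR_ge0.
    rewrite !mulr1 -expRD mem_set; last exact: Kmid.
    rewrite expr1n mul1r ler_expR mulr0 subr0 mulrN.
    exact: (transport_cost_bound eta0 gM Heta).
  have Ub := @integral_expR_second_order _ _ (gauss R m) K g r e M Q0 mK bg br ep e1 gM r0 rQ.
  have NgM z : `|- g z| <= M by rewrite normrN.
  have Vb := @integral_expR_second_order _ _ (gauss R m) K (fun z => - g z) (cst 0) e M Q0
    mK bNg (bounded_measurable_cst _ 0) ep e1 NgM (fun=> lexx 0) (fun=> Q00).
  have VE : k + e * E (fun z => - g z * \1_K z) + e ^+ 2 * (E (fun z => (- g z) ^+ 2 * \1_K z) / 2 - E (fun z => cst 0 z * \1_K z)) - e ^+ 3 * C =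
      k - e * A + e ^+ 2 * (S / 2) - e ^+ 3 * C.
    have -> : E (fun z => - g z * \1_K z) = - A.
      rewrite -mulN1r -bRintegralZ; last exact: bounded_measurableM.
      by apply: eq_Rintegral => z _; rewrite mulN1r mulNr.
    have -> : E (fun z => cst 0 z * \1_K z) = 0.
      by under eq_Rintegral do rewrite mul0r; rewrite Rintegral_cst// mul0r.
    have -> : E (fun z => (- g z) ^+ 2 * \1_K z) = S.
      by apply: eq_Rintegral => z _; rewrite sqrrN.
    by rewrite subr0 mulrN.
  rewrite -/k -/C VE in Vb.
  have V0 : 0 <= k - e * A + e ^+ 2 * (S / 2) - e ^+ 3 * C.
    have h1 : e * A <= e * `|A| by rewrite ler_pM2l// ler_norm.
    have h2 : e ^+ 3 * C <= e * C.
      by apply: ler_wpM2r => //; rewrite exprS ler_piMr// exprn_ile1.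
    have h3 : 0 <= e ^+ 2 * (S / 2) by rewrite mulr_ge0 ?sqr_ge0 ?divr_ge0.
    have h4 : e * `|A| + e * C + e <= k by move: e3; rewrite !mulrDr mulr1.
    move: e_ge0 h1 h2 h3 h4; move: (e * A) (e * `|A|) (e * C) (e ^+ 3 * C) (e ^+ 2 * (S / 2)).
    by clearbody k; clear => *; lra.
  apply: le_trans UV.
  apply: (@le_trans _ _ (E u * (k - e * A + e ^+ 2 * (S / 2) - e ^+ 3 * C))).
    exact: (ler_wpM2r V0 Ub).
  apply: (ler_wpM2l _ Vb); apply: Rintegral_ge0 => z _; exact: u0.
pose F0 := E (fun z => (\sum_i D i z ^+ 2) * \1_K z).
pose F1 := E (fun z => (\sum_i (2 * `|D i z|)) * \1_K z).
have bs0 : bounded_measurable (fun z => (\sum_i D i z ^+ 2) * \1_K z).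
  apply: bounded_measurableM => //.
  by apply: bounded_measurable_sum => i; exact: bounded_measurable_sqr.
have bs1 : bounded_measurable (fun z => (\sum_i (2 * `|D i z|)) * \1_K z).
  apply: bounded_measurableM => //; apply: bounded_measurable_sum => i.
  by apply: bounded_measurableZ; exact: bounded_measurable_norm.
rewrite -subr_le0; apply: (@le0_of_small _ (k * (F1 + m%:R * k)) 1) => // e ep e1.
have := key e ep.
have -> : E (fun z => (\sum_i (`|D i z| + e) ^+ 2) * \1_K z) =
    F0 + (e * F1 + (e ^+ 2 * m%:R) * k).
  have be1 : bounded_measurable (fun z => e * ((\sum_i (2 * `|D i z|)) * \1_K z)).
    exact: bounded_measurableZ.
  have be2 : bounded_measurable (fun z => e ^+ 2 * m%:R * \1_K z).
    exact: bounded_measurableZ.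
  rewrite -(bRintegralZ _ _ bs1) -(bRintegralZ _ _ bI) -(bRintegralD _ be1 be2).
  rewrite -(bRintegralD _ bs0 (bounded_measurableD be1 be2)).
  apply: eq_Rintegral => z _.
  have -> : \sum_i (`|D i z| + e) ^+ 2 =
      \sum_i D i z ^+ 2 + (e * \sum_i (2 * `|D i z|) + e ^+ 2 * m%:R).
    have -> : e ^+ 2 * m%:R = \sum_(i < m) e ^+ 2 by rewrite sumr_const card_ord mulr_natr.
    rewrite mulr_sumr -!big_split/=.
    apply: eq_bigr => i _; rewrite sqrrD real_normK ?num_real//.
    by rewrite -addrA; congr (_ + (_ + _)); ring.
  by move: (\sum_i D i z ^+ 2) (\sum_i _ * _) (\1_K z); clear => *; ring.
have h : e ^+ 2 * (k * (m%:R * k)) <= e * (k * (m%:R * k)).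
  by rewrite expr2 -mulrA ler_pM2l// ler_piMl ?mulr_ge0.
rewrite -/F0; move: h; clearbody F0 F1 S A k; clear => *; lra.
Qed.

End poincare_gauss.

(** * Moments and integration by parts for normal laws *)

Lemma nbhs_infty_ger_succ (R : realType) (x : R) :
  \forall n \near \oo, x <= n.+1%:R.
Proof.
near=> n; apply: (@le_trans _ _ n%:R); last by rewrite ler_nat.
by near: n; exact: nbhs_infty_ger.
Unshelve. all: by end_near. Qed.

Section normal_moments.
Variables (R : realType) (sigma : R).
Hypothesis sigma0 : 0 < sigma.
Notation mu := (@lebesgue_measure R).
Notation P := (normal_prob 0 sigma).
Notation p := (normal_pdf 0 sigma).

Let s2 : 0 < sigma ^+ 2. Proof. by rewrite exprn_gt0. Qed.

Lemma centered_normal_pdfE (x : R) :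
  p x = normal_peak sigma * expR (- x ^+ 2 / (2 * sigma ^+ 2)).
Proof.
rewrite normal_pdfE ?gt_eqF// /normal_fun subr0 -mulr_natl.
by congr (_ * expR (_ / _)).
Qed.

(** The exponential of half the exponent of the density. It is integrable, because
    multiplying the density by it gives a multiple of the density of variance
    2 sigma^2, and it dominates polynomials. *)
Definition gauss_weight (m x : R) := expR ((x - m) ^+ 2 / (4 * sigma ^+ 2)).

Lemma measurable_gauss_weight m : measurable_fun setT (gauss_weight m).
Proof.
apply: measurableT_comp => //; apply: measurable_funM => //.
by apply: measurable_funX; exact: measurable_funB.
Qed.

Lemma gauss_weight_pdf m x :
  gauss_weight m x * normal_pdf m sigma x =
  Num.sqrt 2 * normal_pdf m (Num.sqrt 2 * sigma) x.
Proof.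
have r2 : 0 < Num.sqrt 2 :> R by rewrite sqrtr_gt0.
rewrite !normal_pdfE ?gt_eqF ?mulr_gt0// /normal_fun.
rewrite mulrCA -expRD !mulrA; congr (_ * expR _).
  rewrite /normal_peak exprMn sqr_sqrtr// -[2 * _ * pi]mulrA -[(2 * _) *+ 2]mulrnAr.
  rewrite (sqrtrM (sigma ^+ 2 * pi *+ 2))// invfM mulrA divff ?mul1r//.
rewrite exprMn sqr_sqrtr// !mulr2n; field.
by rewrite !gt_eqF ?addr_gt0 ?mulr_gt0.
Qed.

Lemma integral_gauss_weight m :
  (\int[normal_prob m sigma]_x (gauss_weight m x)%:E = (Num.sqrt 2)%:E)%E.
Proof.
rewrite ge0_integral_normal//; last 2 first.
- by apply/measurable_EFinP; exact: measurable_gauss_weight.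
- by move=> x; rewrite lee_fin expR_ge0.
under eq_integral do rewrite -EFinM gauss_weight_pdf EFinM.
rewrite integralZl//; last exact: integrable_normal_pdf.
by rewrite integral_normal_pdf mule1.
Qed.

Lemma integrable_gauss_weight m :
  (normal_prob m sigma).-integrable setT (EFin \o gauss_weight m).
Proof.
apply/integrableP; split.
  by apply/measurable_EFinP; exact: measurable_gauss_weight.
under eq_integral do rewrite /= ger0_norm ?expR_ge0//.
by rewrite integral_gauss_weight ltry.
Qed.

Lemma integrable_le_gauss_weight m (f : R -> R) c : measurable_fun setT f ->
  (forall x, `|f x| <= c * gauss_weight m x) ->
  (normal_prob m sigma).-integrable setT (EFin \o f).
Proof.
move=> mf fc.
apply: (@le_integrable _ _ _ (normal_prob m sigma) setT measurableT (EFin \o f) (EFin \o (fun x => c * gauss_weight m x))) => //.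
- exact/measurable_EFinP.
- move=> x _; rewrite /= lee_fin; apply: le_trans (fc x) _; exact: ler_norm.
- have := integrableZl measurableT c (integrable_gauss_weight m).
  by apply: eq_integrable => // x _ /=; rewrite EFinM.
Qed.

Lemma sqr_le_gauss_weight m x :
  (x - m) ^+ 2 <= 4 * sigma ^+ 2 * gauss_weight m x.
Proof.
have := expR_ge1Dx ((x - m) ^+ 2 / (4 * sigma ^+ 2)).
rewrite -/(gauss_weight m x) => h; rewrite mulrC -ler_pdivrMr ?mulr_gt0//.
by apply: le_trans h; rewrite lerDr.
Qed.

Lemma gauss_weight_ge1 m x : 1 <= gauss_weight m x.
Proof. by rewrite -expR0 ler_expR divr_ge0 ?sqr_ge0// mulr_ge0 ?sqr_ge0. Qed.

Lemma integrable_normal_sqr : P.-integrable setT (EFin \o (fun x : R => x ^+ 2)).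
Proof.
apply: (@integrable_le_gauss_weight 0 _ (4 * sigma ^+ 2)); first exact: measurable_funX.
by move=> x; rewrite ger0_norm ?sqr_ge0//; have := sqr_le_gauss_weight 0 x; rewrite subr0.
Qed.

Lemma is_derive_normal_pdf (x : R) : is_derive x 1 p (- x / sigma ^+ 2 * p x).
Proof.
have -> : p = (fun x => normal_peak sigma * expR (- x ^+ 2 / (2 * sigma ^+ 2))).
  by apply/funext => y; exact: centered_normal_pdfE.
apply: is_derive_eq; rewrite /GRing.scale/=; field.
by rewrite gt_eqF.
Qed.

(** From exp(-t) <= 1/(1 + t); it makes the boundary terms in the integration by
    parts vanish. *)
Lemma normal_pdf_decay (x : R) :
  (1 + `|x|) * p x <= (4 * (1 + 2 * sigma ^+ 2) * normal_peak sigma) / (1 + `|x|).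
Proof.
have n0 : 0 < 1 + `|x| by rewrite ltr_pwDl.
rewrite ler_pdivlMr// centered_normal_pdfE.
set t := x ^+ 2 / (2 * sigma ^+ 2).
have t0 : 0 <= t by rewrite divr_ge0 ?sqr_ge0// mulr_ge0 ?sqr_ge0.
have e1 : expR (- x ^+ 2 / (2 * sigma ^+ 2)) * (1 + t) <= 1.
  rewrite mulNr -/t expRN mulrC ler_pdivrMr ?expR_gt0// mul1r; exact: expR_ge1Dx.
have h : (1 + `|x|) ^+ 2 <= 4 * (1 + 2 * sigma ^+ 2) * (1 + t).
  have -> : 4 * (1 + 2 * sigma ^+ 2) * (1 + t) = 4 + 8 * sigma ^+ 2 + 4 * t + 4 * x ^+ 2.
    by rewrite /t; field; rewrite gt_eqF.
  have := sqr_ge0 (1 - `|x|); rewrite sqrrB sqrrD expr1n mul1r real_normK ?num_real// => h.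
  by have := sqr_ge0 x; move: (s2) => h2 h3; lra.
rewrite mulrAC -expr2.
set e := expR _ in e1 *.
rewrite mulrCA [leRHS]mulrC ler_wpM2l// ?normal_peak_ge0//.
apply: (@le_trans _ _ (4 * (1 + 2 * sigma ^+ 2) * (1 + t) * e)).
  by apply: ler_wpM2r h; exact: expR_ge0.
rewrite -mulrA [(1 + t) * _]mulrC ler_piMr// mulr_ge0// addr_ge0// mulr_ge0//.
exact: ltW.
Qed.

(** Stein's identity: the integrand times the density is the derivative of
    sigma^2 f p, which tends to 0 at infinity. *)
Lemma normal_integration_by_parts (f f' : R -> R) C :
  (forall x : R, is_derive x 1 f (f' x)) -> continuous f' ->
  (forall x, `|f x| <= C * (1 + `|x|)) -> (forall x, `|f' x| <= C) ->
  \int[P]_x (sigma ^+ 2 * f' x - x * f x) = 0.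
Proof.
move=> df cf' fC f'C.
have cf : continuous f.
  by move=> x; apply: differentiable_continuous; apply/derivable1_diffP; apply: ex_derive.
have mf : measurable_fun setT f by exact: continuous_measurable_fun.
have mf' : measurable_fun setT f' by exact: continuous_measurable_fun.
have C0 : 0 <= C by apply: le_trans (f'C 0).
pose h x := sigma ^+ 2 * f' x - x * f x.
have mh : measurable_fun setT h.
  by apply: measurable_funB; apply: measurable_funM.
have ih : P.-integrable setT (EFin \o h).
  apply: (@integrable_le_gauss_weight 0 _ (sigma ^+ 2 * C + 2 * C * (1 + 4 * sigma ^+ 2))) => //.
  move=> x; apply: (@le_trans _ _ (sigma ^+ 2 * C + 2 * C * (1 + x ^+ 2))).
    apply: le_trans (ler_normB _ _) _; apply: lerD.
      by rewrite normrM (ger0_norm (ltW s2)) ler_pM2l.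
    rewrite normrM; apply: (@le_trans _ _ (`|x| * (C * (1 + `|x|)))).
      exact: ler_wpM2l.
    rewrite mulrCA [2 * C]mulrC -mulrA ler_wpM2l//.
    have := sqr_ge0 (1 - `|x|); have := normr_ge0 x.
    by rewrite -[x ^+ 2](real_normK (num_real x)); clear; rewrite !expr2 => *; lra.
  rewrite [leRHS]mulrDl; apply: lerD.
    by rewrite ler_peMr ?gauss_weight_ge1// mulr_ge0// ltW.
  rewrite -[leRHS]mulrA; apply: ler_wpM2l; first by rewrite mulr_ge0.
  rewrite [leRHS]mulrDl mul1r; apply: lerD; first exact: gauss_weight_ge1.
  by have := sqr_le_gauss_weight 0 x; rewrite subr0.
have ihp := integrable_normal mh ih.
pose G x := sigma ^+ 2 * f x * p x.
have dG (x : R) : is_derive x 1 G (h x * p x).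
  have dp := is_derive_normal_pdf x.
  apply: is_derive_eq; rewrite /h /GRing.scale/=; field.
  by rewrite gt_eqF.
have cp : continuous p by apply: continuous_normal_pdf; rewrite gt_eqF.
have chp : continuous (fun x => h x * p x).
  move=> x; apply: cvgM; last exact: cp.
  apply: cvgB; first by apply: cvgM; [exact: cvg_cst|exact: cf'].
  by apply: cvgM; [exact: cvg_id|exact: cf].
have ftc (n : nat) : (\int[mu]_(x in `[(- n.+1%:R)%R, n.+1%:R%R]) (h x * p x)%:E = (G n.+1%:R - G (- n.+1%:R))%:E)%E.
  rewrite EFinB; apply: continuous_FTC2.
  - by rewrite gtrN// ltr0n.
  - exact: continuous_subspaceT.
  - have cG : continuous G.
      by move=> x; apply: differentiable_continuous; apply/derivable1_diffP; apply: ex_derive.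
    split; first by move=> x _; apply: ex_derive.
      by apply: cvg_at_right_filter; exact: cG.
    by apply: cvg_at_left_filter; exact: cG.
  - by move=> x _; rewrite derive1E derive_val.
have lim0 : (\int[mu]_(x in `[(- n.+1%:R)%R, n.+1%:R%R]) (h x * p x)%:E)%E @[n --> \oo] --> 0%E.
  rewrite (_ : (fun n => _) = EFin \o (fun n => G n.+1%:R - G (- n.+1%:R))); last first.
    by apply/funext => n; exact: ftc.
  apply: cvg_EFin; first exact: nearW.
  pose K := 2 * sigma ^+ 2 * C * (4 * (1 + 2 * sigma ^+ 2) * normal_peak sigma).
  have Gb x : `|G x| <= K / 2 / (1 + `|x|).
    rewrite /G normrM (ger0_norm (normal_pdf_ge0 _ _ _)) normrM (ger0_norm (ltW s2)).
    apply: (@le_trans _ _ (sigma ^+ 2 * C * ((1 + `|x|) * p x))).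
      rewrite [leRHS](_ : _ = sigma ^+ 2 * (C * (1 + `|x|)) * p x); last by ring.
      by apply: ler_wpM2r; rewrite ?normal_pdf_ge0// ler_pM2l.
    rewrite /K [leRHS](_ : _ = sigma ^+ 2 * C * ((4 * (1 + 2 * sigma ^+ 2) * normal_peak sigma) / (1 + `|x|))); last first.
      by field; rewrite gt_eqF// ltr_pwDl.
    by apply: ler_wpM2l (normal_pdf_decay x); rewrite mulr_ge0// ltW.
  apply/cvgr0Pnorm_le => /= e e0.
  have K0 : 0 <= K by rewrite !mulr_ge0 ?addr_ge0 ?mulr_ge0 ?normal_peak_ge0// ltW.
  near=> n.
  apply: le_trans (ler_normB _ _) _.
  apply: (@le_trans _ _ (K / n.+1%:R)).
    have L x : `|x| = n.+1%:R -> `|G x| <= K / 2 / n.+1%:R.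
      move=> xn; apply: le_trans (Gb x) _; rewrite xn; apply: ler_wpM2l; first by rewrite divr_ge0.
      by rewrite lef_pV2 ?posrE ?ltr_pwDl// lerDr.
    have := L n.+1%:R; rewrite normr_nat => /(_ erefl) L1.
    have := L (- n.+1%:R); rewrite normrN normr_nat => /(_ erefl) L2.
    by apply: le_trans (lerD L1 L2) _; rewrite -mulrDl -splitr.
  rewrite ler_pdivrMr ?ltr0n// mulrC -ler_pdivrMr//.
  near: n; exact: nbhs_infty_ger_succ.
pose F n x := ((fun x => (h x * p x)%:E) \_ `[(- n.+1%:R)%R, n.+1%:R%R]) x.
have cvF : (\int[mu]_x F n x)%E @[n --> \oo] --> (\int[mu]_x (h x * p x)%:E)%E.
  have mhp : measurable_fun setT (fun x => (h x * p x)%:E).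
    apply/measurable_EFinP/measurable_funM => //; exact: measurable_normal_pdf.
  have [] := @dominated_convergence _ _ _ mu setT measurableT F
    (fun x => (h x * p x)%:E) (fun x => `|(h x * p x)%:E|%E) => //.
  - move=> n; apply/measurable_restrict => //; rewrite setTI//.
    exact: measurable_funTS.
  - apply/aeW => x _.
    apply: cvg_near_cst; near=> n; rewrite /F patchE mem_set//= in_itv/= -ler_norml.
    near: n; exact: nbhs_infty_ger_succ.
  - exact: integrable_abse.
  - apply/aeW => x n _; rewrite /F patchE; case: ifPn => // _.
    by rewrite abse0.
have F0 n : (\int[mu]_x F n x)%E = (\int[mu]_(x in `[(- n.+1%:R)%R, n.+1%:R%R]) (h x * p x)%:E)%E.
  by rewrite [RHS]integral_mkcond.
rewrite (eq_cvg _ _ F0) in cvF.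
have E0 := cvg_unique _ cvF lim0.
by rewrite /Rintegral integral_normal// E0.
Unshelve. all: by end_near.
Qed.
End normal_moments.

(** * The cosine transform of a normal law *)

Section normal_facts.
Variables (R : realType) (sigma : R).
Hypothesis sigma0 : 0 < sigma.
Notation mu := (@lebesgue_measure R).
Notation P := (normal_prob 0 sigma).

(** Stein's identity for f(x) = x. *)
Lemma Rintegral_normal_sqr : \int[P]_x (x ^+ 2) = sigma ^+ 2.
Proof.
have := @normal_integration_by_parts R sigma sigma0 id (cst 1) 1.
rewrite RintegralB//; last 2 first.
- apply: (bounded_measurable_integrable P (f := fun=> sigma ^+ 2 * 1)).
  exact: bounded_measurable_cst.
- by under eq_fun do rewrite -expr2; exact: integrable_normal_sqr.
have -> : \int[P]_x (sigma ^+ 2 * cst 1 x) = sigma ^+ 2.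
  have := @Rintegral_cst _ _ _ P setT measurableT (sigma ^+ 2 * 1).
  by rewrite [X in _ * fine X](@probability_setT _ _ _ P) !mulr1.
move=> H.
apply/esym/eqP; rewrite -subr_eq0; apply/eqP; apply: H.
- exact: cst_continuous.
- by move=> x; rewrite mul1r lerDr.
- by move=> x; rewrite normr1.
Qed.

(** The density is at most 1/(2 sigma), as pi >= 2. *)
Lemma normal_small_ball (t : R) : 0 <= t -> (P `[(- t)%R, t] <= (t / sigma)%:E)%E.
Proof.
move=> t0; rewrite /normal_prob.
apply: (@le_trans _ _ (\int[mu]_(x in `[(- t)%R, t]) (normal_peak sigma)%:E)%E).
  apply: ge0_le_integral => //.
  - by move=> x _; rewrite lee_fin normal_pdf_ge0.
  - by apply/measurable_EFinP/measurable_funTS; exact: measurable_normal_pdf.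
  - by move=> x _; rewrite lee_fin normal_pdf_ub// gt_eqF.
rewrite integral_cst//= lebesgue_measure_itv/= lte_fin.
have pk : normal_peak sigma * 2 <= sigma^-1.
  rewrite /normal_peak -ler_pdivlMr// -invfM lef_pV2 ?posrE ?mulr_gt0 ?sqrtr_gt0//; last first.
    by rewrite pmulrn_lgt0// mulr_gt0 ?exprn_gt0 ?pi_gt0.
  have -> : sigma * 2 = Num.sqrt ((sigma * 2) ^+ 2).
    by rewrite sqrtr_sqr ger0_norm// mulr_ge0// ltW.
  apply: ler_wsqrtr.
  have -> : (sigma * 2) ^+ 2 = sigma ^+ 2 * 4 by ring.
  have -> : sigma ^+ 2 * pi *+ 2 = sigma ^+ 2 * (2 * pi :> R) by ring.
  rewrite ler_pM2l ?exprn_gt0//.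
  by have := pi_ge2 R; lra.
case: ifPn => _; last by rewrite mule0 lee_fin divr_ge0// ltW.
rewrite -EFinD -EFinM lee_fin opprK -mulr2n -[t *+ 2]mulr_natl mulrA mulrC.
by apply: ler_wpM2l.
Qed.

Variable b : R.

Definition normal_cos (s : R) := \int[P]_x cos (s * x + b).

Let bcos (t : R) : bounded_measurable (fun x : R => cos (t * x + b)).
Proof.
split; last by exists 1 => x; exact: cos_max.
apply: measurableT_comp; last by apply: measurable_funD => //; exact: measurable_funM.
by apply: continuous_measurable_fun; exact: continuous_cos.
Qed.

(** Differentiation under the integral brings down a factor x, which Stein's identity
    converts into a derivative: the transform solves F' = - sigma^2 s F. *)
Lemma is_derive_normal_cos (s : R) :
  is_derive s 1 normal_cos (- (sigma ^+ 2 * s * normal_cos s)).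
Proof.
pose f (s x : R) := cos (s * x + b).
have df (t x : R) : is_derive t 1 (f ^~ x) (- (x * sin (t * x + b))).
  apply: is_derive_eq; rewrite /GRing.scale/=; ring.
have msin (t : R) : measurable_fun setT (fun x : R => sin (t * x + b)).
  apply: measurableT_comp; last by apply: measurable_funD => //; exact: measurable_funM.
  by apply: continuous_measurable_fun; exact: continuous_sin.
have intf t : (t \in `]s - 1, s + 1[) -> P.-integrable setT (EFin \o f t).
  by move=> _; exact: (bounded_measurable_integrable P (bcos t)).
have intG : P.-integrable setT (EFin \o (fun x : R => 1 + x ^+ 2)).
  under [X in _.-integrable _ X]eq_fun do rewrite EFinD.
  apply: integrableD => //; last exact: integrable_normal_sqr.
  by apply: bounded_measurable_integrable; exact: bounded_measurable_cst.
have sI : s \in `]s - 1, s + 1[ by rewrite in_itv/=; apply/andP; split; lra.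
have Gub t x : t \in `]s - 1, s + 1[ -> setT x -> `|partial1of2 f t x| <= 1 + x ^+ 2.
  move=> _ _; rewrite partial1of2E derive_val normrN normrM.
  apply: (@le_trans _ _ `|x|); first by rewrite ler_piMr// sin_max.
  have := sqr_ge0 (1 - `|x|); rewrite sqrrB real_normK ?num_real//.
  by have := normr_ge0 x; lra.
have dd : forall (t x : R), t \in `]s - 1, s + 1[ -> setT x -> derivable (f ^~ x) t 1.
  by move=> t x _ _; apply: ex_derive.
have G0 (x : R) : 0 <= 1 + x ^+ 2 by rewrite addr_ge0 ?sqr_ge0.
have D := @derivable_under_integral R _ _ P f setT measurableT s (s - 1) (s + 1) sI intf dd _ G0 intG Gub.
have V := @differentiation_under_integral R _ _ P f setT measurableT s (s - 1) (s + 1) sI intf dd _ G0 intG Gub.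
apply: DeriveDef => //.
rewrite -derive1E [LHS]V.
under eq_Rintegral do rewrite partial1of2E derive_val.
have mxs : measurable_fun [set: R] (fun x : R => x * sin (s * x + b)).
  by apply: measurable_funM => //; exact: msin.
have ixs : P.-integrable setT (EFin \o (fun x : R => x * sin (s * x + b))).
  apply: (@le_integrable _ _ _ P setT measurableT _ (EFin \o (fun x : R => 1 + x ^+ 2))) => //.
  - exact/measurable_EFinP.
  - move=> x _; rewrite /= lee_fin [leRHS]ger0_norm//.
    by have := Gub s x sI I; rewrite partial1of2E derive_val normrN.
have := @normal_integration_by_parts R sigma sigma0 (fun x => sin (s * x + b)) (fun x => s * cos (s * x + b)) (1 + `|s|).
have bsc : bounded_measurable (fun x : R => s * cos (s * x + b)).
  exact: bounded_measurableZ.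
rewrite RintegralB//; last first.
  by apply: (bounded_measurable_integrable P); exact: bounded_measurableZ.
have -> : \int[P]_x (sigma ^+ 2 * (s * cos (s * x + b))) = sigma ^+ 2 * (s * normal_cos s).
  exact: etrans (bRintegralZ P (sigma ^+ 2) bsc) (congr1 _ (bRintegralZ P s (bcos s))).
move=> parts.
have {}parts : sigma ^+ 2 * (s * normal_cos s) = \int[P]_x (x * sin (s * x + b)).
  apply/eqP; rewrite -subr_eq0; apply/eqP; apply: parts.
  - move=> x; apply: is_derive_eq; rewrite /GRing.scale/=; ring.
  - move=> x; apply: cvgM; first exact: cvg_cst.
    apply: (@cvg_comp _ _ _ (fun x => s * x + b) cos); last exact: continuous_cos.
    apply: cvgD; last exact: cvg_cst.
    by apply: cvgM; [exact: cvg_cst|exact: cvg_id].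
  - move=> x; apply: le_trans (sin_max _) _.
    by rewrite mulrDr mulr1 mulrDl mul1r -addrA lerDl !addr_ge0 ?mulr_ge0.
  - move=> x; rewrite normrM; apply: (@le_trans _ _ (`|s| * 1)).
      by rewrite ler_wpM2l// cos_max.
    by rewrite mulr1 lerDr.
rewrite -mulrA parts.
transitivity (\int[P]_x (-1 * (x * sin (s * x + b)))).
  by apply: eq_Rintegral => x _; rewrite mulN1r.
by rewrite RintegralZl// mulN1r.
Qed.

(** By [is_derive_normal_cos], the product with exp(sigma^2 s^2/2) is constant. The
    phase b makes sines available too, so real functions suffice throughout. *)
Lemma Rintegral_normal_cos s :
  \int[P]_x cos (s * x + b) = expR (- (sigma ^+ 2 * s ^+ 2) / 2) * cos b.
Proof.
pose psi (t : R) := normal_cos t * expR (sigma ^+ 2 * t ^+ 2 / 2).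
have dpsi (t : R) : is_derive t 1 psi 0.
  have d := is_derive_normal_cos t.
  by apply: is_derive_eq; rewrite /GRing.scale/=; field.
have psi0 : psi 0 = cos b.
  rewrite /psi expr0n/= mulr0 mul0r expR0 mulr1 /normal_cos.
  transitivity (\int[P]_x (cst (cos b) x)).
    by apply: eq_Rintegral => x _; rewrite mul0r add0r.
  by rewrite Rintegral_cst// [X in fine X](@probability_setT _ _ _ P) mulr1.
have := is_derive_0_is_cst s 0 dpsi; rewrite psi0 /psi /normal_cos => <-.
by rewrite mulNr expRN mulrC mulfK// gt_eqF// expR_gt0.
Qed.

Lemma normal_abs_moment m :
  (\int[normal_prob m sigma]_x `|x - m|%:E <= (2 * sigma * Num.sqrt 2)%:E)%E.
Proof.
apply: (@le_trans _ _ (\int[normal_prob m sigma]_x (2 * sigma * gauss_weight sigma m x)%:E)%E).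
  apply: ge0_le_integral => //.
  - by apply/measurable_EFinP; apply: measurableT_comp => //; exact: measurable_funB.
  - by apply/measurable_EFinP; apply: measurable_funM => //; exact: measurable_gauss_weight.
  - move=> x _; rewrite lee_fin -(ler_pXn2r (n := 2))// ?nnegrE ?mulr_ge0 ?expR_ge0 ?(ltW sigma0)//.
    rewrite real_normK ?num_real//; apply: le_trans (sqr_le_gauss_weight sigma0 m x) _.
    rewrite !exprMn -[2 ^+ 2]natrX ler_wpM2l// ?mulr_ge0 ?sqr_ge0 ?(ltW sigma0)//.
    by rewrite expr2 ler_peMr ?expR_ge0// gauss_weight_ge1.
under eq_integral do rewrite EFinM.
by rewrite integralZl ?integrable_gauss_weight// integral_gauss_weight.
Qed.

End normal_facts.

(** * Weighted laws on a pi-system *)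

Section bounded_convergence.
Context d (T : measurableType d) (R : realType).
Variable P : {finite_measure set T -> \bar R}.

Lemma bounded_convergence (f_ : nat -> T -> R) (f : T -> R) (M : R) :
  (forall n, measurable_fun setT (f_ n)) -> measurable_fun setT f ->
  (forall n x, `|f_ n x| <= M) -> (forall x, f_ ^~ x @ \oo --> f x) ->
  (\int[P]_x f_ n x) @[n --> \oo] --> \int[P]_x f x.
Proof.
move=> mf_ mf fM fcvg.
have M0 : 0 <= M by apply: le_trans (fM 0%N point).
have fM' x : `|f x| <= M.
  have cn : (fun n => `|f_ n x|) @ \oo --> `|f x| by apply: cvg_norm; exact: fcvg.
  by rewrite -(cvg_lim _ cn)//; apply: limr_le; [apply: cvgP cn|exact: nearW].
have fcvgE x : (f_ n x)%:E @[n --> \oo] --> (f x)%:E.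
  by apply: cvg_EFin; [exact: nearW|exact: fcvg].
have [_ _] := @dominated_convergence _ _ _ P setT measurableT
  (fun n x => (f_ n x)%:E) (EFin \o f) (cst M%:E)
  (fun n => proj2 (measurable_EFinP _ _) (mf_ n))
  (proj2 (measurable_EFinP _ _) mf)
  (aeW _ (fun x _ => fcvgE x))
  (finite_measure_integrable_cst P M measurableT)
  (aeW _ (fun x n _ => fM n x)).
have E (g : T -> R) : measurable_fun setT g -> (forall x, `|g x| <= M) ->
    (\int[P]_x (g x)%:E = (\int[P]_x g x)%:E)%E.
  by move=> mg gM; rewrite Rintegral_EFin//; split => //; exists M.
rewrite (E f)// => /fine_cvg /=.
by apply: cvg_trans; apply: near_eq_cvg; apply: nearW => n; rewrite /= E.
Qed.

End bounded_convergence.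

Section weighted_dynkin.
Context d (T : measurableType d) d' (T' : measurableType d') (R : realType).
Variables (P : probability T R) (Q : probability T' R) (Y : T -> T').
Hypothesis mY : measurable_fun setT Y.
Variables (W : T -> R) (c : R).
Hypothesis bW : bounded_measurable W.
Hypothesis W1 : \int[P]_x W x = c.

Lemma bounded_measurable_preimage (A : set T') : measurable A ->
  bounded_measurable (fun x => \1_A (Y x) : R).
Proof.
by move=> mA; apply: (bounded_measurable_comp (bounded_measurable_indic R mA) mY).
Qed.

(** The identity is stable under complements and countable disjoint unions for any
    bounded signed weight. Weights are what allows joint laws to be treated one
    coordinate at a time. *)
Lemma weighted_dynkin (G : set (set T')) : @measurable _ T' = <<s G >> ->
  setI_closed G ->
  (forall A, G A -> \int[P]_x (W x * \1_A (Y x)) = c * fine (Q A)) ->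
  forall A, measurable A -> \int[P]_x (W x * \1_A (Y x)) = c * fine (Q A).
Proof.
move=> GE GI HG A mA.
have {mA} : <<s G >> A by rewrite -GE.
have bWA B : measurable B -> bounded_measurable (fun x => W x * \1_B (Y x)).
  by move=> mB; apply: bounded_measurableM => //; exact: bounded_measurable_preimage.
move: A; apply: (@dynkin_induction _ _ G
  (fun A => \int[P]_x (W x * \1_A (Y x)) = c * fine (Q A)) GE GI).
- rewrite [X in c * fine X](@probability_setT _ _ _ Q) mulr1 -W1.
  by apply: eq_Rintegral => x _; rewrite indicE in_setT mulr1.
- exact: HG.
- move=> A mA IH.
  rewrite probability_setC// fineB//; last exact: fin_num_measure.
  rewrite mulrBr mulr1 -{1}W1 -IH -bRintegralB//; last exact: bWA.
  apply: eq_Rintegral => x _; rewrite !indicE in_setC.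
  by case: (_ \in _); rewrite ?mulr0 ?mulr1 ?subrr ?subr0.
move=> F mF tF IH.
have [M [M0 WM]] : exists M, 0 <= M /\ forall x, `|W x| <= M.
  by have [_ [M h]] := bW; exists M; split => //; apply: le_trans (h point).
have mU n : measurable (\big[setU/set0]_(i < n) F i) by exact: bigsetU_measurable.
have mB : measurable (\bigcup_k F k) by exact: bigcup_measurable.
have I1 n x : (\1_(\big[setU/set0]_(i < n) F i) (Y x) : R) = \sum_(i < n) \1_(F i) (Y x).
  rewrite !indicE.
  have [/set_mem|] := boolP (_ \in \big[setU/set0]_(i < n) F i).
    rewrite -bigcup_mkord => -[i /= ni Fi].
    rewrite (bigD1 (Ordinal ni))//= indicE mem_set//= big1 ?addr0// => j ji.
    rewrite indicE memNset// => Fj; move/trivIsetP : tF => /(_ j i I I).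
    have jni : (j : nat) != i by apply: contra ji => /eqP ji; apply/eqP/val_inj.
    by move=> /(_ jni) /seteqP[+ _] => /(_ (Y x)); apply.
  move=> nF; rewrite big1// => i _; rewrite indicE memNset// => Fi.
  move: nF; rewrite mem_set//= -bigcup_mkord; exists (val i) => //=.
have lim1 : (\int[P]_x (W x * \1_(\big[setU/set0]_(i < n) F i) (Y x))) @[n --> \oo]
    --> \int[P]_x (W x * \1_(\bigcup_k F k) (Y x)).
  apply: (bounded_convergence (M := M)).
  - by move=> n; exact: (bWA _ (mU n)).1.
  - exact: (bWA _ mB).1.
  - move=> n x; rewrite normrM -[leRHS]mulr1; apply: ler_pM => //.
    by rewrite indicE; case: (_ \in _); rewrite ?normr1 ?normr0.
  - move=> x; apply: cvgM; first exact: cvg_cst.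
    apply: cvg_near_cst; rewrite /= indicE.
    have [/set_mem[k _ Fk]|] := boolP (Y x \in \bigcup_k F k).
      near=> n; rewrite indicE mem_set// -bigcup_mkord; exists k => //=.
      by near: n; exact: nbhs_infty_gt.
    move=> nF; apply: nearW => n; rewrite indicE memNset// -bigcup_mkord => -[k /= _ Fk].
    by move: nF; rewrite mem_set//; exists k.
have lim2 : (\int[P]_x (W x * \1_(\big[setU/set0]_(i < n) F i) (Y x))) @[n --> \oo]
    --> c * fine (Q (\bigcup_k F k)).
  have -> : (fun n => \int[P]_x (W x * \1_(\big[setU/set0]_(i < n) F i) (Y x))) =
      (fun n => c * fine (\sum_(0 <= i < n) Q (F i))%E).
    apply/funext => n.
    under eq_Rintegral do rewrite I1.
    elim: n => [|n IHn].
      rewrite big_nil/= mulr0.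
      under eq_Rintegral do rewrite big_ord0 mulr0.
      by rewrite Rintegral_cst// mul0r.
    under eq_Rintegral do rewrite big_ord_recr/= mulrDr.
    have bS : bounded_measurable (fun x => W x * \sum_(i < n) \1_(F i) (Y x)).
      apply: bounded_measurableM => //; apply: bounded_measurable_sum => i.
      exact: bounded_measurable_preimage.
    rewrite (bRintegralD P bS (bWA _ (mF n))).
    rewrite IHn IH big_nat_recr//= fineD ?mulrDr//; last exact: fin_num_measure.
    by apply/sum_fin_numP => i _ _; exact: fin_num_measure.
  apply: cvgM; first exact: cvg_cst.
  apply: fine_cvg; rewrite fineK; last exact: fin_num_measure.
  exact: measure_sigma_additive.
exact: (cvg_unique _ lim1 lim2).
Unshelve. all: by end_near. Qed.

End weighted_dynkin.

(** * Gaussian smoothing *)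

Lemma Rintegral_swap d1 d2 (T1 : measurableType d1) (T2 : measurableType d2)
    (R : realType) (P1 : probability T1 R) (P2 : probability T2 R) (f : T1 * T2 -> R) :
  bounded_measurable f ->
  \int[P1]_x \int[P2]_y f (x, y) = \int[P2]_y \int[P1]_x f (x, y).
Proof.
move=> bf; pose P12 : probability (T1 * T2)%type R := (P1 \x P2)%E.
have I : (P1 \x P2)%E.-integrable setT (EFin \o f).
  exact: (bounded_measurable_integrable P12).
have := Fubini I; rewrite /Rintegral => E; congr fine.
have bx x : bounded_measurable (fun y => f (x, y)) by exact: bounded_measurable_section.
have by_ y : bounded_measurable (fun x => f (x, y)).
  by apply: (bounded_measurable_comp bf); exact: measurable_pair2.
under eq_integral do rewrite -/(Rintegral P2 setT _) -Rintegral_EFin//.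
by under [RHS]eq_integral do rewrite -/(Rintegral P1 setT _) -Rintegral_EFin//.
Qed.

Section gauss_smoothing.
Context d (T : measurableType d) (R : realType) (P : probability T R).
Notation mu := (@lebesgue_measure R).
Variables (W xi : T -> R).
Hypothesis bW : bounded_measurable W.
Hypothesis mxi : measurable_fun setT xi.
Variable e : R.
Hypothesis e0 : 0 < e.

(** A Gaussian kernel of width e is the cosine transform of a normal law of width
    1/e. Smoothed integrals therefore depend on W and xi only through the cosine
    transform. *)
Lemma weighted_kernel y :
  \int[P]_x (W x * normal_pdf (xi x) e y) =
  normal_peak e *
    \int[normal_prob 0 e^-1]_z \int[P]_x (W x * cos (- z * xi x + z * y)).
Proof.
pose F (xz : T * R) := W xz.1 * cos (- xz.2 * xi xz.1 + xz.2 * y).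
have bF : bounded_measurable F.
  apply: bounded_measurableM; first exact: (bounded_measurable_comp bW measurable_fst).
  split; last by exists 1 => z; exact: cos_max.
  apply: (measurableT_comp (continuous_measurable_fun (@continuous_cos R))).
  apply: measurable_funD; last exact: measurable_funM.
  by apply: measurable_funM; [exact: measurableT_comp|exact: (measurableT_comp mxi)].
rewrite -(Rintegral_swap P (normal_prob 0 e^-1) bF) -bRintegralZ; last first.
  exact: bounded_measurable_Rintegral.
apply: eq_Rintegral => x _ /=.
have e'0 : 0 < e^-1 by rewrite invr_gt0.
have bc : bounded_measurable (fun z : R => cos (- z * xi x + z * y)).
  split; last by exists 1 => z; exact: cos_max.
  apply: (measurableT_comp (continuous_measurable_fun (@continuous_cos R))).
  by apply: measurable_funD; apply: measurable_funM => //; exact: measurableT_comp.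
rewrite (_ : \int[normal_prob 0 e^-1]_z F (x, z) =
  W x * \int[normal_prob 0 e^-1]_z cos (- z * xi x + z * y)); last exact: (bRintegralZ (normal_prob 0 e^-1) (W x) bc).
rewrite mulrCA; congr (_ * _).
have := @Rintegral_normal_cos R e^-1 e'0 0 (y - xi x).
rewrite cos0 mulr1 => H.
rewrite normal_pdfE ?gt_eqF// /normal_fun; congr (_ * _).
transitivity (expR (- (e^-1 ^+ 2 * (y - xi x) ^+ 2) / 2)).
  by congr expR; rewrite mulr2n; field; rewrite !gt_eqF ?addr_gt0 ?exprn_gt0.
rewrite -H; apply: eq_Rintegral => z _; congr cos; ring.
Qed.

Variable g : R -> R.
Hypothesis mg : measurable_fun setT g.
Hypothesis g01 : forall y, 0 <= g y <= 1.

Let bg : bounded_measurable g.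
Proof.
by split => //; exists 1 => y; have /andP[g0 g1] := g01 y; rewrite ger0_norm.
Qed.

(** The convolution of g with a normal density of width e. *)
Definition gauss_smooth (a : R) := \int[normal_prob a e]_y g y.

Let mK : measurable_fun setT (fun xy : T * R => g xy.2 * normal_pdf (xi xy.1) e xy.2).
Proof.
apply: measurable_funM; first exact: (measurableT_comp mg measurable_snd).
have -> : (fun xy : T * R => normal_pdf (xi xy.1) e xy.2) =
    (fun xy => normal_peak e * expR (- (xy.2 - xi xy.1) ^+ 2 / (e ^+ 2 *+ 2))).
  by apply/funext => xy; rewrite normal_pdfE// gt_eqF.
apply: measurable_funM => //; apply: measurableT_comp => //.
apply: measurable_funM => //; apply: measurableT_comp => //.
apply: measurable_funX; apply: measurable_funB => //.
exact: (measurableT_comp mxi measurable_fst).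
Qed.

Lemma gauss_smoothE x :
  (\int[mu]_y (g y * normal_pdf (xi x) e y)%:E = (gauss_smooth (xi x))%:E)%E.
Proof.
rewrite -(Rintegral_EFin (normal_prob (xi x) e) bg).
by rewrite integral_normal.
Qed.

Lemma gauss_smooth01 a : 0 <= gauss_smooth a <= 1.
Proof.
apply/andP; split.
  by apply: Rintegral_ge0 => y _; have /andP[] := g01 y.
have := ble_Rintegral (normal_prob a e) bg (bounded_measurable_cst _ 1) (fun y => proj2 (andP (g01 y))).
by rewrite Rintegral_cst// [X in fine X](@probability_setT _ _ _ (normal_prob a e)) mul1r.
Qed.

Lemma bounded_measurable_gauss_smooth :
  bounded_measurable (fun x => gauss_smooth (xi x)).
Proof.
split; last first.
  by exists 1 => x; have /andP[g0 g1] := gauss_smooth01 (xi x); rewrite ger0_norm.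
have mF : measurable_fun setT (fun xy : T * R => (g xy.2 * normal_pdf (xi xy.1) e xy.2)%:E).
  exact/measurable_EFinP.
have := @measurable_fun_fubini_tonelli_F _ _ _ _ _ mu _ mF.
move=> H; apply/measurable_EFinP; apply: (eq_measurable_fun _ _ (H _)).
  by move=> x _; rewrite /fubini_F/= gauss_smoothE.
move=> xy; rewrite lee_fin mulr_ge0 ?normal_pdf_ge0//.
by have /andP[] := g01 xy.2.
Qed.

(** Fubini, to move the smoothing from g to the law of xi. *)
Lemma weighted_smooth :
  \int[P]_x (W x * gauss_smooth (xi x)) =
  \int[mu]_y (g y * \int[P]_x (W x * normal_pdf (xi x) e y)).
Proof.
pose F (xy : T * measurableTypeR R) := (W xy.1 * (g xy.2 * normal_pdf (xi xy.1) e xy.2))%:E.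
have mF : measurable_fun [set: T * measurableTypeR R] F.
  apply/measurable_EFinP; apply: measurable_funM => //.
  exact: (measurableT_comp bW.1 measurable_fst).
have [_ [M WM]] := bW.
have iF : (P \x mu)%E.-integrable setT F.
  apply/(integrable12ltyP P mu mF).
  apply: (@le_lt_trans _ _ (\int[P]_x (cst M%:E x))%E); last first.
    by rewrite integral_cst// [X in (_ * X)%E](@probability_setT _ _ _ P) mule1 ltry.
  apply: ge0_le_integral => //.
  - by move=> x _; exact: integral_ge0.
  - have mF' : measurable_fun [set: T * measurableTypeR R] (abse \o F) by exact: measurableT_comp.
    exact: (@measurable_fun_fubini_tonelli_F _ _ _ _ _ mu _ mF' (fun z => abse_ge0 _)).
  move=> x _.
  apply: (@le_trans _ _ (\int[mu]_y (M%:E * (normal_pdf (xi x) e y)%:E))%E).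
    apply: ge0_le_integral => //.
    - apply: measurableT_comp => //; apply: measurableT_comp mF _.
      exact: measurable_pair1.
    - apply: emeasurable_funM => //; apply/measurable_EFinP.
      exact: measurable_normal_pdf.
    - move=> y _; rewrite -EFinM lee_fin normrM; apply: ler_pM => //.
      have /andP[g0 g1] := g01 y.
      rewrite ger0_norm ?mulr_ge0 ?normal_pdf_ge0//.
      by rewrite ler_piMl ?normal_pdf_ge0.
  rewrite integralZl//; last exact: integrable_normal_pdf.
  by rewrite integral_normal_pdf mule1.
have := Fubini iF.
have E1 x : (\int[mu]_y F (x, y) = (W x * gauss_smooth (xi x))%:E)%E.
  rewrite /F/=; under eq_integral do rewrite EFinM.
  rewrite integralZl//; first by rewrite gauss_smoothE.
  apply: integrable_normal => //; exact: bounded_measurable_integrable.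
have bk y : bounded_measurable (fun x => normal_pdf (xi x) e y).
  split.
    have -> : (fun x => normal_pdf (xi x) e y) =
        (fun x => normal_peak e * expR (- (y - xi x) ^+ 2 / (e ^+ 2 *+ 2))).
      by apply/funext => x; rewrite normal_pdfE// gt_eqF.
    apply: measurable_funM => //; apply: measurableT_comp => //.
    apply: measurable_funM => //; apply: measurableT_comp => //.
    by apply: measurable_funX; exact: measurable_funB.
  exists (normal_peak e) => x; rewrite ger0_norm ?normal_pdf_ge0//.
  by rewrite normal_pdf_ub// gt_eqF.
have E2 y : (\int[P]_x F (x, y) = (g y * \int[P]_x (W x * normal_pdf (xi x) e y))%:E)%E.
  have bWk : bounded_measurable (fun x => W x * normal_pdf (xi x) e y).
    exact: bounded_measurableM.
  rewrite -bRintegralZ// -Rintegral_EFin; last exact: bounded_measurableZ.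
  by apply: eq_integral => x _; rewrite /F/= mulrCA.
under eq_integral do rewrite E1.
under [X in _ = X -> _]eq_integral do rewrite E2.
by rewrite /Rintegral => ->.
Qed.

End gauss_smoothing.

(** The mean distance of a normal variable to its center is of the order of e. *)
Lemma gauss_smooth_lipschitz (R : realType) (g : R -> R) (e L a : R) : 0 < e ->
  measurable_fun setT g -> (forall y, 0 <= g y <= 1) -> 0 <= L ->
  (forall x y, `|g x - g y| <= L * `|x - y|) ->
  `|g a - gauss_smooth e g a| <= L * (2 * e * Num.sqrt 2).
Proof.
move=> e0 mg g01 L0 gL.
have bg : bounded_measurable g.
  by split => //; exists 1 => y; have /andP[g0 g1] := g01 y; rewrite ger0_norm.
have bd : bounded_measurable (fun y => g a - g y).
  by apply: bounded_measurableB => //; exact: bounded_measurable_cst.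
have -> : g a - gauss_smooth e g a = \int[normal_prob a e]_y (g a - g y).
  have -> : \int[normal_prob a e]_y (g a - g y) =
      \int[normal_prob a e]_y (cst (g a) y) - \int[normal_prob a e]_y g y.
    exact: (bRintegralB (normal_prob a e) (bounded_measurable_cst _ (g a)) bg).
  by rewrite Rintegral_cst// [X in fine X](@probability_setT _ _ _ (normal_prob a e)) mulr1.
apply: le_trans (le_normr_Rintegral _ _) _ => //.
  exact: bounded_measurable_integrable.
rewrite -lee_fin -Rintegral_EFin; last exact: bounded_measurable_norm.
apply: (@le_trans _ _ (\int[normal_prob a e]_y (L%:E * `|y - a|%:E))%E).
  apply: ge0_le_integral => //.
  - by apply/measurable_EFinP; exact: (bounded_measurable_norm bd).1.
  - apply: emeasurable_funM => //; apply/measurable_EFinP.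
    by apply: measurableT_comp => //; exact: measurable_funB.
  - by move=> y _; rewrite -EFinM lee_fin (distrC y); exact: gL.
rewrite ge0_integralZl//; last first.
  by apply/measurable_EFinP; apply: measurableT_comp => //; exact: measurable_funB.
by rewrite EFinM lee_wpmul2l// normal_abs_moment.
Qed.

(** * Cosine transforms determine weighted laws *)

Section ramp.
Variable R : realType.
Implicit Types t k x y : R.

(** Lipschitz functions increasing to the indicator of ]t, +oo[. *)
Definition ramp t k y := Num.min 1 (Num.max 0 (k * (y - t))).

Lemma ramp01 t k y : 0 <= ramp t k y <= 1.
Proof. by rewrite /ramp le_min ler01 ge_min lexx le_max lexx. Qed.

Lemma ramp_lipschitz t k x y : 0 <= k ->
  `|ramp t k x - ramp t k y| <= k * `|x - y|.
Proof.
move=> k0; rewrite -[k in leRHS]ger0_norm// -normrM.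
have -> : k * (x - y) = k * (x - t) - k * (y - t) by ring.
rewrite /ramp; move: (k * (x - t)) (k * (y - t)) => a b.
have lip_max (c p q : R) : `|Num.max c p - Num.max c q| <= `|p - q|.
  have := ler_norm (p - q); have := ler_norm (q - p); rewrite distrC ler_norml.
  by case: (leP c p) => ?; case: (leP c q) => ?; move=> ? ?; apply/andP; split; lra.
have lip_min (c p q : R) : `|Num.min c p - Num.min c q| <= `|p - q|.
  have := ler_norm (p - q); have := ler_norm (q - p); rewrite distrC ler_norml.
  by case: (leP c p) => ?; case: (leP c q) => ?; move=> ? ?; apply/andP; split; lra.
exact: le_trans (lip_min _ _ _) (lip_max _ _ _).
Qed.

Lemma measurable_ramp t k : measurable_fun setT (ramp t k).
Proof.
apply: measurable_minr => //; apply: measurable_maxr => //.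
by apply: measurable_funM => //; exact: measurable_funB.
Qed.

Lemma cvg_ramp t y : ramp t n%:R y @[n --> \oo] --> (\1_(`]t, +oo[%classic) y : R).
Proof.
rewrite indicE; have [|] := boolP (y \in `]t, +oo[%classic).
  rewrite inE/= in_itv/= andbT -subr_gt0 => ty.
  apply: cvg_near_cst; near=> n.
  rewrite /ramp; apply/min_idPl; rewrite le_max; apply/orP; right.
  rewrite -ler_pdivrMr//; near: n; exact: nbhs_infty_ger.
rewrite notin_setE/= in_itv/= andbT => /negP; rewrite -leNgt -subr_le0 => ty.
apply: cvg_near_cst; apply: nearW => n; rewrite /ramp.
by rewrite (max_idPl _) ?(min_idPr _)// mulr_ge0_le0.
Unshelve. all: by end_near. Qed.

End ramp.

Section fourier_uniqueness.
Context d (T : measurableType d) d' (T' : measurableType d') (R : realType).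
Variables (P : probability T R) (P' : probability T' R).
Variables (W xi : T -> R) (W' xi' : T' -> R).
Hypothesis bW : bounded_measurable W.
Hypothesis bW' : bounded_measurable W'.
Hypothesis mxi : measurable_fun setT xi.
Hypothesis mxi' : measurable_fun setT xi'.
Hypothesis same_cos : forall a b,
  \int[P]_x (W x * cos (a * xi x + b)) = \int[P']_x (W' x * cos (a * xi' x + b)).

Lemma weighted_smooth_error d1 (T1 : measurableType d1) (P1 : probability T1 R)
    (W1 xi1 : T1 -> R) (g : R -> R) L M e : 0 < e ->
  bounded_measurable W1 -> measurable_fun setT xi1 ->
  measurable_fun setT g -> (forall y, 0 <= g y <= 1) -> 0 <= L ->
  (forall x y, `|g x - g y| <= L * `|x - y|) -> (forall x, `|W1 x| <= M) ->
  `|\int[P1]_x (W1 x * g (xi1 x)) - \int[P1]_x (W1 x * gauss_smooth e g (xi1 x))|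
  <= M * (L * (2 * e * Num.sqrt 2)).
Proof.
move=> e0 bW1 mxi1 mg g01 L0 gL WM.
have bg : bounded_measurable g.
  by split => //; exists 1 => y; have /andP[g0 g1] := g01 y; rewrite ger0_norm.
have bWg : bounded_measurable (fun x => W1 x * g (xi1 x)).
  by apply: bounded_measurableM => //; apply: (bounded_measurable_comp bg mxi1).
have bWs : bounded_measurable (fun x => W1 x * gauss_smooth e g (xi1 x)).
  by apply: bounded_measurableM => //; exact: bounded_measurable_gauss_smooth.
rewrite -bRintegralB//.
have bd := bounded_measurableB bWg bWs.
apply: le_trans (le_normr_Rintegral _ _) _ => //.
  exact: bounded_measurable_integrable.
set K := M * _.
have := ble_Rintegral P1 (bounded_measurable_norm bd) (bounded_measurable_cst _ K).
rewrite Rintegral_cst// [X in fine X](@probability_setT _ _ _ P1) mulr1.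
apply=> x; rewrite -mulrBr normrM; apply: ler_pM => //.
exact: gauss_smooth_lipschitz.
Qed.

(** Smoothing changes the integrals by O(e), and after smoothing they agree by
    [weighted_kernel]. *)
Lemma weighted_law_lipschitz (g : R -> R) L : measurable_fun setT g ->
  (forall y, 0 <= g y <= 1) -> 0 <= L ->
  (forall x y, `|g x - g y| <= L * `|x - y|) ->
  \int[P]_x (W x * g (xi x)) = \int[P']_x (W' x * g (xi' x)).
Proof.
move=> mg g01 L0 gL.
have [_ [M WM]] := bW; have [_ [M' WM']] := bW'.
apply/eqP; rewrite -subr_eq0 -normr_le0.
apply: (@le0_of_small _ _ ((M + M') * (L * (2 * Num.sqrt 2))) 1) => // e e0 _.
have H1 := weighted_smooth_error P e0 bW mxi mg g01 L0 gL WM.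
have H2 := weighted_smooth_error P' e0 bW' mxi' mg g01 L0 gL WM'.
have E : \int[P]_x (W x * gauss_smooth e g (xi x)) =
    \int[P']_x (W' x * gauss_smooth e g (xi' x)).
  rewrite !weighted_smooth//; apply: eq_Rintegral => y _; congr (_ * _).
  by rewrite !weighted_kernel//; congr (_ * _); apply: eq_Rintegral => z _.
rewrite E in H1.
rewrite -(subrKA (\int[P']_x (W' x * gauss_smooth e g (xi' x)))).
apply: le_trans (ler_normD _ _) _.
rewrite [X in _ + X]distrC; apply: le_trans (lerD H1 H2) _.
by rewrite le_eqVlt; apply/orP; left; apply/eqP; ring.
Qed.

Lemma weighted_law_ray t :
  \int[P]_x (W x * \1_(`]t, +oo[%classic) (xi x)) =
  \int[P']_x (W' x * \1_(`]t, +oo[%classic) (xi' x)).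
Proof.
have cv d1 (T1 : measurableType d1) (P1 : probability T1 R) (W1 xi1 : T1 -> R) :
    bounded_measurable W1 -> measurable_fun setT xi1 ->
    (\int[P1]_x (W1 x * ramp t n%:R (xi1 x))) @[n --> \oo] -->
    \int[P1]_x (W1 x * \1_(`]t, +oo[%classic) (xi1 x)).
  move=> bW1 mxi1; have [mW1 [M WM]] := bW1.
  apply: (@bounded_convergence _ _ R P1 (fun n x => W1 x * ramp t n%:R (xi1 x))
    (fun x => W1 x * \1_(`]t, +oo[%classic) (xi1 x)) M).
  - move=> n; apply: measurable_funM => //.
    exact: (measurableT_comp (measurable_ramp t n%:R) mxi1).
  - apply: measurable_funM => //.
    by apply: (measurableT_comp _ mxi1); exact: measurable_indic.
  - move=> n x; rewrite normrM -[leRHS]mulr1; apply: ler_pM => //.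
    by have /andP[r0 r1] := ramp01 t n%:R (xi1 x); rewrite ger0_norm.
  - by move=> x; apply: cvgM; [exact: cvg_cst|exact: cvg_ramp].
have H1 := cv _ _ P W xi bW mxi.
have H2 := cv _ _ P' W' xi' bW' mxi'.
have E n : \int[P]_x (W x * ramp t n%:R (xi x)) = \int[P']_x (W' x * ramp t n%:R (xi' x)).
  apply: (@weighted_law_lipschitz _ n%:R) => //.
  - exact: measurable_ramp.
  - exact: ramp01.
  - by move=> x y; exact: ramp_lipschitz.
rewrite (eq_cvg _ _ E) in H1.
exact: (cvg_unique _ H1 H2).
Qed.

End fourier_uniqueness.

Section gauss_law.
Context d (T : measurableType d) (R : realType) (P : probability T R).

(** Open rays generate the Borel sets and are stable under intersection. *)
Lemma weighted_normal_law (W xi : T -> R) c :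
  bounded_measurable W -> measurable_fun setT xi ->
  (forall a b, \int[P]_x (W x * cos (a * xi x + b)) = c * expR (- a ^+ 2 / 2) * cos b) ->
  forall A : set R, measurable A ->
  \int[P]_x (W x * \1_A (xi x)) = c * fine (normal_prob 0 1 A).
Proof.
move=> bW mxi H.
have W1 : \int[P]_x W x = c.
  have := H 0 0; rewrite expr0n/= oppr0 mul0r expR0 cos0 !mulr1 => <-.
  by apply: eq_Rintegral => x _; rewrite mul0r addr0 cos0 mulr1.
apply: (@weighted_dynkin _ _ _ (measurableTypeR R) R P (normal_prob 0 1) xi mxi W c bW W1 (@RGenOInfty.G R)).
- exact: RGenOInfty.measurableE.
- move=> _ _ [x ->] [y ->]; exists (Num.max x y).
  by apply/seteqP; split => z /=; rewrite !in_itv/= !andbT gt_max => /andP.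
move=> _ [t ->].
have bc : bounded_measurable (cst c : R -> R) by exact: bounded_measurable_cst.
rewrite (weighted_law_ray (P' := normal_prob 0 1) (W' := cst c) (xi' := id) bW bc mxi)//.
  have mI : measurable (`]t, +oo[%classic : set R) by exact: measurable_itv.
  rewrite (bRintegralZ (normal_prob 0 1) c (bounded_measurable_indic R mI)).
  by rewrite /Rintegral integral_indic// setIT.
move=> a b; rewrite H.
have bcos : bounded_measurable (fun x : R => cos (a * x + b)).
  split; last by exists 1 => x; exact: cos_max.
  apply: (measurableT_comp (continuous_measurable_fun (@continuous_cos R))).
  by apply: measurable_funD => //; exact: measurable_funM.
rewrite (bRintegralZ (normal_prob 0 1) c bcos) Rintegral_normal_cos//.
by rewrite expr1n mul1r mulrA.
Qed.

End gauss_law.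

(** * Standard Gaussian vectors *)

Section gauss_vector.
Context d (T : measurableType d) (R : realType) (P : probability T R).

Fixpoint tuple_map m (xi : nat -> T -> R) (x : T) : coords R m :=
  match m return coords R m with
  | 0 => tt
  | m'.+1 => (xi 0%N x, tuple_map m' (fun i => xi i.+1) x)
  end.

Lemma crd_tuple_map m xi x i : (i < m)%N -> crd (tuple_map m xi x) i = xi i x.
Proof.
by elim: m xi i => // m IH xi [|i] //= im; rewrite IH.
Qed.

Lemma measurable_tuple_map m (xi : nat -> T -> R) :
  (forall i, measurable_fun setT (xi i)) -> measurable_fun setT (tuple_map m xi).
Proof.
elim: m xi => [|m IH] xi mxi /=; first exact: measurable_cst.
exact: (measurable_fun_pair (mxi 0%N) (IH _ (fun i => mxi i.+1))).
Qed.

(** Induction on m. The event for the first coordinate is made part of the weight.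
    The new weight satisfies the hypothesis for the other coordinates by
    [weighted_normal_law], whose own hypothesis is a product of two cosines, a
    half-sum of cosines of linear combinations of all the coordinates. *)
Lemma weighted_gauss_law m (W : T -> R) (xi : nat -> T -> R) c :
  bounded_measurable W -> (forall i, measurable_fun setT (xi i)) ->
  (forall (a : nat -> R) b,
    \int[P]_x (W x * cos (\sum_(i < m) a i * xi i x + b)) =
    c * expR (- (\sum_(i < m) a i ^+ 2) / 2) * cos b) ->
  forall C, measurable C ->
  \int[P]_x (W x * \1_C (tuple_map m xi x)) = c * fine (gauss R m C).
Proof.
elim: m W xi c => [|m IH] W xi c bW mxi H.
  have W1 : \int[P]_x W x = c.
    have := H (fun=> 0) 0; rewrite big_ord0 oppr0 mul0r expR0 cos0 !mulr1 => <-.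
    by apply: eq_Rintegral => x _; rewrite big_ord0 addr0 cos0 mulr1.
  move=> C mC.
  have -> : fine (gauss R 0 C) = \1_C (tt : coords R 0) by [].
  rewrite -W1 mulrC -bRintegralZ//; apply: eq_Rintegral => x _; exact: mulrC.
have mt := @measurable_tuple_map m.+1 xi mxi.
have W1 : \int[P]_x W x = c.
  have := H (fun=> 0) 0.
  have -> : \sum_(i < m.+1) (0 : R) ^+ 2 = 0 by rewrite big1// => i _; rewrite expr0n.
  rewrite oppr0 mul0r expR0 cos0 !mulr1 => <-.
  by apply: eq_Rintegral => x _; rewrite big1 ?addr0 ?cos0 ?mulr1// => i _; rewrite mul0r.
apply: (@weighted_dynkin _ _ _ _ R P (gauss R m.+1) _ mt W c bW W1
  [set A `*` B | A in measurable & B in measurable]).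
- exact: measurable_prod_measurableType.
- move=> _ _ [A mA [B mB <-]] [A' mA' [B' mB' <-]].
  exists (A `&` A'); first exact: measurableI.
  exists (B `&` B'); first exact: measurableI.
  by rewrite setXI.
move=> _ [A mA [B mB <-]].
have PE : fine (gauss R m.+1 (A `*` B)) = fine (normal_prob 0 1 A) * fine (gauss R m B).
  by rewrite /= product_measure1E// fineM// fin_num_measure.
rewrite PE mulrA.
pose W' x := W x * \1_A (xi 0%N x).
have bA : bounded_measurable (fun x => \1_A (xi 0%N x) : R).
  exact: (bounded_measurable_comp (bounded_measurable_indic R mA) (mxi 0%N)).
have bW' : bounded_measurable W' by exact: bounded_measurableM.
rewrite -(IH W' (fun i => xi i.+1) (c * fine (normal_prob 0 1 A)) bW' (fun i => mxi i.+1) _ B mB).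
  apply: eq_Rintegral => x _; rewrite /W' -mulrA; congr (_ * _).
  rewrite !indicE in_setX /=.
  by do 2 case: (_ \in _); rewrite ?mulr0 ?mulr1 ?mul0r.
move=> a b; pose W2 x := W x * cos (\sum_(i < m) a i * xi i.+1 x + b).
have bW2 : bounded_measurable W2.
  apply: bounded_measurableM => //; split; last by exists 1 => z; exact: cos_max.
  apply: (measurableT_comp (continuous_measurable_fun (@continuous_cos R))).
  apply: measurable_funD => //; apply: measurable_sum => i.
  exact: measurable_funM.
have := @weighted_normal_law _ _ R P W2 (xi 0%N)
  (c * expR (- (\sum_(i < m) a i ^+ 2) / 2) * cos b) bW2 (mxi 0%N).
move=> /(_ _ A mA) K.
transitivity (\int[P]_x (W2 x * \1_A (xi 0%N x))).
  by apply: eq_Rintegral => x _; rewrite /W' /W2 mulrAC.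
rewrite K; first by ring.
move=> s t.
(* The coefficients of s xi_0 + sum_i a_i xi_(i+1); the two choices s and -s give
   the half-sum formula for a product of cosines. *)
pose ap (s : R) i := if i is i'.+1 then a i' else s.
have sumE s' x : \sum_(i < m.+1) ap s' i * xi i x =
    s' * xi 0%N x + \sum_(i < m) a i * xi i.+1 x by rewrite big_ord_recl.
have sqE s' : \sum_(i < m.+1) ap s' i ^+ 2 = s' ^+ 2 + \sum_(i < m) a i ^+ 2.
  by rewrite big_ord_recl.
have H1 := H (ap s) (b + t); have H2 := H (ap (- s)) (b - t).
rewrite sqE in H1; rewrite sqE sqrrN in H2.
have bcos (s' t' : R) : bounded_measurable (fun x => W x * cos (\sum_(i < m.+1) ap s' i * xi i x + t')).
  apply: bounded_measurableM => //; split; last by exists 1 => z; exact: cos_max.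
  apply: (measurableT_comp (continuous_measurable_fun (@continuous_cos R))).
  apply: measurable_funD => //; apply: measurable_sum => i.
  exact: measurable_funM.
transitivity (2^-1 * (\int[P]_x (W x * cos (\sum_(i < m.+1) ap s i * xi i x + (b + t))) +
   \int[P]_x (W x * cos (\sum_(i < m.+1) ap (- s) i * xi i x + (b - t))))).
  rewrite -bRintegralD// -bRintegralZ; last exact: bounded_measurableD.
  apply: eq_Rintegral => x _; rewrite !sumE /W2.
  move: (\sum_(i < m) _) => S.
  set u := S + b; set v := s * xi 0%N x + t.
  rewrite (_ : s * _ + _ + _ = u + v); last by rewrite /u /v; ring.
  rewrite (_ : - s * _ + _ + _ = u - v); last by rewrite /u /v; ring.
  by clearbody u v; rewrite cosD cosB; field.
rewrite H1 H2 cosD cosB.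
have -> : expR (- (s ^+ 2 + \sum_(i < m) a i ^+ 2) / 2) =
    expR (- s ^+ 2 / 2) * expR (- (\sum_(i < m) a i ^+ 2) / 2).
  by rewrite -expRD; congr expR; ring.
by field.
Qed.

(** The case of the constant weight 1 in [weighted_gauss_law], extended from
    indicators to bounded functions by the change of variables formula. *)
Lemma gauss_law m (xi : nat -> T -> R) (F : coords R m -> R) :
  (forall i, measurable_fun setT (xi i)) ->
  (forall (a : nat -> R) b,
    \int[P]_x cos (\sum_(i < m) a i * xi i x + b) =
    expR (- (\sum_(i < m) a i ^+ 2) / 2) * cos b) ->
  bounded_measurable F ->
  \int[P]_x F (tuple_map m xi x) = \int[gauss R m]_z F z.
Proof.
move=> mxi H bF; have mt := @measurable_tuple_map m xi mxi.
have law C : measurable C -> P (tuple_map m xi @^-1` C) = gauss R m C.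
  move=> mC.
  have := @weighted_gauss_law m (cst 1) xi 1 (bounded_measurable_cst _ 1) mxi _ C mC.
  rewrite mul1r => K.
  have mpC : measurable (tuple_map m xi @^-1` C) by rewrite -[X in measurable X]setTI; exact: mt.
  rewrite -[RHS]fineK ?fin_num_measure// -K; last first.
    move=> a b; rewrite mul1r -H; apply: eq_Rintegral => x _; exact: mul1r.
  rewrite -Rintegral_EFin; last first.
    by apply: bounded_measurableM; [exact: bounded_measurable_cst|
      exact: (bounded_measurable_comp (bounded_measurable_indic R mC) mt)].
  rewrite -[in LHS](setIT (tuple_map m xi @^-1` C)).
  have := @integral_indic _ T R P setT measurableT _ mpC.
  move=> <-; apply: eq_integral => x _; rewrite mul1r; congr (_%:E).
have mF : measurable_fun setT (EFin \o F) by apply/measurable_EFinP; exact: bF.1.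
have iF : P.-integrable (tuple_map m xi @^-1` setT) ((EFin \o F) \o tuple_map m xi).
  exact: (bounded_measurable_integrable P (bounded_measurable_comp bF mt)).
have := @integral_pushforward _ _ _ _ R _ mt P setT (EFin \o F) mF iF measurableT.
rewrite (eq_measure_integral (gauss R m)); last by move=> A mA _; exact: law.
by rewrite /Rintegral => ->.
Qed.

End gauss_vector.

(** * The Hahn-Banach separation theorem *)

Section sublinear.
Variables (R : realType) (X : lmodType R).
Implicit Types (p q : X -> R) (a x y : X).

Definition sublinear q :=
  (forall x y, q (x + y) <= q x + q y) /\
  (forall t x, 0 <= t -> q (t *: x) = t * q x).

Lemma sublinear0 q : sublinear q -> q 0 = 0.
Proof. by move=> [_ qZ]; rewrite -(scale0r 0) qZ// mul0r. Qed.

Lemma sublinear_oppr q x : sublinear q -> - q (- x) <= q x.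
Proof.
move=> sq; rewrite lerNl -subr_ge0 opprK -(sublinear0 sq) -[in leLHS](subrr x).
by rewrite addrC; exact: sq.1.
Qed.

Definition descent_set q a x :=
  [set r : R | exists2 t, 0 <= t & r = q (x + t *: a) - t * q a].

(** The sublinear functional obtained from q by making it as small as possible in the
    direction - a. It equals q only if q is additive in the direction a. *)
Definition descent q a x := inf (descent_set q a x).

Lemma descent_lb q a x : sublinear q -> lbound (descent_set q a x) (- q (- x)).
Proof.
move=> sq _ [t t0 ->]; rewrite lerBrDr addrC lerBlDr -(sq.2 _ _ t0).
by have := sq.1 (x + t *: a) (- x); rewrite addrAC subrr add0r.
Qed.

Lemma descent_le q a x t : sublinear q -> 0 <= t ->
  descent q a x <= q (x + t *: a) - t * q a.
Proof.
move=> sq t0; apply: ge_inf; last by exists t.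
by exists (- q (- x)); exact: descent_lb.
Qed.

Lemma le_descent q a x r :
  (forall t, 0 <= t -> r <= q (x + t *: a) - t * q a) -> r <= descent q a x.
Proof.
move=> H; apply: lb_le_inf; last by move=> _ [t t0 ->]; exact: H.
by exists (q (x + 0 *: a) - 0 * q a); exists 0.
Qed.

Lemma descent_le_self q a x : sublinear q -> descent q a x <= q x.
Proof.
by move=> sq; have := descent_le a x sq (lexx 0); rewrite scale0r addr0 mul0r subr0.
Qed.

Lemma sublinear_descent q a : sublinear q -> sublinear (descent q a).
Proof.
move=> sq; split.
  move=> x y.
  have H s : 0 <= s -> descent q a (x + y) - (q (y + s *: a) - s * q a) <= descent q a x.
    move=> s0; apply: le_descent => t t0.
    rewrite lerBlDr; apply: le_trans (descent_le a (x + y) sq (addr_ge0 t0 s0)) _.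
    have -> : x + y + (t + s) *: a = (x + t *: a) + (y + s *: a).
      by rewrite scalerDl addrACA.
    have := sq.1 (x + t *: a) (y + s *: a); rewrite mulrDl; lra.
  rewrite -lerBlDl; apply: le_descent => s s0.
  by have := H s s0; rewrite lerBlDr [_ <= _ - _]lerBrDr; lra.
have Zle t x : 0 < t -> t * descent q a x <= descent q a (t *: x).
  move=> t0; apply: le_descent => s s0.
  rewrite -(ler_pM2l (_ : 0 < t^-1)) ?invr_gt0// mulKf ?gt_eqF//.
  have s't : 0 <= t^-1 * s by rewrite mulr_ge0// invr_ge0 ltW.
  apply: le_trans (descent_le a x sq s't) _.
  rewrite mulrBr -(sq.2 t^-1) ?invr_ge0 ?(ltW t0)// scalerDr scalerA mulVf ?gt_eqF//.
  by rewrite scale1r scalerA mulrA.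
move=> t x; rewrite le_eqVlt => /orP[/eqP <-|t0].
  rewrite scale0r mul0r; apply/eqP; rewrite eq_le; apply/andP; split.
    by have := descent_le_self a 0 sq; rewrite (sublinear0 sq).
  by apply: le_descent => s s0; rewrite add0r sq.2// subrr.
apply/eqP; rewrite eq_le Zle// andbT.
have := @Zle t^-1 (t *: x); rewrite invr_gt0 => /(_ t0).
rewrite scalerA mulVf ?gt_eqF// scale1r => h.
by rewrite -(ler_pM2l (_ : 0 < t^-1)) ?invr_gt0// mulKf// gt_eqF.
Qed.

(** A minimal q is left unchanged by all the operations [descent], and is thus
    additive. *)
Lemma minimal_sublinear_linear q : sublinear q ->
  (forall q', sublinear q' -> (forall x, q' x <= q x) -> q' = q) ->
  (forall c x y, q (c *: x + y) = c * q x + q y).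
Proof.
move=> sq qmin.
have qD x y : q (x + y) = q x + q y.
  apply/eqP; rewrite eq_le sq.1/=.
  have E := qmin _ (sublinear_descent y sq) (fun x => descent_le_self y x sq).
  have := descent_le y x sq ler01; rewrite E scale1r mul1r; lra.
have qN x : q (- x) = - q x.
  by apply/eqP; rewrite -addr_eq0 -qD addNr sublinear0.
move=> a x y; rewrite qD; congr (_ + _).
have [a0|a0] := leP 0 a; first exact: sq.2.
by rewrite -[a]opprK scaleNr qN sq.2 ?mulNr// oppr_ge0 ltW.
Qed.

(** Zorn's lemma: the infimum of a chain of sublinear functionals below p is
    sublinear. *)
Lemma sublinear_minorant p : sublinear p ->
  exists2 q, (forall c x y, q (c *: x + y) = c * q x + q y) & forall x, q x <= p x.
Proof.
move=> sp.
pose T := {q | sublinear q /\ forall x, q x <= p x}.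
pose r (s t : T) := `[< forall x, sval t x <= sval s x >].
have rP s t : r s t -> forall x, sval t x <= sval s x by move=> /asboolP.
have t0 : T by exists p; split.
have [||| |t tmax] := @Zorn T r.
- by move=> t; apply/asboolP.
- by move=> u v w /rP uv /rP vw; apply/asboolP => x; exact: le_trans (vw x) (uv x).
- move=> [u hu] [v hv] /rP/= uv /rP/= vu; apply: eq_exist => /=.
  by apply/funext => x; apply/eqP; rewrite eq_le uv vu.
- move=> A Atot.
  have [->|/set0P[s0 As0]] := eqVneq A set0; first by exists t0.
  pose E x := [set y | exists2 s, A s & y = sval s x].
  pose q x := inf (E x).
  have lb x : lbound (E x) (- p (- x)).
    move=> _ [s As ->]; apply: le_trans (sublinear_oppr x (svalP s).1).
    by rewrite lerN2; exact: (svalP s).2.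
  have qle s x : A s -> q x <= sval s x.
    by move=> As; apply: ge_inf; [exists (- p (- x))|exists s].
  have leq_ x c : (forall s, A s -> c <= sval s x) -> c <= q x.
    move=> H; apply: lb_le_inf; last by move=> _ [s As ->]; exact: H.
    by exists (sval s0 x); exists s0.
  have sq : sublinear q.
    split.
      move=> x y.
      have H s : A s -> q (x + y) - sval s y <= q x.
        move=> As; apply: leq_ => u Au; rewrite lerBlDr.
        have [/rP h|/rP h] := Atot s u As Au.
          apply: le_trans (qle u _ Au) _.
          by apply: le_trans ((svalP u).1.1 _ _) _; rewrite lerD2l.
        apply: le_trans (qle s _ As) _.
        by apply: le_trans ((svalP s).1.1 _ _) _; rewrite lerD2r.
      by rewrite -lerBlDl; apply: leq_ => s As; have := H s As; lra.
    have Zle t x : 0 < t -> t * q x <= q (t *: x).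
      move=> tp; apply: leq_ => s As; rewrite (svalP s).1.2 ?(ltW tp)//.
      by rewrite ler_pM2l// qle.
    move=> t x; rewrite le_eqVlt => /orP[/eqP <-|tp].
      rewrite scale0r mul0r; apply/eqP; rewrite eq_le; apply/andP; split.
        by apply: le_trans (qle s0 0 As0) _; rewrite (sublinear0 (svalP s0).1).
      by apply: leq_ => s As; rewrite (sublinear0 (svalP s).1).
    apply/eqP; rewrite eq_le Zle// andbT.
    have := @Zle t^-1 (t *: x); rewrite invr_gt0 => /(_ tp).
    rewrite scalerA mulVf ?gt_eqF// scale1r => h.
    by rewrite -(ler_pM2l (_ : 0 < t^-1)) ?invr_gt0// mulKf// gt_eqF.
  have qp x : q x <= p x by apply: le_trans (qle s0 x As0) ((svalP s0).2 x).
  exists (exist _ q (conj sq qp)) => s As; apply/asboolP => x /=; exact: qle.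
exists (sval t); last exact: (svalP t).2.
apply: minimal_sublinear_linear; first exact: (svalP t).1.
move=> q' sq' q't.
have q'p x : q' x <= p x by apply: le_trans (q't x) ((svalP t).2 x).
have := tmax (exist _ q' (conj sq' q'p)) => /= H.
have : r t (exist _ q' (conj sq' q'p)) by apply/asboolP.
by move=> /H <-.
Qed.

(** A linear minorant of the descent of p along a takes at - a a value which is at
    most - p a. *)
Lemma sublinear_support p a : sublinear p ->
  exists q, [/\ forall c x y, q (c *: x + y) = c * q x + q y,
    forall x, q x <= p x & p a <= q a].
Proof.
move=> sp; have [q ql qle] := sublinear_minorant (sublinear_descent a sp).
exists q; split => //.
  by move=> x; apply: le_trans (qle x) (descent_le_self a x sp).
have q0 : q 0 = 0.
  by have := ql 1 0 0; rewrite scaler0 addr0 mul1r => h; lra.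
have qN : q (- a) = - q a by have := ql (-1) a 0; rewrite scaleN1r q0 !addr0 mulN1r.
rewrite -lerN2 -qN; apply: le_trans (qle _) _.
have := descent_le a (- a) sp ler01; rewrite scale1r addNr (sublinear0 sp); lra.
Qed.

End sublinear.

Section separation.
Variables (R : realType) (X : normedModType R).

Definition convex_points (O : set X) :=
  forall x y t, O x -> O y -> 0 <= t <= 1 -> O (t *: x + (1 - t) *: y).

Variable (O : set X) (r : R).
Hypothesis O_convex : convex_points O.
Hypothesis r0 : 0 < r.
Hypothesis ballO : forall x, `|x| < r -> O x.

Definition gauge_set (x : X) := [set t : R | 0 < t /\ O (t^-1 *: x)].
Definition gauge (x : X) := inf (gauge_set x).

Lemma gauge_le t x : 0 < t -> O (t^-1 *: x) -> gauge x <= t.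
Proof. by move=> t0 Ox; apply: ge_inf => //; exists 0 => s [/ltW]. Qed.

Lemma gauge_set_big t x : `|x| < t * r -> 0 < t -> gauge_set x t.
Proof.
move=> xt t0; split => //; apply: ballO.
by rewrite normrZ ger0_norm ?invr_ge0 ?(ltW t0)// mulrC ltr_pdivrMr// mulrC.
Qed.

Lemma gauge_set_nonempty x : gauge_set x !=set0.
Proof.
exists ((`|x| + 1) / r); apply: gauge_set_big; last by rewrite divr_gt0// ltr_wpDl.
by rewrite divfK ?gt_eqF// ltrDl.
Qed.

Lemma le_gauge c x : (forall t, 0 < t -> O (t^-1 *: x) -> c <= t) -> c <= gauge x.
Proof.
move=> H; apply: lb_le_inf; first exact: gauge_set_nonempty.
by move=> t [t0 Ox]; exact: H.
Qed.

Lemma gauge_le_norm x : gauge x <= `|x| / r.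
Proof.
apply/ler_addgt0Pr => e e0.
have p : 0 < `|x| / r + e by rewrite ltr_wpDl// divr_ge0// ltW.
apply: gauge_le => //; apply: (gauge_set_big _ p).2.
by rewrite mulrDl divfK ?gt_eqF// ltrDl mulr_gt0.
Qed.

Lemma sublinear_gauge : sublinear gauge.
Proof.
split.
  move=> x y.
  have H s : 0 < s -> O (s^-1 *: y) -> gauge (x + y) - s <= gauge x.
    move=> s0 Oy; apply: le_gauge => t t0 Ox; rewrite lerBlDr.
    have ts : 0 < t + s by rewrite addr_gt0.
    apply: gauge_le => //.
    have -> : (t + s)^-1 *: (x + y) =
       (t / (t + s)) *: (t^-1 *: x) + (1 - t / (t + s)) *: (s^-1 *: y).
      rewrite !scalerA scalerDr; congr (_ *: _ + _ *: _); field.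
        by rewrite !gt_eqF.
      by rewrite !gt_eqF.
    apply: O_convex => //; rewrite divr_ge0 ?(ltW t0) ?(ltW ts)//=.
    by rewrite ler_pdivrMr// mul1r lerDl ltW.
  by rewrite -lerBlDl; apply: le_gauge => s s0 Oy; have := H s s0 Oy; lra.
have Zle t x : 0 < t -> t * gauge x <= gauge (t *: x).
  move=> t0; apply: le_gauge => s s0 Ox.
  rewrite mulrC -ler_pdivlMr//; apply: gauge_le; first exact: divr_gt0.
  by rewrite invf_div mulrC -scalerA.
move=> t x; rewrite le_eqVlt => /orP[/eqP <-|tp].
  rewrite scale0r mul0r; apply/eqP; rewrite eq_le; apply/andP; split.
    by have := gauge_le_norm 0; rewrite normr0 mul0r.
  by apply: le_gauge => s /ltW.
apply/eqP; rewrite eq_le Zle// andbT.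
have := @Zle t^-1 (t *: x); rewrite invr_gt0 => /(_ tp).
rewrite scalerA mulVf ?gt_eqF// scale1r => h.
by rewrite -(ler_pM2l (_ : 0 < t^-1)) ?invr_gt0// mulKf// gt_eqF.
Qed.

(** A linear functional supporting the gauge of O at a. *)
Lemma separation a : ~ O a ->
  exists l, [/\ top_dual l, forall x, O x -> l x <= 1, 1 <= l a &
    forall x, `|l x| <= `|x| / r].
Proof.
move=> nOa; have [l [lin le_l la]] := sublinear_support a sublinear_gauge.
have l0 : l 0 = 0 by have := lin 1 0 0; rewrite scaler0 addr0 mul1r => h; lra.
have lN x : l (- x) = - l x by have := lin (-1) x 0; rewrite scaleN1r l0 !addr0 mulN1r.
have lb x : `|l x| <= `|x| / r.
  rewrite ler_norml lerNl -lN; apply/andP; split.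
    by apply: le_trans (le_l _) _; rewrite -[`|x|]normrN gauge_le_norm.
  by apply: le_trans (le_l _) _; rewrite gauge_le_norm.
exists l; split => //.
- split; first by move=> c x y; rewrite lin.
  move=> x; apply/cvgrPdist_lt => e e0; near=> y.
  have -> : l x - l y = l (x - y).
    by have := lin (-1) y x; rewrite scaleN1r mulN1r addrC => ->; rewrite addrC.
  apply: le_lt_trans (lb _) _; rewrite ltr_pdivrMr//.
  near: y; have er0 : 0 < e * r by rewrite mulr_gt0.
  have := nbhsx_ballx x (e * r) er0; apply: filterS => y.
  by rewrite -ball_normE.
- move=> x Ox; apply: le_trans (le_l x) _; apply: gauge_le => //.
  by rewrite invr1 scale1r.
- apply: le_trans la; apply: le_gauge => t t0 Ot; rewrite leNgt; apply/negP => t1.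
  apply: nOa; have -> : a = t *: (t^-1 *: a) + (1 - t) *: 0.
    by rewrite scaler0 addr0 scalerA divff ?gt_eqF// scale1r.
  apply: O_convex => //; first by apply: ballO; rewrite normr0.
  by rewrite !ltW.
Unshelve. all: by end_near. Qed.

End separation.

(** Separation of v from the ball of radius |v|. *)
Lemma norming_functional (R : realType) (X : normedModType R) (v : X) : v != 0 ->
  exists l, [/\ top_dual l, `|v| <= l v & forall x, `|l x| <= `|x|].
Proof.
move=> v0; have n0 : 0 < `|v| by rewrite normr_gt0.
have cb : convex_points [set x : X | `|x| < `|v|].
  move=> x y t /= xv yv /andP[t0 t1].
  apply: le_lt_trans (ler_normD _ _) _; rewrite !normrZ (ger0_norm t0) ger0_norm ?subr_ge0//.
  apply: (@le_lt_trans _ _ (Num.max `|x| `|y|)); last by rewrite gt_max xv yv.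
  have h1 : t * `|x| <= t * Num.max `|x| `|y| by rewrite ler_wpM2l// le_max lexx.
  have h2 : (1 - t) * `|y| <= (1 - t) * Num.max `|x| `|y|.
    by rewrite ler_wpM2l ?subr_ge0// le_max lexx orbT.
  lra.
have [|l [ld _ lv lb]] := separation cb n0 (fun x h => h) (a := v).
  by rewrite /= ltxx.
exists (fun x => `|v| * l x); split.
- split.
    move=> c x y; rewrite ld.1 mulrDr; congr (_ + _).
    by rewrite /GRing.scale/= mulrCA.
  by move=> x; apply: cvgM; [exact: cvg_cst|exact: ld.2].
- by rewrite ler_peMr.
- move=> x; rewrite normrM ger0_norm// mulrC -ler_pdivlMr//; exact: lb.
Qed.

(** * Continuous functionals and square-integrable functions *)

Lemma continuous_measurable_borel (R : realType) (X : normedModType R) (f : X -> R) :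
  continuous f -> measurable_fun [set: borel X] (f : borel X -> R).
Proof.
move=> cf; apply: (measurability _ (RGenOInfty.measurableE R)) => //.
move=> _ [_ [t ->] <-]; rewrite setTI; apply: sub_sigma_algebra.
by apply: open_comp => // x _; exact: cf.
Qed.

Section top_dual_space.
Variables (R : realType) (X : normedModType R).
Implicit Types l k : X -> R.

Lemma top_dual_comb l k a b : top_dual l -> top_dual k ->
  top_dual (fun x => a * l x + b * k x).
Proof.
move=> [ll cl] [lk ck]; split.
  move=> c x y; rewrite ll lk /GRing.scale/=; ring.
move=> x; apply: cvgD; apply: cvgM; try exact: cvg_cst; [exact: cl|exact: ck].
Qed.

Lemma top_dual0 : top_dual (fun _ : X => 0 : R).
Proof. by split; [move=> c x y; rewrite /GRing.scale/= mulr0 addr0|exact: cst_continuous]. Qed.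

Lemma top_dual_scale l a : top_dual l -> top_dual (fun x => a * l x).
Proof.
move=> tl; have := top_dual_comb a 0 tl top_dual0.
by congr top_dual; apply/funext => x; rewrite mulr0 addr0.
Qed.

Lemma top_dualB l k : top_dual l -> top_dual k -> top_dual (fun x => l x - k x).
Proof.
move=> tl tk; have := top_dual_comb 1 (-1) tl tk.
by congr top_dual; apply/funext => x; rewrite mul1r mulN1r.
Qed.

Lemma top_dual_sum (I : Type) (s : seq I) (l : I -> X -> R) (a : I -> R) :
  (forall i, top_dual (l i)) -> top_dual (fun x => \sum_(i <- s) a i * l i x).
Proof.
move=> tl; elim: s => [|i s IH].
  by under [fun _ => _]funext do rewrite big_nil; exact: top_dual0.
under [fun _ => _]funext do rewrite big_cons.
have := top_dual_comb (a i) 1 (tl i) IH.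
by congr top_dual; apply/funext => x; rewrite mul1r.
Qed.

Lemma top_dual_add l x y : top_dual l -> l (x + y) = l x + l y.
Proof. by move=> [ll _]; have := ll 1 x y; rewrite !scale1r. Qed.

Lemma top_dual_0 l : top_dual l -> l 0 = 0.
Proof. by move=> tl; have := top_dual_add 0 0 tl; rewrite addr0 => h; lra. Qed.

Lemma top_dualZ l c x : top_dual l -> l (c *: x) = c * l x.
Proof.
by move=> tl; have := tl.1 c x 0; rewrite !addr0 (top_dual_0 tl) addr0.
Qed.

Lemma top_dual_sub l x y : top_dual l -> l (x - y) = l x - l y.
Proof. by move=> tl; rewrite top_dual_add// -scaleN1r top_dualZ// mulN1r. Qed.

End top_dual_space.

Section L2_space.
Context (R : realType) (X : completeNormedModType R).
Variable gamma : probability (borel X) R.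
Notation L2T := (L2 gamma setT).
Implicit Types f g : X -> R.

(** The inner product of L^2(X, gamma), on functions. *)
Definition l2_ip f g := \int[gamma]_x (f x * g x).

Notation ip := l2_ip.

Lemma L2_integrable_sqr f : L2T f -> gamma.-integrable setT (fun x => (f x ^+ 2)%:E).
Proof.
move=> [mf fi]; apply/integrableP; split.
  by apply/measurable_EFinP; apply: (@measurable_funX _ (borel X)).
by under eq_integral do rewrite /= ger0_norm ?sqr_ge0//.
Qed.

Lemma L2_integrableM f g : L2T f -> L2T g ->
  gamma.-integrable setT (EFin \o (fun x => f x * g x)).
Proof.
move=> Lf Lg.
have If := L2_integrable_sqr Lf; have Ig := L2_integrable_sqr Lg.
apply: (@le_integrable _ _ _ gamma setT measurableT _ (fun x => (f x ^+ 2)%:E + (g x ^+ 2)%:E)%E).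
- by apply/measurable_EFinP; apply: (@measurable_funM _ (borel X)); [exact: Lf.1|exact: Lg.1].
- move=> x _; rewrite -EFinD /= lee_fin [leRHS]ger0_norm ?addr_ge0 ?sqr_ge0//.
  rewrite normrM -(real_normK (num_real (f x))) -(real_normK (num_real (g x))).
  have := sqr_ge0 (`|f x| - `|g x|); have := normr_ge0 (f x); have := normr_ge0 (g x).
  by move: `|f x| `|g x| => a b; rewrite !expr2 => *; nra.
- exact: integrableD.
Qed.

Lemma L2_comb f g a b : L2T f -> L2T g -> L2T (fun x => a * f x + b * g x).
Proof.
move=> Lf Lg; split.
  apply: (@measurable_funD _ (borel X)); apply: (@measurable_funM _ (borel X)) => //;
    [exact: Lf.1|exact: Lg.1].
have I : gamma.-integrable setT (fun x => ((a ^+ 2)%:E * (f x ^+ 2)%:E +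
    ((2 * a * b)%:E * (f x * g x)%:E + (b ^+ 2)%:E * (g x ^+ 2)%:E))%E).
  apply: integrableD => //; first by apply: integrableZl => //; exact: L2_integrable_sqr.
  apply: integrableD => //; apply: integrableZl => //; last exact: L2_integrable_sqr.
  exact: L2_integrableM.
have := integrable_lty measurableT I.
apply: le_lt_trans; rewrite le_eqVlt; apply/orP; left; apply/eqP.
by apply: eq_integral => x _; rewrite -!EFinM -!EFinD; congr (_%:E); ring.
Qed.

Lemma ipC f g : ip f g = ip g f.
Proof. by apply: eq_Rintegral => x _; exact: mulrC. Qed.

Lemma ip_comb f g h a b : L2T f -> L2T g -> L2T h ->
  ip (fun x => a * f x + b * g x) h = a * ip f h + b * ip g h.
Proof.
move=> Lf Lg Lh.
have If := L2_integrableM Lf Lh; have Ig := L2_integrableM Lg Lh.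
rewrite /l2_ip -!RintegralZl// -RintegralD//; first last.
- by have := integrableZl measurableT b Ig; apply: eq_integrable => // x _; rewrite /= EFinM.
- by have := integrableZl measurableT a If; apply: eq_integrable => // x _; rewrite /= EFinM.
by apply: eq_Rintegral => x _; ring.
Qed.

Lemma ip_ge0 f : 0 <= ip f f.
Proof. by apply: Rintegral_ge0 => x _; rewrite -expr2 sqr_ge0. Qed.

Lemma ip_EFin f : L2T f -> (\int[gamma]_x (f x ^+ 2)%:E = (ip f f)%:E)%E.
Proof.
move=> Lf; rewrite /l2_ip /Rintegral fineK.
  by apply: eq_integral => x _; rewrite expr2.
exact: integrable_fin_num (L2_integrableM Lf Lf).
Qed.

Lemma cauchy_schwarz f g : L2T f -> L2T g -> ip f g ^+ 2 <= ip f f * ip g g.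
Proof.
move=> Lf Lg.
have H a b : 0 <= a ^+ 2 * ip f f + 2 * a * b * ip f g + b ^+ 2 * ip g g.
  have := ip_ge0 (fun x => a * f x + b * g x).
  have Lc := L2_comb a b Lf Lg.
  rewrite ip_comb// ipC [ip g _]ipC !ip_comb// [ip g f]ipC.
  by move=> h; apply: le_trans h _; rewrite le_eqVlt; apply/orP; left; apply/eqP; ring.
have := ip_ge0 f; rewrite le_eqVlt => /orP[/eqP f0|fp].
  have [->|s0] := eqVneq (ip f g) 0; first by rewrite expr0n mulr_ge0 ?ip_ge0.
  have := H (- (ip g g + 1) / (2 * ip f g)) 1; rewrite -f0.
  have -> : (- (ip g g + 1) / (2 * ip f g)) ^+ 2 * 0 +
      2 * (- (ip g g + 1) / (2 * ip f g)) * 1 * ip f g + 1 ^+ 2 * ip g g = -1.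
    by field.
  by rewrite oppr_ge0 ler10.
have := H (- ip f g) (ip f f).
have -> : (- ip f g) ^+ 2 * ip f f + 2 * - ip f g * ip f f * ip f g + ip f f ^+ 2 * ip g g =
  ip f f * (ip f f * ip g g - ip f g ^+ 2) by ring.
by rewrite pmulr_rge0// subr_ge0.
Qed.

Lemma ip_eq0 f g : L2T f -> L2T g -> ip f f = 0 -> ip f g = 0.
Proof.
move=> Lf Lg f0; have := cauchy_schwarz Lf Lg; rewrite f0 mul0r => h.
by apply/eqP; rewrite -sqrf_eq0 eq_le h sqr_ge0.
Qed.

End L2_space.

(** * Gaussian functionals *)

Section gaussian_functionals.
Context (R : realType) (X : completeNormedModType R).
Variable gamma : probability (borel X) R.
Hypothesis gammaG : centered_gaussian gamma.
Notation L2T := (L2 gamma setT).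
Notation ip := (l2_ip gamma).
Implicit Types l : X -> R.

Lemma measurable_top_dual l : top_dual l -> measurable_fun [set: borel X] (l : borel X -> R).
Proof. by move=> [_ cl]; exact: continuous_measurable_borel. Qed.

Section law.
Variables (l : X -> R) (Q : probability (measurableTypeR R) R).
Hypothesis tl : top_dual l.
Hypothesis lQ : forall A : set R, measurable A -> pushforward gamma (l : borel X -> R) A = Q A.

Lemma ge0_law_integral (f : R -> \bar R) : measurable_fun setT f ->
  (forall y, 0 <= f y)%E -> (\int[gamma]_x f (l x) = \int[Q]_y f y)%E.
Proof.
move=> mf f0; have ml := measurable_top_dual tl.
have := @ge0_integral_pushforward _ _ (borel X) (measurableTypeR R) R _ ml gamma setT f measurableT mf (fun y _ => f0 y).
by rewrite (eq_measure_integral Q) => [->//|A mA _]; exact: lQ.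
Qed.

Lemma law_Rintegral (f : R -> R) : bounded_measurable f ->
  \int[gamma]_x f (l x) = \int[Q]_y f y.
Proof.
move=> bf; have ml := measurable_top_dual tl.
have mF : measurable_fun setT (EFin \o f) by apply/measurable_EFinP; exact: bf.1.
have iF : gamma.-integrable ((l : borel X -> R) @^-1` setT) ((EFin \o f) \o l).
  exact: (bounded_measurable_integrable gamma (bounded_measurable_comp bf ml)).
have := @integral_pushforward _ _ (borel X) (measurableTypeR R) R _ ml gamma setT (EFin \o f) mF iF measurableT.
rewrite (eq_measure_integral Q); last by move=> A mA _; exact: lQ.
by rewrite /Rintegral => ->.
Qed.

End law.

Let bcos b : bounded_measurable (fun y : R => cos (y + b)).
Proof.
split; last by exists 1 => y; exact: cos_max.
apply: (measurableT_comp (continuous_measurable_fun (@continuous_cos R))).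
exact: measurable_funD.
Qed.

(** The variance of l is written as the inner product of l with itself, which treats
    the Dirac case and the normal case uniformly. *)
Lemma gaussian_functional l : top_dual l ->
  [/\ L2T l,
    forall b, \int[gamma]_x cos (l x + b) = expR (- ip l l / 2) * cos b &
    (0 < ip l l /\ forall t : R, 0 <= t ->
      (gamma [set x | `|l x| <= t]%R <= (t / Num.sqrt (ip l l))%:E)%E) \/
    (ip l l = 0 /\ forall A : set R, measurable A ->
      pushforward gamma (l : borel X -> R) A = \d_(0 : R) A)].
Proof.
move=> tl; have ml := measurable_top_dual tl.
have ipE : ip l l = fine (\int[gamma]_x (l x ^+ 2)%:E)%E.
  by rewrite /l2_ip /Rintegral; congr fine; apply: eq_integral => x _; rewrite expr2.
have msq : measurable_fun setT (fun y : R => (y ^+ 2)%:E).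
  by apply/measurable_EFinP; exact: measurable_funX.
have [[s s0 lQ]|lQ] := gammaG tl.
  have sq := ge0_law_integral (Q := normal_prob 0 s) tl lQ msq
    (fun y => etrans (lee_fin _ _) (sqr_ge0 y)).
  have s2 : (\int[normal_prob 0 s]_y (y ^+ 2)%:E = (s ^+ 2)%:E)%E.
    rewrite -(Rintegral_normal_sqr s0) /Rintegral fineK//.
    by apply: integrable_fin_num => //; exact: integrable_normal_sqr.
  have ips : ip l l = s ^+ 2 by rewrite ipE sq s2.
  split.
  - by split => //; rewrite sq s2 ltry.
  - move=> b; rewrite (law_Rintegral (Q := normal_prob 0 s) tl lQ (bcos b)) ips.
    have := Rintegral_normal_cos s0 b 1; rewrite expr1n mulr1 => <-.
    by apply: eq_Rintegral => y _; rewrite mul1r.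
  - left; rewrite ips exprn_gt0//; split => // t t0; rewrite sqrtr_sqr ger0_norm ?(ltW s0)//.
    apply: le_trans (normal_small_ball s0 t0).
    rewrite -(lQ _ (measurable_itv _)) /pushforward.
    rewrite le_eqVlt; apply/orP; left; apply/eqP; congr (gamma _).
    by apply/seteqP; split => x /=; rewrite in_itv/= ler_norml.
pose Q0 : probability (measurableTypeR R) R := @dirac _ (measurableTypeR R) (0 : R) R.
have D0 (f : R -> \bar R) (mf : measurable_fun setT f) : (\int[Q0]_y f y)%E = f 0.
  by rewrite integral_dirac// diracT mul1e.
have sq := ge0_law_integral (Q := Q0) tl lQ msq
    (fun y => etrans (lee_fin _ _) (sqr_ge0 y)).
have ips : ip l l = 0 by rewrite ipE sq D0// expr0n.
split.
- by split => //; rewrite sq D0// ltry.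
- move=> b; rewrite (law_Rintegral (Q := Q0) tl lQ (bcos b)) ips oppr0 mul0r expR0 mul1r.
  rewrite /Rintegral D0 ?add0r//; apply/measurable_EFinP; exact: (bcos b).1.
- by right.
Qed.

Lemma L2_top_dual l : top_dual l -> L2T l.
Proof. by move=> /gaussian_functional[]. Qed.

(** A functional of variance 0 has a Dirac law. *)
Lemma nondegenerate_ip l : nondegenerate_measure gamma -> top_dual l ->
  ip l l = 0 -> forall x, l x = 0.
Proof.
move=> nd tl l0 x; apply: contrapT => /eqP lx.
have [_ _ [[]|[_ lQ]]] := gaussian_functional tl; first by rewrite l0 ltxx.
by apply: (nd l tl); [exists x|exists 0].
Qed.

Lemma ip_suml (I : Type) (s : seq I) (l : I -> X -> R) (a : I -> R) (g : X -> R) :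
  (forall i, top_dual (l i)) -> L2T g ->
  ip (fun x => \sum_(i <- s) a i * l i x) g = \sum_(i <- s) a i * ip (l i) g.
Proof.
move=> tl Lg; elim: s => [|i s IH].
  rewrite big_nil; transitivity (ip (fun=> 0) g).
    by congr (ip _ g); apply/funext => x; rewrite big_nil.
  by rewrite /l2_ip; under eq_Rintegral do rewrite mul0r; rewrite Rintegral_cst// mul0r.
rewrite big_cons -IH -[X in _ + X]mul1r.
rewrite -ip_comb//; last 2 first.
- exact: L2_top_dual.
- by apply: L2_top_dual; exact: top_dual_sum.
by congr (ip _ g); apply/funext => x; rewrite big_cons mul1r.
Qed.

(** The variance of a combination of orthonormal functionals is the sum of the
    squares of its coefficients. *)
Lemma gauss_law_functionals m (xi : nat -> X -> R) (F : coords R m -> R) :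
  (forall i, top_dual (xi i)) ->
  (forall i j, (i < m)%N -> (j < m)%N -> ip (xi i) (xi j) = (i == j)%:R) ->
  bounded_measurable F ->
  \int[gamma]_x F (tuple_map m (xi : nat -> borel X -> R) x) = \int[gauss R m]_z F z.
Proof.
move=> txi orth bF.
apply: (@gauss_law _ (borel X) R gamma m xi F _ _ bF).
  by move=> i; exact: measurable_top_dual.
move=> a b; have tl := top_dual_sum (index_enum 'I_m) (fun i : 'I_m => a i) (fun i : 'I_m => txi i).
have [_ H _] := gaussian_functional tl.
rewrite H; congr (expR (- _ / 2) * _).
have Ll := L2_top_dual tl.
rewrite ip_suml//.
apply: eq_bigr => i _; rewrite ipC ip_suml//; try exact: L2_top_dual.
rewrite (bigD1 i)//= big1 ?addr0; first by rewrite orth// eqxx mulr1 expr2.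
by move=> j ji; rewrite orth//; have /negbTE-> : (j != i :> nat) by []; rewrite mulr0.
Qed.

(** Some ball of radius n has measure larger than 1/2. A functional of norm at most 1
    is bounded by n on it, so by the small ball estimate its standard deviation is
    less than 2 n. *)
Lemma uniform_variance : exists2 C : R, 0 < C &
  forall l, top_dual l -> (forall x, `|l x| <= `|x|) -> ip l l <= C.
Proof.
have mB n : measurable ([set x : borel X | `|x : X| <= n%:R]).
  have mn := continuous_measurable_borel (@norm_continuous R X).
  have := mn measurableT _ (measurable_itv `]-oo, (n%:R : R)]).
  by rewrite setTI; congr measurable; apply/seteqP; split => x /=; rewrite in_itv.
have cv : gamma [set x : borel X | `|x : X| <= n%:R] @[n --> \oo] --> gamma setT.
  have -> : [set: borel X] = \bigcup_n [set x : borel X | `|x : X| <= n%:R].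
    apply/esym/seteqP; split => // x _; exists (Num.truncn `|x : X|).+1 => //=.
    by apply/ltW; exact: truncnS_gt.
  apply: nondecreasing_cvg_mu => //; first exact: bigcup_measurable.
  move=> a b ab; apply/subsetPset => x /= /le_trans; apply; by rewrite ler_nat.
have [n hn] : exists n, (2^-1%:E < gamma [set x : borel X | (`|x : X| <= n%:R)%R])%E.
  apply: contrapT => /forallNP hn.
  have : (gamma setT <= 2^-1%:E)%E.
    rewrite -(cvg_lim _ cv)//; apply: lime_le; first exact: cvgP cv.
    by near=> n; rewrite leNgt; apply/negP/hn.
  by rewrite [X in (X <= _)%E](@probability_setT _ _ _ gamma) lee_fin; lra.
exists ((2 * n%:R) ^+ 2 + 1); first by rewrite ltr_wpDl// sqr_ge0.
move=> l tl lb.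
have [_ _ [[lp sb]|[-> _]]] := gaussian_functional tl; last first.
  by rewrite addr_ge0// sqr_ge0.
have h : (2^-1%:E < (n%:R / Num.sqrt (ip l l))%:E)%E.
  apply: lt_le_trans hn (le_trans _ (sb n%:R _)) => //.
  apply: le_measure; rewrite ?inE//.
    have := measurable_top_dual tl => ml.
    have := (measurableT_comp (@normr_measurable R setT) ml) measurableT _ (measurable_itv `]-oo, (n%:R : R)]).
    by rewrite setTI; congr measurable; apply/seteqP; split => x /=; rewrite in_itv.
  by move=> x /=; exact: le_trans.
move: h; rewrite lte_fin ltr_pdivlMr ?sqrtr_gt0// => h.
have -> : ip l l = Num.sqrt (ip l l) ^+ 2 by rewrite sqr_sqrtr// ltW.
rewrite -[leLHS]addr0 lerD//; rewrite lerXn2r ?nnegrE ?sqrtr_ge0 ?mulr_ge0//.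
lra.
Unshelve. all: by end_near.
Qed.

(** Gram-Schmidt. A residual of variance 0 vanishes identically by
    [nondegenerate_ip]; any other residual is normalized and added to the family. *)
Lemma orthonormal_basis n (l : nat -> X -> R) : nondegenerate_measure gamma ->
  (forall i, top_dual (l i)) ->
  exists m (xi : nat -> X -> R) (B : nat -> nat -> R),
    [/\ forall i, top_dual (xi i),
        forall i j, (i < m)%N -> (j < m)%N -> ip (xi i) (xi j) = (i == j)%:R &
        forall i, (i < n)%N -> forall x, l i x = \sum_(k < m) B i k * xi k x].
Proof.
move=> nd tl; elim: n => [|n [m [xi [B [txi orth lE]]]]].
  by exists 0%N, (fun _ _ => 0), (fun _ _ => 0); split => // i; exact: top_dual0.
pose c (k : nat) := ip (l n) (xi k).
pose p x := \sum_(k < m) c k * xi k x.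
have tp : top_dual p by apply: (top_dual_sum (index_enum 'I_m) (fun i : 'I_m => c i) (fun i : 'I_m => txi i)).
pose r x := l n x - p x.
have tr : top_dual r by exact: top_dualB.
have rxi j : (j < m)%N -> ip r (xi j) = 0.
  move=> jm; have -> : r = (fun x => 1 * l n x + (-1) * p x).
    by apply/funext => x; rewrite mul1r mulN1r.
  rewrite ip_comb; try exact: L2_top_dual.
  rewrite ip_suml; [|by move=> i; exact: txi|exact: L2_top_dual].
  rewrite (bigD1 (Ordinal jm))//= big1 ?addr0.
    by rewrite orth// eqxx mulr1 mulN1r mul1r subrr.
  move=> i ij; rewrite orth//; have /negbTE-> : (i != j :> nat) by [].
  by rewrite mulr0.
have [r0|rn0] := eqVneq (ip r r) 0.
  exists m, xi, (fun i k => if (i == n)%N then c k else B i k); split => // i.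
  rewrite ltnS leq_eqVlt => /orP[/eqP ->|ilt] x.
    by have := nondegenerate_ip nd tr r0 x; rewrite eqxx => /subr0_eq.
  by rewrite (ltn_eqF ilt) lE.
have rp : 0 < ip r r by rewrite lt_def rn0 ip_ge0.
pose s : R := Num.sqrt (ip r r).
have s0 : s != 0 by rewrite gt_eqF// sqrtr_gt0.
have ss : s * s = ip r r by rewrite -expr2 sqr_sqrtr// ltW.
pose e x := s^-1 * r x.
have te : top_dual e by exact: top_dual_scale.
have ipe g : L2T g -> ip e g = s^-1 * ip r g.
  move=> Lg; have -> : e = (fun x => s^-1 * r x + 0 * r x).
    by apply/funext => x; rewrite mul0r addr0.
  by rewrite ip_comb ?mul0r ?addr0//; exact: L2_top_dual.
exists m.+1, (fun k => if (k == m)%N then e else xi k),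
  (fun i k => if (i == n)%N then (if (k == m)%N then s else c k)
              else if (k == m)%N then 0 else B i k); split.
- by move=> i; case: ifP.
- have exi j : (j < m)%N -> ip e (xi j) = 0.
    by move=> jm; rewrite ipe ?rxi ?mulr0//; exact: L2_top_dual.
  move=> i j; rewrite !ltnS [(i <= m)%N]leq_eqVlt [(j <= m)%N]leq_eqVlt.
  move=> /orP[/eqP ->|im] /orP[/eqP ->|jm].
  + rewrite !eqxx ipe; last exact: L2_top_dual.
    rewrite ipC ipe; last exact: L2_top_dual.
    by rewrite -ss mulKf// mulVf.
  + by rewrite eqxx (ltn_eqF jm) exi// (gtn_eqF jm).
  + by rewrite eqxx (ltn_eqF im) ipC exi.
  + by rewrite (ltn_eqF im) (ltn_eqF jm) orth.
- move=> i; rewrite ltnS leq_eqVlt => /orP[/eqP ->|ilt] x.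
    rewrite big_ord_recr/= !eqxx /e mulVKf//.
    transitivity (p x + r x); first by rewrite /r addrC subrK.
    by congr (_ + _); apply: eq_bigr => k _; rewrite (ltn_eqF (ltn_ord k)).
  rewrite big_ord_recr/= (ltn_eqF ilt) eqxx mul0r addr0 lE//.
  by apply: eq_bigr => k _; rewrite (ltn_eqF (ltn_ord k)).
Qed.

End gaussian_functionals.

(** * Existence of the vectors R_gamma l *)

Lemma countable_enumeration (T : Type) (A : set T) (x0 : T) : countable A -> A x0 ->
  exists e : nat -> T, (forall n, A (e n)) /\ (forall x, A x -> exists n, e n = x).
Proof.
move=> /countable_injP[f fi] Ax0.
pose e n := if pselect (exists2 x, A x & f x = n) is left p then sval (cid2 p) else x0.
exists e; split=> [n|x Ax].
  by rewrite /e; case: pselect => // p; case: cid2.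
exists (f x); rewrite /e; case: pselect => [p|[]]; last by exists x.
by case: cid2 => y /= Ay; apply: fi; rewrite ?inE.
Qed.

Lemma separable_dense_sequence (T : topologicalType) (x0 : T) : separable T ->
  exists e : nat -> T, forall U : set T, open U -> U !=set0 -> exists n, U (e n).
Proof.
move=> [D [cD dD]].
have [x Dx] : D !=set0.
  by have [||x [_ Dx]] := dD setT; [exists x0|exact: openT|exists x].
have [e [_ eD]] := countable_enumeration cD Dx.
exists e => U oU U0; have [y [Uy Dy]] := dD U U0 oU.
by have [n en] := eD y Dy; exists n; rewrite en.
Qed.

Section L2_bounds.
Context (R : realType) (X : completeNormedModType R).
Variable gamma : probability (borel X) R.
Notation L2T := (L2 gamma setT).
Notation ip := (l2_ip gamma).

Lemma L2_le (f h : X -> R) : L2T f -> measurable_fun [set: borel X] (h : borel X -> R) ->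
  (forall x, `|h x| <= `|f x|) -> L2T h.
Proof.
move=> [mf fi] mh hf; split => //; apply: le_lt_trans fi.
apply: ge0_le_integral => //.
- by move=> x _; rewrite lee_fin sqr_ge0.
- by apply/measurable_EFinP; apply: (@measurable_funX _ (borel X)).
- by apply/measurable_EFinP; apply: (@measurable_funX _ (borel X)).
- move=> x _; rewrite lee_fin -(real_normK (num_real (h x))) -(real_normK (num_real (f x))).
  by rewrite lerXn2r ?nnegrE.
Qed.

Lemma ip_le (f h : X -> R) : L2T f -> L2T h ->
  (forall x, `|h x| <= `|f x|) -> ip h h <= ip f f.
Proof.
move=> Lf Lh hf; rewrite -lee_fin -!ip_EFin//.
apply: ge0_le_integral => //.
- by move=> x _; rewrite lee_fin sqr_ge0.
- by apply/measurable_EFinP; apply: (@measurable_funX _ (borel X)); exact: Lh.1.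
- by apply/measurable_EFinP; apply: (@measurable_funX _ (borel X)); exact: Lf.1.
- move=> x _; rewrite lee_fin -(real_normK (num_real (h x))) -(real_normK (num_real (f x))).
  by rewrite lerXn2r ?nnegrE.
Qed.

Lemma L2_cst c : L2T (fun=> c).
Proof.
split; first exact: measurable_cst.
rewrite integral_cst// [X in (_ * X)%E](@probability_setT _ _ _ gamma) mule1 ltry //.
Qed.

Lemma L2_indic (A : set (borel X)) : measurable A -> L2T (\1_A : X -> R).
Proof.
move=> mA; apply: (L2_le (L2_cst 1)); first exact: measurable_indic.
by move=> x; rewrite normr1 indicE; case: (_ \in _); rewrite ?normr1 ?normr0.
Qed.

(** Dominated convergence, with f^2 as dominating function. *)
Lemma L2_vanishing_tail (f : X -> R) (u : nat -> X -> R) (e : R) : L2T f -> 0 < e ->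
  (forall n, L2T (fun x => f x * u n x)) -> (forall n x, `|u n x| <= 1) ->
  (forall x, exists n, forall m, (n <= m)%N -> u m x = 0) ->
  exists n, ip (fun x => f x * u n x) (fun x => f x * u n x) < e.
Proof.
move=> Lf e0 Lfu u1 u0.
have lef n x : `|f x * u n x| <= `|f x| by rewrite normrM ler_piMr.
have mfu n : measurable_fun [set: borel X] (fun x => ((f x * u n x) ^+ 2)%:E).
  by apply/measurable_EFinP; apply: (@measurable_funX _ (borel X)); exact: (Lfu n).1.
have cv0 x : ((f x * u n x) ^+ 2)%:E @[n --> \oo] --> (0 : \bar R)%E.
  have [n0 hn0] := u0 x; apply: cvg_near_cst; exists n0 => // n /= nn.
  by rewrite hn0// mulr0 expr0n.
have dom (x : borel X) n : (`|((f x * u n x) ^+ 2)%:E| <= (f x ^+ 2)%:E)%E.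
  rewrite lee_fin ger0_norm ?sqr_ge0//.
  rewrite -(real_normK (num_real (f x))) -(real_normK (num_real (f x * _))).
  by rewrite lerXn2r ?nnegrE.
have [_ _] := @dominated_convergence _ (borel X) R gamma setT measurableT
  (fun n x => ((f x * u n x) ^+ 2)%:E) (cst 0%E) (fun x => (f x ^+ 2)%:E)
  mfu (measurable_cst _)
  (aeW _ (fun (x : borel X) _ => cv0 x))
  (L2_integrable_sqr Lf)
  (aeW _ (fun (x : borel X) n _ => dom x n)).
rewrite integral_cst// mul0e => cv.
apply: contrapT => /forallNP hn.
have : (e%:E <= 0)%E.
  rewrite -(cvg_lim _ cv)//; apply: lime_ge; first exact: cvgP cv.
  by near=> n; rewrite /= ip_EFin// lee_fin leNgt; apply/negP/hn.
by rewrite lee_fin leNgt e0.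
Unshelve. all: by end_near.
Qed.

End L2_bounds.

Section Rgamma.
Context (R : realType) (X : completeNormedModType R) (Xsep : separable X).
Variable gamma : probability (borel X) R.
Hypothesis gammaG : centered_gaussian gamma.
Notation L2T := (L2 gamma setT).
Notation ip := (l2_ip gamma).

(** Riemann sums of the integral of l(x) x, for a partition of X into Borel pieces
    contained in balls of radius d, of which finitely many are kept. The error against g is
    controlled by Cauchy-Schwarz, on the kept pieces through |g(x) - g(q_k)| <= d,
    and on the others through the small tail of l and [uniform_variance]. *)
Lemma Rgamma_approx (l : X -> R) (e : R) : top_dual l -> 0 < e ->
  exists S : X, forall g, top_dual g -> (forall x, `|g x| <= `|x|) ->
    `|g S - ip l g| <= e.
Proof.
move=> tl e0; have Ll := L2_top_dual gammaG tl.
have [C C0 varC] := uniform_variance gammaG.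
pose A := ip l l; have A0 : 0 <= A := ip_ge0 _ _.
pose d := e / (A + C + 2); have d0 : 0 < d by rewrite divr_gt0//; lra.
have [q qd] := separable_dense_sequence 0 Xsep.
pose B k : set X := [set x | `|x - q k| < d].
(* The pieces: balls made disjoint. *)
pose P k : set X := B k `\` \big[setU/set0]_(j < k) B j.
have mP k : measurable (P k : set (borel X)).
  have mB j : measurable (B j : set (borel X)).
    apply: sub_sigma_algebra; rewrite (_ : B j = ball (q j) d); first exact: ball_open.
    by apply/seteqP; split => x; rewrite /B -ball_normE /ball_ /= distrC.
  by apply: measurableD => //; apply: bigsetU_measurable.
have Pd k x : P k x -> `|x - q k| < d by case.
have Pdisj i j x : P i x -> P j x -> i = j.
  wlog ij : i j / (i < j)%N.
    move=> H Pi Pj; have [/H->//|/H<-//|//] := ltngtP i j.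
  move=> [Bi _] [_ nBj]; exfalso; apply: nBj.
  by rewrite -bigcup_mkord; exists i.
have Pcov x : exists k, P k x.
  have [k Bk] : exists k, B k x.
    apply: (qd [set y | `|x - y| < d]); last by exists x; rewrite /= subrr normr0.
    rewrite (_ : [set y | _] = ball x d); first exact: ball_open.
    by apply/seteqP; split => y; rewrite -ball_normE.
  have ex : exists k, `[< B k x >] by exists k; apply/asboolP.
  case: (ex_minnP ex) => m /asboolP Bm mmin; exists m; split => //.
  rewrite -bigcup_mkord => -[j /= jm Bj].
  by have := mmin j (asboolT Bj); rewrite leqNgt jm.
pose step N (w : nat -> R) (x : X) : R := \sum_(k < N) w k * \1_(P k) x.
have stepP N w x k : P k x -> step N w x = if (k < N)%N then w k else 0.
  move=> Pk; rewrite /step; case: ifPn => [kN|kN].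
    rewrite (bigD1 (Ordinal kN))//= indicE mem_set// mulr1 big1 ?addr0// => j jk.
    rewrite indicE memNset ?mulr0// => Pj.
    by move/eqP: jk; apply; apply: val_inj => /=; exact: Pdisj Pj Pk.
  rewrite big1// => j _; rewrite indicE memNset ?mulr0// => Pj.
  by move: kN; rewrite (Pdisj _ _ _ Pk Pj) ltn_ord.
have Lstep N w : L2T (step N w).
  rewrite /step; elim: N => [|N IH].
    by under [fun _ => _]funext do rewrite big_ord0; exact: L2_cst.
  under [fun _ => _]funext do rewrite big_ord_recr/=.
  have := L2_comb 1 (w N) IH (L2_indic gamma (mP N)).
  by under [fun _ => _]funext do rewrite mul1r.
have ip_step N w : ip (step N w) l = \sum_(k < N) w k * ip (\1_(P k)) l.
  elim: N => [|N IH].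
    rewrite big_ord0 /l2_ip; under eq_Rintegral do rewrite /step big_ord0 mul0r.
    by rewrite Rintegral_cst// mul0r.
  rewrite big_ord_recr/= -IH -[X in X + _]mul1r -ip_comb//; last exact: L2_indic.
  by congr (ip _ l); apply/funext => x; rewrite mul1r /step big_ord_recr.
(* The indicator of the complement of the first N pieces. *)
pose u N x := 1 - step N (fun=> 1) x.
have uP N x k : P k x -> u N x = if (k < N)%N then 0 else 1.
  by move=> Pk; rewrite /u (stepP _ _ _ _ Pk); case: ifP; rewrite ?subrr ?subr0.
have u1 N x : `|u N x| <= 1.
  have [k Pk] := Pcov x; rewrite (uP _ _ _ Pk).
  by case: ifP; rewrite ?normr0 ?normr1.
have Lu N : L2T (u N).
  have := L2_comb 1 (-1) (L2_cst gamma 1) (Lstep N (fun=> 1)).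
  by under [fun _ => _]funext do rewrite mul1r mulN1r.
have Lfu f N : L2T f -> L2T (fun x => f x * u N x).
  move=> Lf; apply: (L2_le Lf).
    by apply: (@measurable_funM _ (borel X)); [exact: Lf.1|exact: (Lu N).1].
  by move=> x; rewrite normrM ler_piMr.
have [|N hN] := L2_vanishing_tail Ll (exprn_gt0 2 d0) (fun N => Lfu l N Ll) u1.
  move=> x; have [k Pk] := Pcov x; exists k.+1 => m km.
  by rewrite (uP _ _ _ Pk) km.
exists (\sum_(k < N) ip (\1_(P k)) l *: q k) => g tg g1.
have Lg := L2_top_dual gammaG tg.
have gS : g (\sum_(k < N) ip (\1_(P k)) l *: q k) = ip (step N (g \o q)) l.
  rewrite ip_step; elim: (N) => [|M IH]; first by rewrite !big_ord0 top_dual_0.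
  by rewrite !big_ord_recr/= top_dual_add// top_dualZ// IH mulrC.
pose s := step N (g \o q).
pose r x := g x - s x - g x * u N x.
have rle x : `|r x| <= d.
  have [k Pk] := Pcov x; rewrite /r /s (stepP _ _ _ _ Pk) (uP _ _ _ Pk) /=.
  case: ifP => _; last by rewrite subr0 mulr1 subrr normr0 ltW.
  by rewrite mulr0 subr0 -top_dual_sub//; apply: le_trans (g1 _) (ltW (Pd _ _ Pk)).
have Lgs : L2T (fun x => g x - s x).
  have := L2_comb 1 (-1) Lg (Lstep N (g \o q)).
  by under [fun _ => _]funext do rewrite mul1r mulN1r.
have Lr : L2T r.
  have := L2_comb 1 (-1) Lgs (Lfu g N Lg).
  by under [fun _ => _]funext do rewrite mul1r mulN1r.
have E : ip l g - g (\sum_(k < N) ip (\1_(P k)) l *: q k) =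
    ip r l + ip (fun x => l x * u N x) g.
  rewrite gS ipC.
  have -> : ip (fun x => l x * u N x) g = ip (fun x => g x * u N x) l.
    by apply: eq_Rintegral => x _; ring.
  rewrite -[ip r l]mul1r -[X in _ = _ + X]mul1r -ip_comb//; last exact: Lfu.
  rewrite -[X in X - _]mul1r -[X in _ + X]mulN1r -ip_comb//.
  by congr (ip _ l); apply/funext => x; rewrite /r /s; ring.
rewrite distrC E.
have abs_of_sqr (a b : R) : 0 <= b -> a ^+ 2 <= d ^+ 2 * b -> `|a| <= d * (b + 1).
  move=> b0 h; have db : 0 <= d * (b + 1) by rewrite mulr_ge0 ?(ltW d0)// addr_ge0.
  rewrite -(@ler_pXn2r _ 2)// ?nnegrE// real_normK ?num_real// exprMn.
  apply: le_trans h _; rewrite ler_pM2l ?exprn_gt0//.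
  by rewrite (_ : (b + 1) ^+ 2 = b + (1 + b + b ^+ 2)); [rewrite lerDl !addr_ge0 ?sqr_ge0|ring].
have h1 : `|ip r l| <= d * (A + 1).
  apply: abs_of_sqr => //; apply: le_trans (cauchy_schwarz Lr Ll) _.
  rewrite ler_wpM2r//.
  have -> : d ^+ 2 = ip (fun=> d) (fun=> d).
    by rewrite /l2_ip Rintegral_cst// [X in fine X](@probability_setT _ _ _ gamma) mulr1 expr2.
  apply: ip_le => //; first exact: L2_cst.
  by move=> x; rewrite (ger0_norm (ltW d0)).
have h2 : `|ip (fun x => l x * u N x) g| <= d * (C + 1).
  apply: abs_of_sqr; first exact: ltW.
  apply: le_trans (cauchy_schwarz (Lfu l N Ll) Lg) _.
  by apply: ler_pM; rewrite ?ip_ge0//; [exact: ltW|exact: varC].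
apply: le_trans (ler_normD _ _) _; apply: le_trans (lerD h1 h2) _.
rewrite -mulrDr /d -mulrA [X in e * X](_ : _ = 1) ?mulr1//.
by rewrite (_ : A + 1 + (C + 1) = A + C + 2) ?mulVf//; [lra|ring].
Qed.

Lemma top_dual_bounded (g : X -> R) : top_dual g ->
  exists2 M, 0 < M & forall x, `|g x| <= M * `|x|.
Proof.
move=> tg; have /cvgrPdist_le /(_ 1 ltr01) := tg.2 0.
rewrite top_dual_0// => /nbhs_ballP[d /= d0 h].
exists (2 / d); first by rewrite divr_gt0.
move=> x; have [->|x0] := eqVneq x 0; first by rewrite top_dual_0// !normr0 mulr0.
have nx : 0 < `|x| by rewrite normr_gt0.
(* Rescales x to norm d / 2. *)
pose c := d / (2 * `|x|); have c0 : 0 < c by rewrite divr_gt0// mulr_gt0.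
have := h (c *: x); rewrite -ball_normE /ball_ /= sub0r normrN normrZ gtr0_norm//.
have -> : c * `|x| = d / 2 by rewrite /c; field; rewrite gt_eqF.
have -> : d / 2 < d by lra.
move=> /(_ isT); rewrite sub0r normrN top_dualZ// normrM gtr0_norm// mulrC.
move=> h1; rewrite -(ler_pM2r c0); apply: le_trans h1 _.
rewrite le_eqVlt; apply/orP; left; apply/eqP; rewrite /c; field.
by rewrite !gt_eqF.
Qed.

(** The approximations of [Rgamma_approx] form a Cauchy sequence, since norming
    functionals compute the norm of their differences. *)
Lemma Rgamma_exists (l : X -> R) : top_dual l -> exists h : X, is_Rgamma gamma l h.
Proof.
move=> tl.
have /choice[S hS] n : exists S : X, forall g, top_dual g ->
    (forall x, `|g x| <= `|x|) -> `|g S - ip l g| <= (n.+1%:R)^-1.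
  exact: Rgamma_approx.
have close n m : `|S n - S m| <= n.+1%:R^-1 + m.+1%:R^-1.
  have [->|v0] := eqVneq (S n - S m) 0; first by rewrite normr0 addr_ge0// ltW.
  have [g [tg gv g1]] := norming_functional v0.
  apply: le_trans gv _; rewrite top_dual_sub//.
  have := hS n g tg g1; have := hS m g tg g1.
  rewrite !ler_norml => /andP[a b] /andP[c d]; move: (n.+1%:R^-1) (m.+1%:R^-1) a b c d => u v; lra.
have cS : cvgn S.
  apply: cauchy_cvg; apply: cauchy_exP => e e0.
  have [N _ hN] := near_infty_natSinv_lt (PosNum (divr_gt0 e0 (ltr0n R 2))).
  exists (S N); exists N => // n /= Nn; rewrite -ball_normE /=.
  apply: le_lt_trans (close _ _) _.
  have h1 : N.+1%:R^-1 < e / 2 := hN N (leqnn _).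
  have h2 : n.+1%:R^-1 < e / 2 := hN n Nn.
  by move: (n.+1%:R^-1) (N.+1%:R^-1) h1 h2 => u v; lra.
exists (lim (S @ \oo)) => g tg.
have [M M0 gM] := top_dual_bounded tg.
have : g \o S @ \oo --> g (lim (S @ \oo)).
  by apply: continuous_cvg => //; exact: tg.2.
move=> /(cvg_lim (@Rhausdorff R)) <-.
apply: cvg_lim => //; apply/cvgrPdist_le => e e0.
have eM : 0 < e / M by rewrite divr_gt0.
have [N _ hN] := near_infty_natSinv_lt (PosNum eM).
exists N => // n /= Nn.
have tg' := top_dual_scale M^-1 tg.
have := hS n _ tg'.
have -> : ip l (fun x => M^-1 * g x) = M^-1 * \int[gamma]_x (l x * g x).
  have Lg := L2_top_dual gammaG tg; have Ll := L2_top_dual gammaG tl.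
  have := ip_comb M^-1 0 Lg Lg Ll; rewrite mul0r addr0 [ip g l]ipC => <-.
  by rewrite ipC; congr (ip _ l); apply/funext => x; rewrite mul0r addr0.
rewrite -mulrBr => h; have {}h : `|M^-1 * (g (S n) - \int[gamma]_x (l x * g x))| <= n.+1%:R^-1.
  apply: h => x; rewrite normrM gtr0_norm ?invr_gt0//.
  by rewrite mulrC ler_pdivrMr// mulrC.
move: h; rewrite normrM gtr0_norm ?invr_gt0// distrC => h.
have := le_lt_trans h (hN n Nn); rewrite /= mulrC ltr_pdivrMr// mulfVK ?gt_eqF//.
exact: ltW.
Qed.

End Rgamma.

(** * The Cameron-Martin space *)

Section cameron_martin_space.
Context (R : realType) (X : completeNormedModType R) (Xsep : separable X).
Variable gamma : probability (borel X) R.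
Hypothesis gammaG : centered_gaussian gamma.
Notation L2T := (L2 gamma setT).
Notation ip := (l2_ip gamma).
Notation H := (cameron_martin gamma).
Notation dot := (cm_dot gamma).

Lemma ip_sqr_comb (f g : X -> R) a b : L2T f -> L2T g ->
  ip (fun x => a * f x + b * g x) (fun x => a * f x + b * g x) =
  a ^+ 2 * ip f f + 2 * a * b * ip f g + b ^+ 2 * ip g g.
Proof.
move=> Lf Lg; have Lc := L2_comb a b Lf Lg.
by rewrite ip_comb// ipC [ip g _]ipC !ip_comb// [ip g f]ipC; ring.
Qed.

Lemma L2B (f g : X -> R) : L2T f -> L2T g -> L2T (fun x => f x - g x).
Proof.
move=> Lf Lg; have := L2_comb 1 (-1) Lf Lg.
by under [fun _ => _]funext do rewrite mul1r mulN1r.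
Qed.

Lemma dual_closure_comb f g a b : dual_closure gamma f -> dual_closure gamma g ->
  dual_closure gamma (fun x => a * f x + b * g x).
Proof.
move=> [Lf cf] [Lg cg]; split; first exact: L2_comb.
move=> e e0; pose d := e / (2 * a ^+ 2 + 2 * b ^+ 2 + 1).
have D0 : 0 < 2 * a ^+ 2 + 2 * b ^+ 2 + 1.
  by have := sqr_ge0 a; have := sqr_ge0 b; move: (a ^+ 2) (b ^+ 2) => *; lra.
have d0 : 0 < d by rewrite divr_gt0.
have [l tl fl] := cf d d0; have [k tk gk] := cg d d0.
have Lfl := L2B Lf (L2_top_dual gammaG tl).
have Lgk := L2B Lg (L2_top_dual gammaG tk).
exists (fun x => a * l x + b * k x); first exact: top_dual_comb.
move: fl gk; rewrite (ip_EFin Lfl) (ip_EFin Lgk) !lte_fin => fl gk.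
have Lc := L2_comb a b Lfl Lgk.
have E : (\int[gamma]_x ((a * f x + b * g x - (a * l x + b * k x)) ^+ 2)%:E =
  (ip (fun x => a * (f x - l x) + b * (g x - k x))%R
     (fun x => a * (f x - l x) + b * (g x - k x))%R)%:E)%E.
  by rewrite -(ip_EFin Lc); apply: eq_integral => x _; congr (_ ^+ 2)%:E; ring.
rewrite E lte_fin; move: (ip_ge0 gamma (fun x => a * (f x - l x) + - b * (g x - k x))).
rewrite !ip_sqr_comb//; move: (ip (fun x => f x - l x) (fun x => g x - k x)) fl gk.
move: (ip (fun x => f x - l x) (fun x => f x - l x)) => p.
move: (ip (fun x => g x - k x) (fun x => g x - k x)) => q r pd qd.
have h1 : a ^+ 2 * p <= a ^+ 2 * d by rewrite ler_wpM2l ?sqr_ge0 ?ltW.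
have h2 : b ^+ 2 * q <= b ^+ 2 * d by rewrite ler_wpM2l ?sqr_ge0 ?ltW.
have -> : e = 2 * (a ^+ 2 * d) + 2 * (b ^+ 2 * d) + d by rewrite /d; field; rewrite gt_eqF.
rewrite sqrrN; have -> : 2 * a * - b * r = - (2 * a * b * r) by ring.
move: (2 * a * b * r) (a ^+ 2 * p) (b ^+ 2 * q) (a ^+ 2 * d) (b ^+ 2 * d) h1 h2 => *; lra.
Qed.

Lemma dual_closure_top_dual l : top_dual l -> dual_closure gamma l.
Proof.
move=> tl; split; first exact: L2_top_dual.
move=> e e0; exists l => //; under eq_integral do rewrite subrr expr0n.
by rewrite integral0 lte_fin.
Qed.

(** Representatives of one vector differ by a function orthogonal to the dual, and
    so to its closure. Hence the scalar product of H can be computed from arbitrary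
    representatives. *)
Lemma representative_ip f f' h g : L2T f -> L2T f' ->
  is_Rgamma gamma f h -> is_Rgamma gamma f' h -> dual_closure gamma g -> ip f g = ip f' g.
Proof.
move=> Lf Lf' fh fh' [Lg cg].
pose D x := f x - f' x; have LD : L2T D by exact: L2B.
have Dl k : L2T k -> ip D k = ip f k - ip f' k.
  move=> Lk; have := ip_comb 1 (-1) Lf Lf' Lk; rewrite mul1r mulN1r => <-.
  by congr (ip _ k); apply/funext => x; rewrite mul1r mulN1r.
apply/subr0_eq; rewrite -Dl//; apply/eqP; rewrite -sqrf_eq0 eq_le sqr_ge0 andbT.
apply/ler_addgt0Pl => e e0; rewrite addr0.
pose d := e / (ip D D + 1); have DD := ip_ge0 gamma D.
have d0 : 0 < d by rewrite divr_gt0// ltr_wpDl.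
have [l tl gl] := cg d d0; have Ll := L2_top_dual gammaG tl.
have Lgl := L2B Lg Ll.
move: gl; rewrite (ip_EFin Lgl) lte_fin => gl.
have -> : ip D g = ip D (fun x => g x - l x).
  have Dl0 : ip D l = 0.
    rewrite Dl//; apply/eqP; rewrite subr_eq0; apply/eqP.
    exact: etrans (esym (fh l tl)) (fh' l tl).
  have := ip_comb 1 (-1) Lg Ll LD.
  rewrite mul1r mulN1r [ip l D]ipC Dl0 oppr0 addr0 [ip g D]ipC => <-.
  by rewrite ipC; congr (ip D _); apply/funext => x; rewrite mul1r mulN1r.
apply: le_trans (cauchy_schwarz LD Lgl) _.
apply: (@le_trans _ _ (ip D D * d)); first by rewrite ler_wpM2l// ltW.
rewrite /d mulrA ler_pdivrMr ?ltr_wpDl// mulrC ler_wpM2l ?ltW//.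
by rewrite ltr_pwDr.
Qed.

Lemma cm_hatP h : H h -> dual_closure gamma (cm_hat gamma h) /\ is_Rgamma gamma (cm_hat gamma h) h.
Proof.
move=> [f df fh]; have := @getPex _ [set f | dual_closure gamma f /\ is_Rgamma gamma f h].
by apply; exists f.
Qed.

Lemma cm_dotE f g h k : dual_closure gamma f -> dual_closure gamma g ->
  is_Rgamma gamma f h -> is_Rgamma gamma g k -> dot h k = ip f g.
Proof.
move=> df dg fh gk.
have [dh hh] := cm_hatP (ex_intro2 _ _ f df fh : H h).
have [dk hk] := cm_hatP (ex_intro2 _ _ g dg gk : H k).
rewrite (_ : dot h k = ip (cm_hat gamma h) (cm_hat gamma k))//.
rewrite (representative_ip dh.1 df.1 hh fh dk) ipC.
by rewrite (representative_ip dk.1 dg.1 hk gk df) ipC.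
Qed.

Lemma is_Rgamma_comb f g h k a b : L2T f -> L2T g ->
  is_Rgamma gamma f h -> is_Rgamma gamma g k ->
  is_Rgamma gamma (fun x => a * f x + b * g x) (a *: h + b *: k).
Proof.
move=> Lf Lg fh gk l tl; have Ll := L2_top_dual gammaG tl.
rewrite (top_dual_add _ _ tl) (top_dualZ a h tl) (top_dualZ b k tl).
have -> : l h = ip f l := fh l tl; have -> : l k = ip g l := gk l tl.
exact/esym/(ip_comb a b Lf Lg Ll).
Qed.

Lemma cameron_martin_comb h k a b : H h -> H k -> H (a *: h + b *: k).
Proof.
move=> [f df fh] [g dg gk]; exists (fun x => a * f x + b * g x).
  exact: dual_closure_comb.
exact: (is_Rgamma_comb a b df.1 dg.1 fh gk).
Qed.

Lemma cameron_martin0 : H 0.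
Proof.
exists (fun=> 0).
  exact: dual_closure_top_dual (@top_dual0 _ X).
move=> l tl; rewrite top_dual_0//; under eq_Rintegral do rewrite mul0r.
by rewrite Rintegral_cst// mul0r.
Qed.

Lemma cm_dotC h k : dot h k = dot k h.
Proof. exact: ipC. Qed.

Lemma cm_dot_comb h h' k a b : H h -> H h' -> H k ->
  dot (a *: h + b *: h') k = a * dot h k + b * dot h' k.
Proof.
move=> [f df fh] [f' df' fh'] [g dg gk].
rewrite (cm_dotE (dual_closure_comb a b df df') dg (is_Rgamma_comb a b df.1 df'.1 fh fh') gk).
rewrite (cm_dotE df dg fh gk) (cm_dotE df' dg fh' gk).
exact: (ip_comb a b df.1 df'.1 dg.1).
Qed.

Lemma cm_dot_ge0 h : 0 <= dot h h.
Proof. exact: ip_ge0. Qed.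

Lemma cm_norm_sqr h : cm_norm gamma h ^+ 2 = dot h h.
Proof. by rewrite sqr_sqrtr// cm_dot_ge0. Qed.

Lemma cm_dot_sqr_comb h k a b : H h -> H k ->
  dot (a *: h + b *: k) (a *: h + b *: k) =
  a ^+ 2 * dot h h + 2 * a * b * dot h k + b ^+ 2 * dot k k.
Proof.
move=> Hh Hk; have Hc := cameron_martin_comb a b Hh Hk.
rewrite cm_dot_comb// cm_dotC [dot k _]cm_dotC !cm_dot_comb// [dot k h]cm_dotC.
by move: (dot h h) (dot h k) (dot k k) => p q w; ring.
Qed.

(** A nonzero vector is detected by a continuous functional. *)
Lemma cm_dot_eq0 h : H h -> dot h h = 0 -> h = 0.
Proof.
move=> [f df fh]; rewrite (cm_dotE df df fh fh) => f0.
apply: contrapT => /eqP h0; have [l [tl hl _]] := norming_functional h0.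
move: hl; rewrite (fh l tl).
by rewrite [\int[_]_x _](ip_eq0 df.1 (L2_top_dual gammaG tl) f0) normr_le0 (negbTE h0).
Qed.

(** For continuous functionals; by [Rgamma_exists] the default value does not occur
    there. *)
Definition Rgamma (l : X -> R) : X := get (is_Rgamma gamma l).

Lemma RgammaP l : top_dual l -> is_Rgamma gamma l (Rgamma l).
Proof. by move=> tl; apply: getPex; exact: Rgamma_exists. Qed.

Lemma cameron_martin_Rgamma l : top_dual l -> H (Rgamma l).
Proof. by move=> tl; exists l; [exact: dual_closure_top_dual|exact: RgammaP]. Qed.

(** The reproducing property: R_gamma(l) represents the restriction of l to H. *)
Lemma cm_dot_Rgamma l h : top_dual l -> H h -> dot (Rgamma l) h = l h.
Proof.
move=> tl [f df fh].
rewrite (cm_dotE (dual_closure_top_dual tl) df (RgammaP tl) fh) ipC.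
exact/esym/(fh l tl).
Qed.

Lemma cameron_martin_sum n (a : 'I_n -> R) (h : 'I_n -> X) : (forall i, H (h i)) ->
  H (\sum_i a i *: h i).
Proof.
move=> Hh; elim/big_ind : _ => //; first exact: cameron_martin0.
  by move=> x y Hx Hy; have := cameron_martin_comb 1 1 Hx Hy; rewrite !scale1r.
by move=> i _; have := cameron_martin_comb (a i) 0 (Hh i) cameron_martin0; rewrite scaler0 addr0.
Qed.

Lemma cm_dot_sum n (a : 'I_n -> R) (h : 'I_n -> X) k : (forall i, H (h i)) -> H k ->
  dot (\sum_i a i *: h i) k = \sum_i a i * dot (h i) k.
Proof.
elim: n a h => [|n IH] a h Hh Hk.
  rewrite !big_ord0; have := cm_dot_comb 0 0 cameron_martin0 cameron_martin0 Hk.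
  by rewrite !scale0r addr0 !mul0r addr0.
rewrite !big_ord_recr/= -IH//.
have Hs : H (\sum_(i < n) a (widen_ord (leqnSn n) i) *: h (widen_ord (leqnSn n) i)).
  by apply: cameron_martin_sum.
by have := cm_dot_comb 1 (a ord_max) Hs (Hh ord_max) Hk; rewrite scale1r mul1r.
Qed.

Lemma cm_dot_ext h k : H h -> H k -> (forall z, H z -> dot h z = dot k z) -> h = k.
Proof.
move=> Hh Hk hk; have Hd := cameron_martin_comb 1 (-1) Hh Hk.
apply/subr0_eq; move: Hd; rewrite scale1r scaleN1r => Hd.
apply: cm_dot_eq0 => //.
have := cm_dot_comb 1 (-1) Hh Hk Hd; rewrite scale1r scaleN1r => ->.
by rewrite hk// mul1r mulN1r subrr.
Qed.

End cameron_martin_space.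

(** * Calculus on row vectors *)

Section row_calculus.
Context (R : realType) (n : nat).
Implicit Types (u v w : 'rV[R]_n) (phi : 'rV[R]_n -> R^o).

Lemma row_norm_lt u e : 0 < e -> (forall i, `|u 0 i| < e) -> `|u| < e.
Proof.
move=> e0 ue; suff : ball_ (fun x : 'rV[R]_n => `|x|) 0 e u by rewrite /ball_ /= sub0r normrN.
rewrite -mx_norm_ball; split => // i j.
by rewrite ord1 mxE -ball_normE /ball_ /= sub0r normrN.
Qed.

Lemma continuous_row (T : topologicalType) (f : 'I_n -> T -> R) :
  (forall i, continuous (f i)) -> continuous (fun x => \row_i f i x : 'rV[R]_n).
Proof.
move=> cf x; apply/cvgrPdist_lt => e e0.
have : \forall y \near x, forall i, `|f i x - f i y| < e.
  by apply: filter_forall => i; move/cvgrPdist_lt : (cf i x); exact.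
apply: filterS => y ye; apply: row_norm_lt => // i.
by rewrite !mxE.
Qed.

Lemma row_diff_sum phi w v :
  'd phi w v = \sum_i v 0 i * 'd phi w (delta_mx 0 i : 'rV[R]_n).
Proof.
rewrite {1}(row_sum_delta v) linear_sum; apply: eq_bigr => i _.
by rewrite linearZ.
Qed.

(** The mean value theorem along the segment from u to v. *)
Lemma row_mean_value phi u v : (forall w, differentiable phi w) ->
  exists w : 'rV[R]_n, (exists2 t, 0 <= t <= 1 & w = u + t *: (v - u)) /\
    phi v - phi u = \sum_i (v 0 i - u 0 i) * 'D_(delta_mx 0 i) phi w.
Proof.
move=> dphi.
pose h (t : R) : R^o := phi (u + t *: (v - u)).
have line t s : u + (s + t) *: (v - u) = s *: (v - u) + (u + t *: (v - u)).
  by rewrite scalerDl addrCA.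
have dh (t : R) : is_derive t 1 h ('D_(v - u) phi (u + t *: (v - u))).
  have dv : derivable phi (u + t *: (v - u)) (v - u) by exact: diff_derivable.
  have E : (fun s : R => s^-1 *: ((h \o shift t) (s *: 1) - h t)) =
     (fun s : R => s^-1 *: ((phi \o shift (u + t *: (v - u))) (s *: (v - u)) - phi (u + t *: (v - u)))).
    by apply/funext => s; rewrite /= /h /shift/= -line [_%:A](mulr1 s).
  by apply: DeriveDef; rewrite /derivable /derive E.
have ch : {within `[0, 1], continuous h}.
  apply: continuous_subspaceT => t; apply: differentiable_continuous.
  by apply/derivable1_diffP; exact: ex_derive.
have [c cI] := MVT ltr01 (fun t _ => dh t) ch.
rewrite subr0 mulr1 {1}/h scale1r addrCA subrr addr0 /h scale0r addr0 => ->.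
exists (u + c *: (v - u)); split.
  by exists c => //; move: cI; rewrite in_itv/= => /andP[/ltW-> /ltW->].
rewrite deriveE// row_diff_sum; apply: eq_bigr => i _.
by rewrite !mxE deriveE.
Qed.

(** The second point is not confined to A, so that intermediate points given by the
    mean value theorem are covered. *)
Lemma compact_uniform_continuity (A : set 'rV[R]_n) phi (e : R) : compact A -> 0 < e ->
  continuous phi ->
  \forall d \near (0 : R)^'+, forall u v, A u -> `|u - v| < d -> `|phi u - phi v| < e.
Proof.
move=> /compact_near_coveringP cA e0 cphi.
have H : \forall d \near 0^'+, forall u, A u ->
    forall v, `|u - v| < d -> `|phi u - phi v| < e.
  apply: (cA R (0^'+) (fun d u => forall v, `|u - v| < d -> `|phi u - phi v| < e)) => w Aw.
  have e2 : 0 < e / 2 by rewrite divr_gt0.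
  have /cvgrPdist_lt /(_ _ e2) /nbhs_ballP[r /= r0] := cphi w.
  rewrite -ball_normE => rw.
  have r2 : 0 < r / 2 by rewrite divr_gt0.
  near=> x d => y /= xy.
  have wx : `|w - x| < r / 2.
    by near: x; apply/nbhs_ballP; exists (r / 2) => //; rewrite -ball_normE.
  have dr : d < r / 2 by near: d; apply: nbhs_right_lt.
  have h1 : `|phi w - phi x| < e / 2 by apply: rw; rewrite /ball_/=; lra.
  have h2 : `|phi w - phi y| < e / 2.
    by apply: rw; rewrite /ball_/= -(subrKA x) (splitr r);
      apply: le_lt_trans (ler_normD _ _) _; apply: ltrD => //; exact: lt_trans dr.
  rewrite -(subrKA (phi w)); apply: le_lt_trans (ler_normD _ _) _.
  by rewrite (splitr e); apply: ltrD => //; rewrite distrC.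
by apply: filterS H => d hd u v Au; exact: hd.
Unshelve. all: by end_near.
Qed.

(** By the mean value theorem and the uniform continuity of the partial derivatives
    on the box of side M, for phi composed with the linear map of matrix B. This is
    the hypothesis of [poincare_gauss]. *)
Lemma first_order_bound m phi (B : 'I_n -> 'I_m -> R) (M delta : R) : C1b phi -> 0 < delta ->
  exists2 eta, 0 < eta & forall a b : 'I_m -> R,
    let u : 'rV[R]_n := \row_i \sum_k B i k * a k in
    let v : 'rV[R]_n := \row_i \sum_k B i k * b k in
    (forall i, `|u 0 i| <= M) -> (forall k, `|b k - a k| <= eta) ->
    phi u - phi v <=
    \sum_k (`|\sum_i 'D_(delta_mx 0 i) phi u * B i k| + delta) * `|b k - a k|.
Proof.
move=> [_ dphi cphi] delta0.
pose S := \sum_i \sum_k `|B i k| + 1.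
have S0' : 0 <= \sum_i \sum_k `|B i k| by apply: sumr_ge0 => i _; apply: sumr_ge0.
have S0 : 0 < S by rewrite ltr_wpDl.
have dS : 0 < delta / S by rewrite divr_gt0.
pose A : set 'rV[R]_n := [set u | forall i, (`[- M, M]%classic : set R) (u ord0 i)].
have cA : compact A.
  by apply: (@rV_compact R n (fun=> `[(- M), M]%classic)) => i; exact: segment_compact.
have [d [d0 hd]] : exists d : R, 0 < d /\ forall i u w, A u -> `|u - w| < d ->
    `|'D_(delta_mx 0 i) phi u - 'D_(delta_mx 0 i) phi w| < delta / S.
  have : \forall d \near (0 : R)^'+, 0 < d /\ forall i u w, A u -> `|u - w| < d ->
    `|'D_(delta_mx 0 i) phi u - 'D_(delta_mx 0 i) phi w| < delta / S.
    apply: filterI; first exact: nbhs_right_gt.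
    have H i : \forall d \near (0 : R)^'+, forall u w, A u -> `|u - w| < d ->
        `|'D_(delta_mx 0 i) phi u - 'D_(delta_mx 0 i) phi w| < delta / S.
      by have [ci _] := cphi i; exact: compact_uniform_continuity.
    exact: (filter_forall _ H).
  by move=> /filter_ex.
exists (d / (2 * S)); first by rewrite divr_gt0// mulr_gt0.
move=> a b u v uM ab.
have Au : A u by move=> i; have := uM i; rewrite /= in_itv/= ler_norml.
have uv i : v 0 i - u 0 i = \sum_k B i k * (b k - a k).
  rewrite !mxE -sumrB; apply: eq_bigr => k _; ring.
have uvd i : `|v 0 i - u 0 i| < d.
  rewrite uv; apply: le_lt_trans (_ : S * (d / (2 * S)) < d); last first.
    rewrite (_ : S * _ = d / 2); last by field; rewrite gt_eqF.
    by rewrite ltr_pdivrMr// ltr_pMr// ltr1n.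
  apply: le_trans (_ : (\sum_k `|B i k|) * (d / (2 * S)) <= _).
    rewrite mulr_suml; apply: le_trans (ler_norm_sum _ _ _) _.
    by apply: ler_sum => k _; rewrite normrM ler_wpM2l.
  rewrite ler_pM2r ?divr_gt0 ?mulr_gt0// /S (bigD1 i)//= -addrA lerDl addr_ge0//.
  by apply: sumr_ge0 => j _; apply: sumr_ge0.
have [w [[t /andP[t0 t1] wE] mv]] := row_mean_value u v dphi.
have uw i : `|'D_(delta_mx 0 i) phi u - 'D_(delta_mx 0 i) phi w| <= delta / S.
  apply/ltW/hd => //; rewrite wE opprD addrA subrr add0r normrN; apply: row_norm_lt => // j.
  rewrite !mxE normrM (ger0_norm t0); have := uvd j; rewrite !mxE.
  by apply: le_lt_trans; rewrite ler_piMl.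
rewrite -opprB mv.
have -> : - (\sum_i (v 0 i - u 0 i) * 'D_'e_i phi w) =
  \sum_k (- (\sum_i 'D_'e_i phi u * B i k) +
     \sum_i ('D_'e_i phi u - 'D_'e_i phi w) * B i k) * (b k - a k).
  under [RHS]eq_bigr do rewrite -sumrN -big_split/= mulr_suml.
  rewrite exchange_big/= -sumrN; apply: eq_bigr => i _.
  rewrite uv mulr_suml -sumrN; apply: eq_bigr => k _; ring.
apply: ler_sum => k _.
apply: le_trans (ler_norm _) _; rewrite normrM ler_wpM2r//.
apply: le_trans (ler_normD _ _) _; rewrite normrN lerD2l.
apply: le_trans (ler_norm_sum _ _ _) _.
apply: le_trans (_ : (\sum_i `|B i k|) * (delta / S) <= _).
  rewrite mulr_suml; apply: ler_sum => i _; rewrite normrM mulrC ler_wpM2l//.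
rewrite mulrCA ger_pMr// ler_pdivrMr// mul1r.
apply: le_trans (_ : \sum_i \sum_k `|B i k| <= _); last by rewrite lerDl.
by apply: ler_sum => i _; rewrite (bigD1 k)//= lerDl sumr_ge0.
Qed.

(** An open set of row vectors is a countable union of rational boxes, whose
    preimages are finite intersections of preimages of intervals. *)
Lemma measurable_continuous_row d (T : measurableType d) (z : 'I_n -> T -> R) phi :
  (forall i, measurable_fun setT (z i)) -> continuous phi ->
  measurable_fun setT (fun x => phi (\row_i z i x)).
Proof.
move=> mz cphi; apply: (measurability _ (RGenOInfty.measurableE R)) => //.
move=> _ [_ [t ->] <-]; rewrite setTI.
set U := [set u | t < phi u].
have oU : open U.
  by apply: (@open_comp _ _ (phi : _ -> R) [set y | t < y]) => // u _; exact: cphi.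
pose box (qk : 'rV[rat]_n * nat) : set 'rV[R]_n :=
  [set u | forall i, `|u 0 i - ratr (qk.1 0 i)| < qk.2.+1%:R^-1].
pose F (qk : 'rV[rat]_n * nat) : set T :=
  if `[< box qk `<=` U >] then [set x | box qk (\row_i z i x)] else set0.
have -> : (fun x => phi (\row_i z i x)) @^-1` `]t, +oo[ = \bigcup_qk F qk.
  apply/seteqP; split => x /=.
    rewrite in_itv /= andbT => tx.
    have : nbhs (\row_i z i x : 'rV[R]_n) U by apply: open_nbhs_nbhs; split.
    move=> /nbhs_ballP[r /= r0]; rewrite -ball_normE => rU.
    have [k hk] : exists k : nat, k.+1%:R^-1 < r / 2.
      have [N _ hN] := near_infty_natSinv_lt (PosNum (divr_gt0 r0 (ltr0n R 2))).
      by exists N; exact: hN (leqnn N).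
    have /choice[q hq] i : exists q : rat, `|z i x - ratr q| < k.+1%:R^-1.
      have kp : 0 < k.+1%:R^-1 :> R by rewrite invr_gt0.
      move: (k.+1%:R^-1) kp {hk} => c cp.
      have [|q] := @rat_in_itvoo R (z i x - c) (z i x + c); first by lra.
        by rewrite in_itv/= => /andP[a b]; exists q; rewrite ltr_norml; apply/andP; split; lra.
    exists (\row_i q i, k) => //; rewrite /F; case: asboolP => [_ i|[]].
      by rewrite !mxE.
    move=> u /= bu; apply: rU; rewrite /ball_ /=; apply: row_norm_lt => // i.
    have := bu i; have := hq i; rewrite !mxE !ltr_norml => /=.
    move: (k.+1%:R^-1) hk => w hw /andP[a b] /andP[c e].
    by apply/andP; split; lra.
  move=> [qk _]; rewrite /F; case: asboolP => // h bx.
  by rewrite in_itv/= andbT; exact: h.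
apply: countable_bigcupT_measurable => [|qk]; first exact: countableP.
rewrite /F; case: asboolP => // _.
have -> : [set x | box qk (\row_i z i x)] =
    \bigcap_i ((fun x => `|z i x - ratr (qk.1 0 i)|) @^-1` `]-oo, qk.2.+1%:R^-1[).
  apply/seteqP; split => x /=.
    by move=> bx i _; have := bx i; rewrite mxE /= in_itv.
  by move=> bx i; have := bx i I; rewrite mxE /= in_itv.
apply: fin_bigcap_measurable => // i _.
have mi : measurable_fun setT (fun x => `|z i x - ratr (qk.1 0 i)|).
  by apply: (measurableT_comp (@normr_measurable R setT)); exact: measurable_funB.
by have := mi measurableT _ (measurable_itv `]-oo, (qk.2.+1%:R^-1 : R)[); rewrite setTI.
Qed.

End row_calculus.

(** * Gradients of cylindrical functions *)

Section cylindrical.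
Context (R : realType) (X : completeNormedModType R) (Xsep : separable X).
Variable gamma : probability (borel X) R.
Hypothesis gammaG : centered_gaussian gamma.
Notation ip := (l2_ip gamma).
Notation H := (cameron_martin gamma).
Notation dot := (cm_dot gamma).

Lemma bounded_funP (T : Type) (f : T -> R^o) : bounded_fun f -> exists M : R, forall x, `|f x| <= M.
Proof.
move=> [M [_ hM]]; exists (M + 1) => x; apply: (hM (M + 1)) => //.
by rewrite ltrDl.
Qed.

Section gradient.
Variables (n : nat) (phi : 'rV[R]_n -> R^o) (l : 'I_n -> X -> R).
Hypothesis phiC : C1b phi.
Hypothesis tl : forall i, top_dual (l i).
Let f (x : X) : R^o := phi (\row_i l i x).
Let p i x : R := 'D_(delta_mx 0 i) phi (\row_j l j x).

Lemma cyl_diff x h : 'd f x h = \sum_i p i x * l i h.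
Proof.
pose L (y : X) : 'rV[R]_n := \row_i l i y.
have Llin : linear L.
  by move=> a y z; apply/rowP => i; rewrite !mxE top_dual_add// top_dualZ.
pose aL := GRing.isLinear.Build R X 'rV[R]_n *:%R L Llin.
pose LL : {linear X -> 'rV[R]_n} := HB.pack L aL.
have cL : continuous LL by apply: continuous_row => i; exact: (tl i).2.
have dphi y : differentiable phi y by have [_ + _] := phiC; exact.
have -> : f = phi \o LL by [].
rewrite diff_comp//; last exact: linear_differentiable.
rewrite [LHS]/comp/= (diff_lin x cL) row_diff_sum; apply: eq_bigr => i _.
by rewrite mxE mulrC /p deriveE.
Qed.

(** The right-hand side represents the differential on H by the reproducing property
    [cm_dot_Rgamma], and such a representative is unique. *)
Lemma cyl_gradHE x : cyl_gradH gamma f x = \sum_i p i x *: Rgamma gamma (l i).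
Proof.
have HR i : H (Rgamma gamma (l i)) by exact: cameron_martin_Rgamma.
have Hs : H (\sum_i p i x *: Rgamma gamma (l i)) by exact: cameron_martin_sum.
have := @getPex _ [set y | H y /\ forall h, H h -> dot y h = 'd f x h].
case=> [|Hg gE].
  exists (\sum_i p i x *: Rgamma gamma (l i)); split => // h Hh.
  rewrite cyl_diff cm_dot_sum//; apply: eq_bigr => i _.
  by rewrite cm_dot_Rgamma.
apply: (@cm_dot_ext _ _ gamma) => // h Hh.
rewrite [LHS](gE h Hh) cyl_diff cm_dot_sum//; apply: eq_bigr => i _.
by rewrite cm_dot_Rgamma.
Qed.

Lemma cyl_gradH_cm x : H (cyl_gradH gamma f x).
Proof. by rewrite cyl_gradHE; apply: cameron_martin_sum => // i; exact: cameron_martin_Rgamma. Qed.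

Lemma cyl_gradH_dot x h : H h -> dot (cyl_gradH gamma f x) h = \sum_i p i x * l i h.
Proof.
move=> Hh; rewrite cyl_gradHE cm_dot_sum//.
  by apply: eq_bigr => i _; rewrite cm_dot_Rgamma.
by move=> i; exact: cameron_martin_Rgamma.
Qed.

Lemma cyl_gradH_sqr x : dot (cyl_gradH gamma f x) (cyl_gradH gamma f x) =
  \sum_i \sum_j p i x * p j x * ip (l i) (l j).
Proof.
rewrite cyl_gradH_dot; last exact: cyl_gradH_cm.
apply: eq_bigr => i _; have HR j : H (Rgamma gamma (l j)) by exact: cameron_martin_Rgamma.
have -> : l i (cyl_gradH gamma f x) = dot (cyl_gradH gamma f x) (Rgamma gamma (l i)).
  by rewrite cm_dotC cm_dot_Rgamma//; exact: cyl_gradH_cm.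
rewrite cyl_gradH_dot// mulr_sumr; apply: eq_bigr => j _.
rewrite -mulrA; congr (_ * (_ * _)).
have -> : l j (Rgamma gamma (l i)) = ip (l i) (l j) by exact: RgammaP.
by [].
Qed.

Lemma bounded_measurable_cyl : bounded_measurable (f : borel X -> R).
Proof.
have [bphi dphi _] := phiC; split; last first.
  by have [M hM] := bounded_funP bphi; exists M => x; exact: hM.
apply: (@measurable_continuous_row _ _ _ (borel X) (fun i => (l i : borel X -> R))).
  by move=> i; exact: measurable_top_dual.
by move=> y; apply: differentiable_continuous.
Qed.

Lemma bounded_measurable_cyl_derive i : bounded_measurable (p i : borel X -> R).
Proof.
have [_ _ /(_ i)[cp bp]] := phiC; split; last first.
  by have [M hM] := bounded_funP bp; exists M => x; exact: hM.
apply: (@measurable_continuous_row _ _ _ (borel X) (fun i => (l i : borel X -> R))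
  ('D_(delta_mx 0 i) phi)) => //.
by move=> j; exact: measurable_top_dual.
Qed.

Lemma bounded_measurable_cyl_grad :
  bounded_measurable ((fun x => dot (cyl_gradH gamma f x) (cyl_gradH gamma f x)) : borel X -> R).
Proof.
under [fun x => _]funext do rewrite cyl_gradH_sqr.
apply: bounded_measurable_sum => i; apply: bounded_measurable_sum => j.
apply: bounded_measurableM; last exact: bounded_measurable_cst.
by apply: bounded_measurableM; exact: bounded_measurable_cyl_derive.
Qed.

End gradient.
End cylindrical.

(** * The inequality on polyhedra *)

Section polyhedra.
Context (R : realType) (X : completeNormedModType R) (Xsep : separable X).
Variable gamma : probability (borel X) R.
Hypothesis gammaG : centered_gaussian gamma.
Hypothesis gammaN : nondegenerate_measure gamma.
Notation ip := (l2_ip gamma).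
Notation dot := (cm_dot gamma).

(** The Poincare inequality on A multiplied by gamma(A). In this form, without
    division, it is stable under limits of A. *)
Definition poincare_on (A : set X) (f : X -> R) :=
  \int[gamma]_x (\1_A x : R) * \int[gamma]_x (f x ^+ 2 * \1_A x)
    - (\int[gamma]_x (f x * \1_A x)) ^+ 2 <=
  \int[gamma]_x (\1_A x : R) *
    \int[gamma]_x (dot (cyl_gradH gamma f x) (cyl_gradH gamma f x) * \1_A x).

(** In the coordinates given by [orthonormal_basis] for the l_i and the lam_j, the
    polyhedron is a convex set of R^m and the H-gradient becomes the Euclidean one.
    The bounds on the l_i confine the row vectors to a compact box, where the
    derivatives of phi are uniformly continuous. *)
Lemma poincare_polyhedron n (phi : 'rV[R]_n -> R^o) (l : 'I_n -> X -> R)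
    (N : nat) (lam : nat -> X -> R) (c : nat -> R) (M : R) :
  C1b phi -> (forall i, top_dual (l i)) -> (forall j, top_dual (lam j)) ->
  poincare_on [set x | (forall j, (j < N)%N -> lam j x <= c j) /\ (forall i, `|l i x| <= M)]
    (fun x => phi (\row_i l i x)).
Proof.
move=> phiC tl tlam.
(* The n functionals of f followed by the N functionals of the polyhedron. *)
pose L i := if insub i is Some i' then l i' else lam (i - n)%N.
have Ll (i : 'I_n) : L i = l i by rewrite /L valK.
have Llam j : L (n + j)%N = lam j.
  by rewrite /L insubF ?addKn// ltnNge leq_addr.
have tL i : top_dual (L i) by rewrite /L; case: insub.
have [m [xi [B [txi orth LB]]]] := orthonormal_basis gammaG (n + N) gammaN tL.
pose lin i (z : coords R m) := \sum_(k < m) B i k * crd z k.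
pose tm (x : borel X) : coords R m := tuple_map m (xi : nat -> borel X -> R) x.
have linE i x : (i < n + N)%N -> lin i (tm x) = L i x.
  move=> iN; rewrite LB//; apply: eq_bigr => k _.
  by rewrite /tm crd_tuple_map.
have bn (i : 'I_n) : (i < n + N)%N by apply: leq_trans (ltn_ord i) (leq_addr _ _).
pose K : set (coords R m) := [set z | (forall j, (j < N)%N -> lin (n + j)%N z <= c j) /\
  (forall i : 'I_n, `|lin i z| <= M)].
pose u (z : coords R m) : 'rV[R]_n := \row_i lin i z.
pose p (i : 'I_n) z : R := 'D_(delta_mx 0 i) phi (u z).
pose D (k : 'I_m) z := \sum_(i < n) p i z * B i k.
have mlin i : measurable_fun setT (lin i).
  by apply: measurable_sum => k; apply: measurable_funM => //; exact: measurable_crd.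
have mK : measurable K.
  have -> : K = (\bigcap_(j in `I_N) lin (n + j)%N @^-1` `]-oo, c j]) `&`
      (\bigcap_(i in [set: 'I_n]) (fun z => `|lin i z|) @^-1` `]-oo, M]).
    apply/seteqP; split => z.
      move=> [h1 h2]; split; first by move=> j jN; rewrite /= in_itv/=; exact: h1.
      by move=> i _; rewrite /= in_itv/=; exact: h2.
    move=> [h1 h2]; split; first by move=> j jN; have := h1 j jN; rewrite /= in_itv.
    by move=> i; have := h2 i I; rewrite /= in_itv.
  apply: measurableI; apply: fin_bigcap_measurable => // i _.
    by have := mlin (n + i)%N measurableT _ (measurable_itv `]-oo, c i]); rewrite setTI.
  have mi := measurableT_comp (@normr_measurable R setT) (mlin i).
  by have := mi measurableT _ (measurable_itv `]-oo, M]); rewrite setTI.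
have Kmid x y : K x -> K y -> K (midpoint x y).
  have midE i : lin i (midpoint x y) = (lin i x + lin i y) / 2.
    rewrite /lin -big_split/= mulr_suml; apply: eq_bigr => k _.
    by rewrite crd_midpoint; ring.
  move=> [x1 x2] [y1 y2]; split.
    by move=> j jN; rewrite midE; have := x1 j jN; have := y1 j jN; lra.
  move=> i; rewrite midE; have := x2 i; have := y2 i.
  rewrite !ler_norml => /andP[a b] /andP[e d]; apply/andP; split; lra.
have [bphi dphi cphi] := phiC.
have bg : bounded_measurable (fun z => phi (u z) : R).
  split; last by have [C hC] := bounded_funP bphi; exists C => z; exact: hC.
  apply: (measurable_continuous_row (z := fun i : 'I_n => lin i)) => // y.
  exact: differentiable_continuous.
have bp i : bounded_measurable (p i).
  have [ci bi] := cphi i; split; last by have [C hC] := bounded_funP bi; exists C => z; exact: hC.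
  exact: (@measurable_continuous_row _ _ _ _ (fun i : 'I_n => lin i) ('D_(delta_mx 0 i) phi)).
have bD k : bounded_measurable (D k).
  apply: bounded_measurable_sum => i; apply: bounded_measurableM => //.
  exact: bounded_measurable_cst.
have /(poincare_gauss mK Kmid bg bD) P : forall delta : R, 0 < delta ->
    exists2 eta, 0 < eta & forall x y, K x -> K y ->
      (forall i : 'I_m, `|crd y i - crd x i| <= eta) ->
      phi (u x) - phi (u y) <= \sum_i (`|D i x| + delta) * `|crd y i - crd x i|.
  move=> delta delta0.
  have [eta eta0 h] := first_order_bound (fun (i : 'I_n) (k : 'I_m) => B i k) M phiC delta0.
  exists eta => // x y Kx Ky xy.
  have := h (fun k => crd x k) (fun k => crd y k) _ xy; apply.
  by move=> i; rewrite mxE; exact: Kx.2.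
pose A := [set x | (forall j, (j < N)%N -> lam j x <= c j) /\ (forall i, `|l i x| <= M)].
have AK x : A x <-> K (tm x).
  split=> -[h1 h2]; split.
  - by move=> j jN; rewrite linE ?ltn_add2l// Llam; exact: h1.
  - by move=> i; rewrite linE// Ll; exact: h2.
  - by move=> j jN; have := h1 j jN; rewrite linE ?ltn_add2l// Llam.
  - by move=> i; have := h2 i; rewrite linE// Ll.
have IA x : \1_A x = \1_K (tm x) :> R.
  rewrite !indicE; have -> // : (x \in A) = (tm x \in K).
  by apply/idP/idP => /set_mem /AK/mem_set.
have fE x : phi (\row_i l i x) = phi (u (tm x)).
  by congr (phi _); apply/rowP => i; rewrite !mxE linE// Ll.
have pE i x : 'D_(delta_mx 0 i) phi (\row_j l j x) = p i (tm x).
  by congr ('D_(delta_mx 0 i) phi _); apply/rowP => j; rewrite !mxE linE// Ll.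
have ipE (i j : 'I_n) : ip (l i) (l j) = \sum_(k < m) B i k * B j k.
  have lE (i' : 'I_n) : l i' = (fun x => \sum_(k < m) B i' k * xi k x).
    by apply/funext => x; rewrite -Ll LB.
  have Lxi k := L2_top_dual gammaG (txi k).
  rewrite {1}lE ip_suml//; last exact: L2_top_dual.
  apply: eq_bigr => k _; congr (_ * _).
  rewrite lE ipC ip_suml// (bigD1 k)//= big1 ?addr0; first by rewrite orth// eqxx mulr1.
  by move=> k' kk'; rewrite orth//; have /negbTE-> : (k' != k :> nat) by []; rewrite mulr0.
have gE x : dot (cyl_gradH gamma (fun x => phi (\row_i l i x)) x)
    (cyl_gradH gamma (fun x => phi (\row_i l i x)) x) = \sum_k D k (tm x) ^+ 2.
  rewrite cyl_gradH_sqr//.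
  under eq_bigr do under eq_bigr do rewrite ipE !pE mulr_sumr.
  under eq_bigr do rewrite exchange_big/=.
  rewrite exchange_big/=; apply: eq_bigr => k _.
  rewrite expr2 /D mulr_suml; apply: eq_bigr => i _.
  rewrite mulr_sumr; apply: eq_bigr => j _.
  by move: (p i (tm x)) (p j (tm x)) (B i k) (B j k) => *; ring.
have law (F : coords R m -> R) (G : X -> R) : bounded_measurable F -> (forall x, G x = F (tm x)) ->
    \int[gamma]_x G x = \int[gauss R m]_z F z.
  move=> bF GF; rewrite -(gauss_law_functionals gammaG txi orth bF).
  by apply: eq_Rintegral => x _; exact: GF.
have bI : bounded_measurable (\1_K : coords R m -> R) by exact: bounded_measurable_indic.
rewrite /poincare_on -/A (law _ _ bI IA).
rewrite (law (fun z => phi (u z) ^+ 2 * \1_K z)); first last.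
- by move=> x; rewrite IA fE.
- by apply: bounded_measurableM => //; exact: bounded_measurable_sqr.
rewrite (law (fun z => phi (u z) * \1_K z)); first last.
- by move=> x; rewrite IA fE.
- exact: bounded_measurableM.
rewrite (law (fun z => (\sum_k D k z ^+ 2) * \1_K z)); first last.
- by move=> x; rewrite IA gE.
- apply: bounded_measurableM => //; apply: bounded_measurable_sum => k.
  exact: bounded_measurable_sqr.
exact: P.
Qed.

End polyhedra.

(** * The inequality on open convex sets *)

Lemma convex_set_points (R : realType) (X : normedModType R) (Om : set X) :
  convex_set (Om : set (convex_lmodType X)) -> convex_points Om.
Proof.
move=> cO x y t Ox Oy /andP[t0 t1].
have tI : Itv.spec (@Itv.num_sem R) (Itv.Real `[0%Z, 1%Z]) t.
  by rewrite /= /Itv.num_sem/= in_itv/= t0 t1 num_real.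
by have /set_mem := cO x y (Itv.mk tI) (mem_set Ox) (mem_set Oy).
Qed.

Section open_convex.
Variables (R : realType) (X : normedModType R) (Xsep : separable X).
Variables (O : set X) (r : R).
Hypothesis O_open : open O.
Hypothesis O_convex : convex_points O.
Hypothesis r0 : 0 < r.
Hypothesis ballO : forall x, `|x| < r -> O x.

(** If z were in O, then x would be a convex combination of z and of a point of the
    ball of radius r. *)
Let convex_gap (x z : X) (s : R) : ~ O x -> 1 < s -> `|z - s *: x| < (s - 1) * r -> ~ O z.
Proof.
move=> nOx s1 zs Oz; apply: nOx.
have s10 : 0 < s - 1 by rewrite subr_gt0.
have sp : 0 < s by exact: lt_trans s1.
(* The point w for which x = z/s + (1 - 1/s) w. *)
pose w := (s - 1)^-1 *: (s *: x - z).
have Ow : O w.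
  apply: ballO; rewrite /w normrZ gtr0_norm ?invr_gt0// distrC.
  by rewrite mulrC ltr_pdivrMr// mulrC.
have := O_convex (t := s^-1) Oz Ow.
have -> : s^-1 *: z + (1 - s^-1) *: w = x.
  rewrite /w scalerA.
  have -> : (1 - s^-1) / (s - 1) = s^-1.
    by field; rewrite !gt_eqF.
  by rewrite -scalerDr addrC subrK scalerA mulVf ?scale1r// gt_eqF.
by apply; rewrite invr_ge0 (ltW sp)/= invf_le1// ltW.
Qed.

(** The functionals separate O from the points outside O of a dense sequence. A point
    x of O is still in O after multiplication by some s > 1, so the functionals are
    bounded by 1/s < 1 at x. Conversely, if x is not in O, then near (1 + eta) x there
    are points of the sequence, outside O by [convex_gap], whose functionals are
    close to 1 or larger at x. *)
Lemma open_convex_halfspaces : exists lam : nat -> X -> R,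
  (forall k, top_dual (lam k)) /\
  forall x, O x <-> exists n : nat, forall k, lam k x <= n%:R / n.+1%:R.
Proof.
have [q qd] := separable_dense_sequence 0 Xsep.
have /choice[lam hlam] k : exists l : X -> R, [/\ top_dual l, forall x, O x -> l x <= 1,
    ~ O (q k) -> 1 <= l (q k) & forall x, `|l x| <= `|x| / r].
  have [Oq|nOq] := pselect (O (q k)); last first.
    by have [l [h1 h2 h3 h4]] := separation O_convex r0 ballO nOq; exists l.
  exists (fun=> 0); split => //; first exact: top_dual0.
  by move=> x; rewrite normr0 divr_ge0// ltW.
exists lam; split; first by move=> k; have [] := hlam k.
move=> x; split=> [Ox|[n hn]].
  have [s s1 Os] : exists2 s, 1 < s & O (s *: x).
    have : (s *: x) @[s --> (1 : R)] --> (1 : R) *: x by exact: scalel_continuous.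
    rewrite scale1r => /(_ O) cvO.
    have : nbhs x O by exact: open_nbhs_nbhs.
    move=> /cvO /nbhs_ballP[e /= e0 h]; exists (1 + e / 2); first by rewrite ltrDl divr_gt0.
    apply: h; rewrite -ball_normE /ball_/= opprD addrA subrr add0r normrN gtr0_norm ?divr_gt0//.
    by rewrite gtr_pMr// invf_lt1// ltr1n.
  have sp : 0 < s by exact: lt_trans s1.
  have s1' : 0 < 1 - s^-1 by rewrite subr_gt0 invf_lt1.
  have [N _ hN] := near_infty_natSinv_lt (PosNum s1').
  exists N => k; have [tl le1 _ _] := hlam k.
  have := le1 _ Os; rewrite top_dualZ// mulrC -ler_pdivlMr// mul1r => h.
  apply: le_trans h _; have /= := hN N (leqnn N).
  have -> : N%:R / N.+1%:R = 1 - N.+1%:R^-1 :> R by rewrite -natr1; field; rewrite natr1.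
  by move: (N.+1%:R^-1) => u; lra.
apply: contrapT => nOx.
pose t : R := n%:R / n.+1%:R.
have t0 : 0 <= t by rewrite divr_ge0.
have t1 : t < 1 by rewrite ltr_pdivrMr// mul1r ltr_nat.
(* Chosen so that (1 + eta) t <= 1 - eta. *)
pose eta : R := (1 - t) / 4; have eta0 : 0 < eta by rewrite divr_gt0// subr_gt0.
pose s := 1 + eta.
have [k hk] : exists k, `|q k - s *: x| < eta * r.
  apply: (qd [set y | `|y - s *: x| < eta * r]); last first.
    by exists (s *: x); rewrite /= subrr normr0 mulr_gt0.
  rewrite (_ : [set y | _] = ball (s *: x) (eta * r)); first exact: ball_open.
  by apply/seteqP; split => y; rewrite -ball_normE /ball_/= distrC.
have nOq : ~ O (q k).
  apply: (convex_gap nOx (s := s)); first by rewrite ltrDl.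
  by rewrite /s addrAC subrr add0r.
have [tl _ /(_ nOq) lq lb] := hlam k.
have h1 : `|lam k (q k) - s * lam k x| < eta.
  rewrite -top_dualZ// -top_dual_sub//; apply: le_lt_trans (lb _) _.
  by rewrite ltr_pdivrMr.
have h2 : s * lam k x <= s * t.
  by rewrite ler_pM2l ?hn// /s addr_gt0.
move: h1; rewrite ltr_norml => /andP[_ h1].
have : 1 - eta < s * t by apply: lt_le_trans h2; lra.
have : (1 + eta) * t <= 1 - eta; last by rewrite /s => h3 h4; have := lt_le_trans h4 h3; rewrite ltxx.
by rewrite /eta; nra.
Qed.

End open_convex.

Section convex_poincare.
Context (R : realType) (X : completeNormedModType R) (Xsep : separable X).
Variable gamma : probability (borel X) R.
Hypothesis gammaG : centered_gaussian gamma.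
Hypothesis gammaN : nondegenerate_measure gamma.
Notation dot := (cm_dot gamma).

Lemma poincare_on_limit (A_ : nat -> set X) (A : set X) (f : X -> R) :
  (forall n, measurable (A_ n : set (borel X))) -> measurable (A : set (borel X)) ->
  (forall x, exists n0, forall n, (n0 <= n)%N -> A_ n x <-> A x) ->
  bounded_measurable (f : borel X -> R) ->
  bounded_measurable ((fun x => dot (cyl_gradH gamma f x) (cyl_gradH gamma f x)) : borel X -> R) ->
  (forall n, poincare_on gamma (A_ n) f) -> poincare_on gamma A f.
Proof.
move=> mA_ mA lim_A bf bg PA.
have cvI (h : borel X -> R) : bounded_measurable h ->
    (\int[gamma]_x (h x * \1_(A_ n) x)) @[n --> \oo] --> \int[gamma]_x (h x * \1_A x).
  move=> bh; have [mh [M hM]] := bh.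
  apply: (@bounded_convergence _ (borel X) R gamma (fun n x => h x * \1_(A_ n) x)
    (fun x => h x * \1_A x) M).
  - by move=> n; apply: measurable_funM => //; exact: measurable_indic.
  - by apply: measurable_funM => //; exact: measurable_indic.
  - move=> n x; rewrite normrM indicE; apply: le_trans (hM x).
    by case: (_ \in _); rewrite ?normr1 ?normr0 ?mulr1 ?mulr0.
  - move=> x; have [n0 hn0] := lim_A x; apply: cvg_near_cst; exists n0 => // n /= nn.
    rewrite !indicE; have -> // : (x \in A_ n) = (x \in A).
    by apply/idP/idP => /set_mem /(hn0 n nn)/mem_set.
have c1 : (\int[gamma]_x (\1_(A_ n) x : R)) @[n --> \oo] --> \int[gamma]_x (\1_A x : R).
  have := cvI _ (bounded_measurable_cst (borel X) 1).
  under eq_fun do under eq_Rintegral do rewrite mul1r.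
  by under [X in _ --> X -> _]eq_Rintegral do rewrite mul1r.
have c2 := cvI _ (bounded_measurable_sqr bf).
have c3 := cvI _ bf.
have c4 := cvI _ bg.
apply: (ler_cvg_to (cvgB (cvgM c1 c2) (cvgM c3 c3)) (cvgM c1 c4)).
by apply: nearW => n; exact: PA.
Qed.

(** Two successive limits: N to infinity for the number of half-spaces and the bound
    on the functionals l_i, and j to infinity for the level j/(j+1). *)
Lemma poincare_convex (Om : set X) n (phi : 'rV[R]_n -> R^o) (l : 'I_n -> X -> R) :
  Om !=set0 -> open Om -> convex_points Om -> C1b phi -> (forall i, top_dual (l i)) ->
  poincare_on gamma Om (fun x => phi (\row_i l i x)).
Proof.
move=> [a Oa] oO cO phiC tl.
pose O : set X := [set y | Om (y + a)].
have oO' : open O.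
  by apply: open_comp => // y _; apply: cvgD; [exact: cvg_id|exact: cvg_cst].
have cO' : convex_points O.
  move=> x y t Ox Oy t01; rewrite /O/=.
  have := cO _ _ _ Ox Oy t01; congr Om.
  by rewrite !scalerDr addrACA -scalerDl addrCA subrr addr0 scale1r.
have [r r0 hr] : exists2 r : R, 0 < r & forall x, `|x| < r -> O x.
  have /nbhs_ballP[r /= r0 h] : nbhs (0 : X) O.
    by apply: open_nbhs_nbhs; split => //; rewrite /O/= add0r.
  exists r => // x xr; apply: h; rewrite -ball_normE /ball_/= sub0r normrN//.
have [lam [tlam OE]] := open_convex_halfspaces Xsep oO' cO' r0 hr.
pose f x := phi (\row_i l i x).
have bf := bounded_measurable_cyl phiC tl.
have bg := bounded_measurable_cyl_grad Xsep gammaG phiC tl.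
have mlam (k : X -> R) c : top_dual k -> measurable ([set x | k x <= c] : set (borel X)).
  move=> tk; have mk := measurable_top_dual tk.
  have := mk measurableT _ (measurable_itv `]-oo, c]).
  by rewrite setTI; congr measurable; apply/seteqP; split => x /=; rewrite in_itv.
have lamE k x : lam k (x - a) = lam k x - lam k a by exact: top_dual_sub.
pose B (j : nat) : set X := [set x | forall k, lam k (x - a) <= j%:R / j.+1%:R].
have mB j : measurable (B j : set (borel X)).
  have -> : B j = \bigcap_k [set x | lam k x <= j%:R / j.+1%:R + lam k a].
    apply/seteqP; split => x /=.
      by move=> h k _; have := h k; rewrite lamE lerBlDr.
    by move=> h k; have := h k I; rewrite /= lamE lerBlDr.
  by apply: bigcapT_measurable => k; exact: mlam.
apply: (@poincare_on_limit B) => //.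
- exact: sub_sigma_algebra.
- move=> x; have [Ox|nOx] := pselect (Om x).
    have [n0 hn0] : exists n, forall k, lam k (x - a) <= n%:R / n.+1%:R.
      by apply/OE; rewrite /O/= subrK.
    exists n0 => m nm; split => // _ k; apply: le_trans (hn0 k) _.
    by rewrite ler_pdivrMr// mulrAC ler_pdivlMr// -!natrM ler_nat; lia.
  exists 0%N => m _; split => // Bm; exfalso; apply: nOx.
  have : O (x - a) by apply/OE; exists m.
  by rewrite /O/= subrK.
move=> j.
pose C N : set X := [set x | (forall k, (k < N)%N -> lam k x <= j%:R / j.+1%:R + lam k a) /\
  forall i, `|l i x| <= N%:R].
apply: (@poincare_on_limit C) => //.
- move=> N.
  have -> : C N = (\bigcap_(k in `I_N) [set x | lam k x <= j%:R / j.+1%:R + lam k a]) `&`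
      (\bigcap_(i in [set: 'I_n]) ([set x | l i x <= N%:R] `&` [set x | - l i x <= N%:R])).
    apply/seteqP; split => x.
      move=> [h1 h2]; split => // i _; have := h2 i; rewrite ler_norml => /andP[u v].
      by split => //=; rewrite lerNl.
    move=> [h1 h2]; split => // i; have [u v] := h2 i I.
    by rewrite ler_norml lerNl; apply/andP.
  apply: measurableI; apply: fin_bigcap_measurable => // i _; first exact: mlam.
  apply: measurableI; first exact: mlam.
  have := top_dual_scale (-1) (tl i) => t'.
  by have := mlam _ N%:R t'; congr measurable; apply/seteqP; split => x /=; rewrite mulN1r.
- move=> x; have [Bx|nBx] := pselect (B j x).
    pose n0 := (\sum_i (Num.truncn `|l i x|).+1)%N.
    exists n0 => N nN; split => // _; split.
      by move=> k _; have := Bx k; rewrite lamE lerBlDr.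
    move=> i; apply: le_trans (_ : (Num.truncn `|l i x|).+1%:R <= _).
      by apply/ltW; exact: truncnS_gt.
    rewrite ler_nat; apply: leq_trans nN.
    by rewrite /n0 (bigD1 i)//= leq_addr.
  have [k nk] : exists k, ~ lam k (x - a) <= j%:R / j.+1%:R by apply/existsNP.
  exists k.+1 => N kN; split => // -[h _]; exfalso; apply: nk.
  by rewrite lamE lerBlDr; exact: h.
move=> N; exact: (poincare_polyhedron Xsep gammaG gammaN).
Qed.

End convex_poincare.

(** * Passage to the closure *)

Lemma lee_comb (R : realType) (a b s t : R) (x y : \bar R) : 0 <= a -> 0 <= b ->
  (x <= s%:E -> y <= t%:E -> a%:E * x + b%:E * y <= (a * s + b * t)%:E)%E.
Proof.
by move=> a0 b0 xs yt; rewrite EFinD !EFinM; apply: leeD; apply: lee_wpmul2l; rewrite ?lee_fin.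
Qed.

Section variance.
Context d (T : measurableType d) (R : realType) (P : {finite_measure set T -> \bar R}).
Variable D : set T.
Hypothesis mD : measurable D.

Lemma integral_sqr_dist (f : T -> R) (c : R) : measurable_fun D f ->
  (\int[P]_(x in D) ((f x) ^+ 2)%:E < +oo)%E ->
  (\int[P]_(x in D) ((f x - c) ^+ 2)%:E =
   (\int[P]_(x in D) (f x ^+ 2)%R - 2 * c * \int[P]_(x in D) f x
     + c ^+ 2 * fine (P D))%:E)%E.
Proof.
move=> mf fi.
have i2 : P.-integrable D (fun x => (f x ^+ 2)%:E).
  apply/integrableP; split; first by apply/measurable_EFinP; exact: measurable_funX.
  by under eq_integral do rewrite /= ger0_norm ?sqr_ge0//.
have ic k : P.-integrable D (cst (k%:E : \bar R)) by exact: finite_measure_integrable_cst.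
have i1 : P.-integrable D (fun x => (f x)%:E).
  apply: (@le_integrable _ _ _ P D mD _ (fun x => 1%:E + (f x ^+ 2)%:E)%E).
  - exact/measurable_EFinP.
  - move=> x _; rewrite -EFinD /= lee_fin [leRHS]ger0_norm ?addr_ge0 ?sqr_ge0//.
    rewrite -(real_normK (num_real (f x))); have := sqr_ge0 (`|f x| - 1).
    by move: `|f x| => a; rewrite !expr2; nra.
  - exact: (integrableD mD (ic 1) i2).
have E1 : (\int[P]_(x in D) (f x)%:E = (\int[P]_(x in D) f x)%:E)%E.
  by rewrite /Rintegral fineK//; exact: integrable_fin_num.
have E2 : (\int[P]_(x in D) (f x ^+ 2)%:E = (\int[P]_(x in D) (f x ^+ 2)%R)%:E)%E.
  by rewrite /Rintegral fineK//; exact: integrable_fin_num.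
have PD : P D = (fine (P D))%:E by rewrite fineK// fin_num_measure.
under eq_integral => x _.
  rewrite (_ : (f x - c) ^+ 2 = f x ^+ 2 + ((- 2 * c) * f x + c ^+ 2)); last by ring.
  rewrite !EFinD (EFinM (- 2 * c)); over.
have iz : P.-integrable D (fun x => (- 2 * c)%:E * (f x)%:E)%E by exact: integrableZl.
rewrite integralD//; last by apply: integrableD => //; exact: ic.
rewrite integralD//; last exact: ic.
have -> : (\int[P]_(x in D) ((- 2 * c)%:E * (f x)%:E) =
    (- 2 * c * \int[P]_(x in D) f x)%:E)%E by rewrite integralZl// E1 EFinM.
have -> : (\int[P]_(x in D) (c ^+ 2)%:E = (c ^+ 2 * fine (P D))%:E)%E.
  by rewrite [RHS]EFinM -PD; exact: integral_cst.
by rewrite E2 -!EFinD; congr (_%:E); ring.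
Qed.

Lemma ge0_le_integral_comb (f g h : T -> R) (a b : R) : 0 <= a -> 0 <= b ->
  measurable_fun D f -> measurable_fun D g -> measurable_fun D h ->
  (forall x, D x -> [/\ 0 <= f x, 0 <= g x, 0 <= h x & f x <= a * g x + b * h x]) ->
  (\int[P]_(x in D) (f x)%:E <=
   a%:E * \int[P]_(x in D) (g x)%:E + b%:E * \int[P]_(x in D) (h x)%:E)%E.
Proof.
move=> a0 b0 mf mg mh H.
rewrite -!ge0_integralZl_EFin//; first last.
- exact/measurable_EFinP.
- by move=> x /H[].
- exact/measurable_EFinP.
- by move=> x /H[].
rewrite -ge0_integralD//; first last.
- by apply/measurable_EFinP; exact: measurable_funM.
- by move=> x /H[_ _ h0 _]; rewrite lee_fin mulr_ge0.
- by apply/measurable_EFinP; exact: measurable_funM.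
- by move=> x /H[_ g0 _ _]; rewrite lee_fin mulr_ge0.
apply: ge0_le_integral => //.
- by move=> x /H[].
- exact/measurable_EFinP.
- by apply/measurable_EFinP; apply: measurable_funD; exact: measurable_funM.
- by move=> x /H[_ _ _ le]; rewrite -!EFinM -EFinD lee_fin.
Qed.

Lemma integral_indic_EFin (f : T -> R) : bounded_measurable f ->
  (\int[P]_(x in D) (f x)%:E = (\int[P]_x (f x * \1_D x))%:E)%E.
Proof.
move=> bf; rewrite -Rintegral_EFin; last first.
  by apply: bounded_measurableM => //; exact: bounded_measurable_indic.
rewrite integral_mkcond; apply: eq_integral => x _.
by rewrite patchE indicE; case: (_ \in _); rewrite ?mulr1 ?mulr0.
Qed.

End variance.

Section cm_geometry.
Context (R : realType) (X : completeNormedModType R) (Xsep : separable X).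
Variable gamma : probability (borel X) R.
Hypothesis gammaG : centered_gaussian gamma.
Notation H := (cameron_martin gamma).
Notation dot := (cm_dot gamma).
Notation nrm := (cm_norm gamma).

Lemma cm_dot_le h k : H h -> H k -> `|dot h k| <= nrm h * nrm k.
Proof.
move=> Hh Hk; have [[Lh _] _] := cm_hatP Hh; have [[Lk _] _] := cm_hatP Hk.
have := cauchy_schwarz Lh Lk; rewrite -[l2_ip _ _ _]/(dot h k) -[l2_ip _ _ _ * _]/(dot h h * dot k k).
rewrite -!cm_norm_sqr -exprMn -(real_normK (num_real (dot h k))).
by rewrite ler_pXn2r// nnegrE// mulr_ge0// sqrtr_ge0.
Qed.

Lemma cameron_martinB h k : H h -> H k -> H (h - k).
Proof.
by move=> Hh Hk; have := cameron_martin_comb gammaG 1 (-1) Hh Hk; rewrite scale1r scaleN1r.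
Qed.

Lemma cm_dotB h k z : H h -> H k -> H z -> dot (h - k) z = dot h z - dot k z.
Proof.
move=> Hh Hk Hz; have := cm_dot_comb gammaG 1 (-1) Hh Hk Hz.
by rewrite scale1r scaleN1r mul1r mulN1r.
Qed.

Lemma cm_dot_sqrB h k : H h -> H k -> dot (h - k) (h - k) = dot h h - 2 * dot h k + dot k k.
Proof.
move=> Hh Hk; have Hd := cameron_martinB Hh Hk.
rewrite cm_dotB// cm_dotC [dot k _]cm_dotC !cm_dotB// [dot k h]cm_dotC.
by move: (dot h h) (dot h k) (dot k k) => p q w; ring.
Qed.

(** Continuity of F from below in the norm of H, at each point of H. *)
Lemma cm_open_gt (F : X -> R) (t : R) :
  (forall h, H h -> exists2 C, 0 <= C & forall k, H k -> F h - F k <= C * nrm (k - h)) ->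
  cm_open gamma [set h | H h /\ t < F h].
Proof.
move=> HF; split=> [h []//|h [Hh th]].
have [C C0 hC] := HF h Hh.
have C1 : 0 < C + 1 by rewrite ltr_wpDl.
exists ((F h - t) / (C + 1)); first by rewrite divr_gt0 ?subr_gt0.
move=> k Hk; rewrite (ltr_pdivlMr _ _ C1) => hk; split => //.
have := hC k Hk; have n0 : 0 <= nrm (k - h) by exact: sqrtr_ge0.
by move: (nrm (k - h)) hk n0 => u; rewrite mulrDr mulr1 mulrC; lra.
Qed.

(** The definition of L^2(Omega, gamma; H) speaks of open sets of H; real functions
    that are lower semicontinuous on H are tested on their superlevel sets. *)
Lemma measurable_cm (Om : set X) (Y : X -> X) (F : X -> R) :
  measurable (Om : set (borel X)) -> L2H gamma Om Y ->
  (forall h, H h -> exists2 C, 0 <= C & forall k, H k -> F h - F k <= C * nrm (k - h)) ->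
  measurable_fun (Om : set (borel X)) ((fun x => F (Y x)) : borel X -> R).
Proof.
move=> mOm [HY mY _] HF; apply: (measurability _ (RGenOInfty.measurableE R)) => //.
move=> _ [_ [t ->] <-].
have := mY _ (cm_open_gt t HF); congr measurable; apply/seteqP; split => x [Ox].
  by move=> [_ tF]; split => //=; rewrite in_itv/= tF.
by rewrite /= in_itv/= andbT => tF; split => //; split => //; exact: HY.
Qed.

Lemma measurable_cm_sqr (Om : set X) (Y : X -> X) :
  measurable (Om : set (borel X)) -> L2H gamma Om Y ->
  measurable_fun (Om : set (borel X)) ((fun x => dot (Y x) (Y x)) : borel X -> R).
Proof.
move=> mOm LY; apply: (measurable_cm (F := fun h => dot h h) mOm LY) => h Hh.
exists (2 * nrm h); first by rewrite mulr_ge0// sqrtr_ge0.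
move=> k Hk; have Hd := cameron_martinB Hk Hh.
have := cm_dot_le Hd Hh; rewrite ler_norml => /andP[b _].
have := cm_dot_ge0 gamma (k - h); rewrite cm_dot_sqrB//.
move: b; rewrite cm_dotB// -[2 * _ * _]mulrA [nrm h * _]mulrC.
by move: (nrm _ * nrm _) (dot h h) (dot k h) (dot k k) => c p q w b0 d0; lra.
Qed.

Lemma measurable_cm_functional (Om : set X) (Y : X -> X) (l : X -> R) :
  measurable (Om : set (borel X)) -> L2H gamma Om Y -> top_dual l ->
  measurable_fun (Om : set (borel X)) ((fun x => l (Y x)) : borel X -> R).
Proof.
move=> mOm LY tl; apply: (measurable_cm (F := l) mOm LY) => h Hh.
have HR := cameron_martin_Rgamma Xsep gammaG tl.
exists (nrm (Rgamma gamma l)); first exact: sqrtr_ge0.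
move=> k Hk; have Hd := cameron_martinB Hk Hh.
have := cm_dot_le HR Hd; rewrite (cm_dot_Rgamma Xsep gammaG tl Hd) top_dual_sub//.
rewrite ler_norml => /andP[+ _].
by move: (nrm _ * nrm _) (l h) (l k) => c p q b0; lra.
Qed.

(** The square of the norm of (h - k) - e k is nonnegative. *)
Lemma cm_dot_young h k (e : R) : H h -> H k -> 0 < e ->
  dot h h <= (1 + e^-1) * dot (h - k) (h - k) + (1 + e) * dot k k.
Proof.
move=> Hh Hk e0; have Hd := cameron_martinB Hh Hk.
have := cm_dot_ge0 gamma (1 *: (h - k) + (- e) *: k).
rewrite cm_dot_sqr_comb// cm_dot_sqrB// cm_dotB//.
move: (dot h h) (dot h k) (dot k k) => p q w h0; rewrite -subr_ge0.
have : 0 <= e^-1 * (1 ^+ 2 * (p - 2 * q + w) + 2 * 1 * - e * (q - w) + (- e) ^+ 2 * w).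
  by rewrite mulr_ge0// invr_ge0 ltW.
by congr (0 <= _); field; rewrite gt_eqF.
Qed.

End cm_geometry.

Section sobolev.
Context (R : realType) (X : completeNormedModType R) (Xsep : separable X).
Variable gamma : probability (borel X) R.
Hypothesis gammaG : centered_gaussian gamma.
Hypothesis gammaN : nondegenerate_measure gamma.
Notation H := (cameron_martin gamma).
Notation dot := (cm_dot gamma).
Notation nrm := (cm_norm gamma).
Variable Om : set X.
Hypothesis Om0 : Om !=set0.
Hypothesis Om_open : open Om.
Hypothesis Om_convex : convex_points Om.
Hypothesis gOm : gamma Om != 0%E.

Let mOm : measurable (Om : set (borel X)).
Proof. exact: sub_sigma_algebra. Qed.

Let P := fine (gamma Om).

Let P0 : 0 < P.
Proof.
have fin : gamma Om \is a fin_num by exact: fin_num_measure.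
by rewrite fine_gt0// lt0e gOm measure_ge0 /= -ge0_fin_numE.
Qed.

(** The quadratic polynomial of [integral_sqr_dist] is minimal at the mean. *)
Lemma mean_minimizes (phi : X -> R) (c : R) : L2 gamma Om phi ->
  (\int[gamma]_(x in Om) ((phi x - mean gamma Om phi) ^+ 2)%:E <=
   \int[gamma]_(x in Om) ((phi x - c) ^+ 2)%:E)%E.
Proof.
move=> [mphi iphi]; have V := integral_sqr_dist (P := gamma) mOm _ mphi iphi.
rewrite !V lee_fin -/P /mean -/P.
set S := (\int[gamma]_(x in Om) phi x); set Q := Rintegral _ _ _.
rewrite -subr_ge0.
have -> : Q - 2 * c * S + c ^+ 2 * P - (Q - 2 * (P^-1 * S) * S + (P^-1 * S) ^+ 2 * P) =
    P * (c - P^-1 * S) ^+ 2 by field; rewrite gt_eqF.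
by rewrite mulr_ge0 ?sqr_ge0// ltW.
Qed.

Lemma poincare_cylindrical (f : X -> R) : FC1b f -> exists c : R,
  (\int[gamma]_(x in Om) ((f x - c) ^+ 2)%:E <=
   \int[gamma]_(x in Om) (dot (cyl_gradH gamma f x) (cyl_gradH gamma f x))%:E)%E.
Proof.
move=> [n [phi [l [phiC tl fE]]]].
have {fE} -> : f = (fun x => phi (\row_i l i x)) by apply/funext.
set u := (fun x => phi (\row_i l i x) : R).
have bu : bounded_measurable (u : borel X -> R) by exact: bounded_measurable_cyl.
have bg := bounded_measurable_cyl_grad Xsep gammaG phiC tl.
have pc := poincare_convex Xsep gammaG gammaN Om0 Om_open Om_convex phiC tl.
pose S := \int[gamma]_x (u x * \1_Om x).
have mu' : measurable_fun (Om : set (borel X)) u by apply: measurable_funTS; exact: bu.1.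
have i2 := integral_indic_EFin gamma mOm (bounded_measurable_sqr bu).
have i2' : (\int[gamma]_(x in Om) ((u x) ^+ 2)%:E < +oo)%E by rewrite i2 ltry.
have E2 : \int[gamma]_(x in Om) (u x ^+ 2) = \int[gamma]_x (u x ^+ 2 * \1_Om x).
  by rewrite {1}/Rintegral i2.
have E1 : \int[gamma]_(x in Om) u x = S.
  by rewrite {1}/Rintegral (integral_indic_EFin gamma mOm bu).
have EP : \int[gamma]_x (\1_Om x : R) = P.
  by rewrite /Rintegral integral_indic// setIT.
exists (S / P).
rewrite (integral_sqr_dist (P := gamma) mOm _ mu' i2') (integral_indic_EFin gamma mOm bg).
rewrite lee_fin E1 E2 -/P; move: pc; rewrite /poincare_on EP -/u -/S.
set Q := Rintegral _ _ _; set G := Rintegral _ _ _ => pc.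
rewrite -(ler_pM2l P0); apply: le_trans pc; rewrite le_eqVlt; apply/orP; left; apply/eqP.
by field; rewrite gt_eqF.
Qed.

(** Expanding the square leaves the scalar product of the gradient and Y, which by
    the reproducing property is a finite sum of terms p_i l_i(Y). *)
Lemma measurable_cm_diff (f : X -> R) (Y : X -> X) : FC1b f -> L2H gamma Om Y ->
  measurable_fun (Om : set (borel X))
    ((fun x => dot (cyl_gradH gamma f x - Y x) (cyl_gradH gamma f x - Y x)) : borel X -> R).
Proof.
move=> [n [phi [l [phiC tl fE]]]] LY.
have {fE} -> : f = (fun x => phi (\row_i l i x)) by apply/funext.
have [mg _] := bounded_measurable_cyl_grad Xsep gammaG phiC tl.
pose p i x : R := 'D_(delta_mx 0 i) phi (\row_j l j x).
have HY : forall x, Om x -> H (Y x) by case: LY.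
apply: (@eq_measurable_fun _ _ (borel X) R Om (fun x : borel X => dot (cyl_gradH gamma (fun x => phi (\row_i l i x)) x)
    (cyl_gradH gamma (fun x => phi (\row_i l i x)) x)
    - 2 * (\sum_i p i x * l i (Y x)) + dot (Y x) (Y x))).
  move=> x /set_mem Ox; rewrite cm_dot_sqrB//; [|exact: cyl_gradH_cm|exact: HY].
  by rewrite (cyl_gradH_dot Xsep gammaG phiC tl x (HY x Ox)).
apply: measurable_funD; last exact: (measurable_cm_sqr gammaG mOm LY).
apply: measurable_funB; first exact: measurable_funTS.
apply: measurable_funM => //; apply: measurable_sum => i.
apply: measurable_funM; last exact: (measurable_cm_functional Xsep gammaG mOm LY (tl i)).
by apply: measurable_funTS; exact: (bounded_measurable_cyl_derive phiC tl i).1.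
Qed.

(** With a weight e in Young's inequality, |phi - c|^2 is compared with |u_n - c|^2 and
    |grad u_n|^2 with |Y|^2, at the price of factors 1 + e on the main terms and
    1 + 1/e on the error terms, which are smaller than e^2 for a suitable n. *)
Lemma poincare_graph (phi : X -> R) (Y : X -> X) : gradH_graph gamma Om phi Y ->
  (\int[gamma]_(x in Om) ((phi x - mean gamma Om phi) ^+ 2)%:E <=
   \int[gamma]_(x in Om) ((nrm (Y x)) ^+ 2)%:E)%E.
Proof.
move=> [Lphi LY [u [uF u_phi u_Y]]].
have HY : forall x, Om x -> H (Y x) by case: LY.
have mphi := Lphi.1.
have mu' n : measurable_fun (Om : set (borel X)) (u n : borel X -> R).
  have [k [psi [l [psiC tl uE]]]] := uF n.
  have -> : u n = (fun x => psi (\row_i l i x)) by apply/funext.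
  by apply: measurable_funTS; exact: (bounded_measurable_cyl psiC tl).1.
have Hg n x : H (cyl_gradH gamma (u n) x).
  have [k [psi [l [psiC tl uE]]]] := uF n.
  have -> : u n = (fun x => psi (\row_i l i x)) by apply/funext.
  exact: cyl_gradH_cm.
have mg n : measurable_fun (Om : set (borel X))
    ((fun x => dot (cyl_gradH gamma (u n) x) (cyl_gradH gamma (u n) x)) : borel X -> R).
  have [k [psi [l [psiC tl uE]]]] := uF n.
  have -> : u n = (fun x => psi (\row_i l i x)) by apply/funext.
  by apply: measurable_funTS; exact: (bounded_measurable_cyl_grad Xsep gammaG psiC tl).1.
have mY := measurable_cm_sqr gammaG mOm LY.
have md n := measurable_cm_diff (uF n) LY.
set L := (\int[gamma]_(x in Om) _)%E.
have L0 : (0 <= L)%E by apply: integral_ge0 => x _; rewrite lee_fin sqr_ge0.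
have [J J0 JE] : exists2 J : R, 0 <= J &
    (\int[gamma]_(x in Om) ((nrm (Y x)) ^+ 2)%:E = J%:E)%E.
  have J0 : (0 <= \int[gamma]_(x in Om) ((nrm (Y x)) ^+ 2)%:E)%E.
    by apply: integral_ge0 => x _; rewrite lee_fin sqr_ge0.
  exists (fine (\int[gamma]_(x in Om) ((nrm (Y x)) ^+ 2)%:E)%E); first exact: fine_ge0.
  by rewrite fineK// ge0_fin_numE//; case: LY.
rewrite JE; apply/lee_addgt0Pr => r rp.
(* The total error is at most 3 e^2 + 2 e + e^3 + (2 e + e^2) J <= e (6 + 3 J). *)
pose e := Num.min 1 (r / (6 + 3 * J)).
have k0 : 0 < 6 + 3 * J by lra.
have e0 : 0 < e by rewrite lt_min ltr01 divr_gt0.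
have e1 : e <= 1 by rewrite ge_min lexx.
have er : e * (6 + 3 * J) <= r by rewrite -ler_pdivlMr// ge_min lexx orbT.
have e20 : (0 < (e ^+ 2)%:E)%E by rewrite lte_fin exprn_gt0.
have [n [an bn]] : exists n,
    (\int[gamma]_(x in Om) ((u n x - phi x) ^+ 2)%:E < (e ^+ 2)%:E)%E /\
    (\int[gamma]_(x in Om) ((nrm (cyl_gradH gamma (u n) x - Y x)) ^+ 2)%:E < (e ^+ 2)%:E)%E.
  have h1 := u_phi _ (open_ereal_lt' e20).
  have h2 := u_Y _ (open_ereal_lt' e20).
  by have [n [an bn]] := filter_ex (@filterI nat \oo _ _ _ h1 h2); exists n.
have [c hc] := poincare_cylindrical (uF n).
have ie0 : 0 <= 1 + e^-1 by rewrite addr_ge0// invr_ge0 ltW.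
have ee0 : 0 <= 1 + e by rewrite addr_ge0// ltW.
(* Young's inequality for phi - c = (u_n - c) - (u_n - phi). *)
have s1 : (L <= (1 + e^-1)%:E * \int[gamma]_(x in Om) ((u n x - phi x) ^+ 2)%:E +
    (1 + e)%:E * \int[gamma]_(x in Om) ((u n x - c) ^+ 2)%:E)%E.
  apply: le_trans (mean_minimizes c Lphi) _.
  apply: (@ge0_le_integral_comb _ (borel X)) => //.
  - by apply: measurable_funX; exact: measurable_funB.
  - by apply: measurable_funX; exact: measurable_funB.
  - by apply: measurable_funX; exact: measurable_funB.
  move=> x _; split; rewrite ?sqr_ge0//.
  have : 0 <= e^-1 * (u n x - phi x + e * (u n x - c)) ^+ 2.
    by rewrite mulr_ge0 ?sqr_ge0// invr_ge0 ltW.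
  move=> h; rewrite -subr_ge0; move: h; congr (0 <= _); field.
  by rewrite gt_eqF.
have s2 : (\int[gamma]_(x in Om) (dot (cyl_gradH gamma (u n) x) (cyl_gradH gamma (u n) x))%:E <=
    (1 + e^-1)%:E * \int[gamma]_(x in Om) (dot (cyl_gradH gamma (u n) x - Y x) (cyl_gradH gamma (u n) x - Y x))%:E +
    (1 + e)%:E * \int[gamma]_(x in Om) (dot (Y x) (Y x))%:E)%E.
  apply: (@ge0_le_integral_comb _ (borel X) R gamma Om mOm _ _ _ _ _ ie0 ee0 (mg n) (md n) mY).
  move=> x Ox; split; [exact: cm_dot_ge0|exact: cm_dot_ge0|exact: cm_dot_ge0|].
  by apply: cm_dot_young => //; exact: HY.
have JE' : (\int[gamma]_(x in Om) (dot (Y x) (Y x))%:E = J%:E)%E.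
  by rewrite -JE; apply: eq_integral => x _; rewrite cm_norm_sqr.
have bn' : (\int[gamma]_(x in Om) (dot (cyl_gradH gamma (u n) x - Y x) (cyl_gradH gamma (u n) x - Y x))%:E <= (e ^+ 2)%:E)%E.
  apply: le_trans (ltW bn); rewrite le_eqVlt; apply/orP; left; apply/eqP.
  by apply: eq_integral => x _; rewrite cm_norm_sqr.
have s3 : (\int[gamma]_(x in Om) ((u n x - c) ^+ 2)%:E <=
    ((1 + e^-1) * e ^+ 2 + (1 + e) * J)%:E)%E.
  apply: le_trans hc (le_trans s2 _); rewrite JE'; exact: lee_comb.
have s4 : (L <= ((1 + e^-1) * e ^+ 2 + (1 + e) * ((1 + e^-1) * e ^+ 2 + (1 + e) * J))%:E)%E.
  by apply: le_trans s1 _; apply: lee_comb => //; exact: ltW.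
apply: le_trans s4 _; rewrite -EFinD lee_fin.
have -> : (1 + e^-1) * e ^+ 2 = e ^+ 2 + e by field; rewrite gt_eqF.
have : e ^+ 2 <= e by rewrite expr2 ler_piMl// ltW.
have : e ^+ 3 <= e by rewrite exprS ler_piMr ?exprn_ile1// ltW.
have : e ^+ 2 * J <= e * J by rewrite ler_wpM2r// expr2 ler_piMl// ltW.
have -> : e ^+ 2 + e + (1 + e) * (e ^+ 2 + e + (1 + e) * J) =
  J + (3 * e ^+ 2 + 2 * e + e ^+ 3 + 2 * (e * J) + e ^+ 2 * J) by ring.
move: er; rewrite mulrDr mulrCA.
clear s1 s2 s3 an bn bn' hc JE JE' mg md mu' mphi mY HY Hg.
by move: (e ^+ 2 * J) (e ^+ 2) (e ^+ 3) (e * J) => *; lra.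
Qed.

End sobolev.

Theorem proposition3p3 (R : realType) (X : completeNormedModType R)
  (Xsep : separable X) (Xinf : infinite_dimensional X)
  (gamma : probability (borel X) R)
  (gammaG : centered_gaussian gamma) (gammaN : nondegenerate_measure gamma)
  (Omega : set X) (Omega0 : Omega !=set0) (Omega_open : open Omega)
  (Omega_convex : convex_set (Omega : set (convex_lmodType X)))
  (phi : X -> R) (phiW : W12 gamma Omega phi) :
  (\int[gamma]_(x in Omega) (`|phi x - mean gamma Omega phi| ^+ 2)%:E
   <= \int[gamma]_(x in Omega) ((cm_norm gamma (gradH gamma Omega phi x)) ^+ 2)%:E)%E.
Proof.
have graph : gradH_graph gamma Omega phi (gradH gamma Omega phi) by exact: getPex.
under eq_integral do rewrite real_normK ?num_real//.
have [g0|g0] := eqVneq (gamma Omega) 0%E.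
  rewrite null_set_integral//.
  - by apply: integral_ge0 => x _; rewrite lee_fin sqr_ge0.
  - exact: sub_sigma_algebra.
  - apply/measurable_EFinP; apply: measurable_funX; apply: measurable_funB => //.
    by have [[]] := graph.
exact: (poincare_graph Xsep gammaG gammaN Omega0 Omega_open (convex_set_points Omega_convex) g0).
Qed.
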